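(* Let $a>0$, $x>0$, $0<\theta,\psi<1$, let $k\geq 1$ be an odd integer, and let $\nu\in\mathbb{C}$ with $\Re(\nu)>0$. Then \begin{align*} &\left(\frac{a^2x}{4}\right)^{\frac{\nu}{2}+k+1}\sum_{n=1}^{\infty} n^{\nu/2}K_{\nu}(a\sqrt{nx})\sum_{d\mid n}d^k\sin(2\pi d\theta)\sin\left(\frac{2\pi n\psi}{d}\right)\\ &=-\frac{(-1)^{\frac{k+1}{2}}}{8(2\pi)^{-k-1}}\Gamma(\nu+k+1)\sum_{m,n\geq 0}\left\{\frac{(n+\psi)^k}{\left(\frac{16\pi^2}{a^2}\frac{(n+\psi)(m+\theta)}{x}+1\right)^{\nu+k+1}}-\frac{(n+1-\psi)^k}{\left(\frac{16\pi^2}{a^2}\frac{(n+1-\psi)(m+\theta)}{x}+1\right)^{\nu+k+1}}\right.\\ &\qquad\left.-\frac{(n+\psi)^k}{\left(\frac{16\pi^2}{a^2}\frac{(n+\psi)(m+1-\theta)}{x}+1\right)^{\nu+k+1}}+\frac{(n+1-\psi)^k}{\left(\frac{16\pi^2}{a^2}\frac{(n+1-\psi)(m+1-\theta)}{x}+1\right)^{\nu+k+1}}\right\}. \end{align*}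
   Context: $K_\nu$ denotes the modified Bessel function of the second kind of order $\nu$. The double sum runs over all pairs of non-negative integers $m,n$. *)

(* Defs.v *)
From Stdlib Require Import Reals Arith.
From Coquelicot Require Import Coquelicot.
Open Scope R_scope.

(* y^s for a positive real base y and complex exponent s (principal branch). *)
Definition cpowR (y : R) (s : C) : C :=
  (exp (Re s * ln y) * cos (Im s * ln y), exp (Re s * ln y) * sin (Im s * ln y)).

Definition Ccosh (z : C) : C :=
  (cosh (Re z) * cos (Im z), sinh (Re z) * sin (Im z)).

Definition CSeries (u : nat -> C) : C :=
  (Series (fun n => Re (u n)), Series (fun n => Im (u n))).

Definition CInt_0_inf (f : R -> C) : C :=
  (RInt_gen (fun t => Re (f t)) (at_right 0) (Rbar_locally p_infty),
   RInt_gen (fun t => Im (f t)) (at_right 0) (Rbar_locally p_infty)).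

Definition BesselK (nu : C) (z : R) : C :=
  CInt_0_inf (fun t => Cmult (RtoC (exp (- z * cosh t))) (Ccosh (Cmult nu (RtoC t)))).

Definition CGamma (s : C) : C :=
  CInt_0_inf (fun t => Cmult (cpowR t (Cminus s (RtoC 1))) (RtoC (exp (- t)))).

(* sum over the positive divisors d of n (n >= 1) of f d *)
Definition divsum (n : nat) (f : nat -> R) : R :=
  sum_f_R0 (fun i => if (n mod (S i) =? 0)%nat then f (S i) else 0) (pred n).

(* Main.v *)
Require Import Defs.
From Stdlib Require Import Reals Arith Lra Lia FunctionalExtensionality.
From Coquelicot Require Import Coquelicot.
Open Scope R_scope.

(** Put [X = a^2 x / 4] and [c = 4 pi^2 / X]. Writing [(X n)^(nu/2) K_nu(2 sqrt (X n))] as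
    [1/2 int t^(nu-1) e^(-t-X n/t) dt] and [Gamma(s) (c u v + 1)^(-s)] as
    [int t^(s-1) e^(-t(1+c u v)) dt], both sides become integrals against [t^(nu-1) e^(-t)], and the
    theorem reduces to an identity for each [tau = c t > 0] between the signed double series of
    [u^k e^(-tau u v)] and [sum_n c_n e^(-4 pi^2 n / tau)], where [c_n] is the divisor sum.
    That identity follows from two uses of the Lipschitz formula
    [sum_(n>=0) (n+phi)^k e^(-(n+phi)z) = k! sum_(e in Z) e^(2 pi i e phi) / (z + 2 pi i e)^(k+1)]:
    with [z = tau v] for the sum over [u], and, after interchanging the sums, with
    [z = 4 pi^2 e / tau + 2 pi i theta], [phi = 1] for the sum over [v]; as [k + 1] is even, the
    terms [v = m + theta] and [v = m + 1 - theta] together run through all poles.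
    For [k = 1] the interchange is legitimate only because these two terms are subtracted, which
    gains one power of decay. *)

(** * Series *)

(** The Lipschitz formula is obtained from Fourier coefficients in phi. Multiplying by e^(-2 pi i j
    phi) replaces z by z + 2 pi i j in the exponential series, whose coefficient then telescopes to
    the Euler integral for k! / (z + 2 pi i j)^(k+1). A uniqueness theorem for bounded functions,
    continuous at the point considered, turns equal coefficients into equal values. [Series] and
    [RInt_gen] are total functions, so each identity has to come with a convergence proof. Every
    interchange rests on a majorant that is a product of one factor for each index or variable; such
    products come from y^q e^(-y) <= q^q e^(-q), which trades exponential decay for any power. The
    condition Re nu > 0 is spent in two halves of size d = Re nu / 2: one makes the lattice sums
    converge, with exponent -(1 + d) in each index, the other leaves the weight t^(d-1) e^(-t),
    integrable at 0. In the theta-type identity k = 1 is the tight case, where decay of exponent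
    -3/2 remains for each index. *)

Lemma ex_series_dominated (a b : nat -> R) :
  (forall n, Rabs (a n) <= b n) -> ex_series b -> ex_series a.
Proof.
  intros H Hb. exact (ex_series_le (V := R_CompleteNormedModule) a b H Hb).
Qed.

Lemma Series_abs_le (a b : nat -> R) :
  (forall n, Rabs (a n) <= b n) -> ex_series b -> Rabs (Series a) <= Series b.
Proof.
  intros H Hb. eapply Rle_trans.
  - apply Series_Rabs. apply ex_series_dominated with b; auto.
    intros n; rewrite Rabs_Rabsolu; auto.
  - apply Series_le; auto. intros n; split; [apply Rabs_pos | auto].
Qed.

Lemma Series_pos (a : nat -> R) : (forall n, 0 <= a n) -> ex_series a -> 0 <= Series a.
Proof.
  intros H Ha. eapply Rle_trans; [apply Rabs_pos|].
  apply Series_abs_le with (b := a); auto.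
  intros n; rewrite Rabs_pos_eq; auto; lra.
Qed.

Lemma Series_tail_le (a b : nat -> R) (N : nat) :
  (forall n, Rabs (a n) <= b n) -> ex_series b ->
  Rabs (Series a - sum_f_R0 a N) <= Series b - sum_f_R0 b N.
Proof.
  intros H Hb.
  assert (Ha : ex_series a) by (eapply ex_series_dominated; eauto).
  rewrite (Series_incr_n a (S N)), (Series_incr_n b (S N)); auto; try lia.
  simpl pred.
  replace (sum_f_R0 a N + Series (fun k => a (S N + k)%nat) - sum_f_R0 a N)
    with (Series (fun k => a (S N + k)%nat)) by ring.
  replace (sum_f_R0 b N + Series (fun k => b (S N + k)%nat) - sum_f_R0 b N)
    with (Series (fun k => b (S N + k)%nat)) by ring.
  apply Series_abs_le; [intros; apply H|].
  apply (ex_series_incr_n b (S N)); auto.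
Qed.

Lemma is_series_of_remainder (a r : nat -> R) (l : R) :
  (forall n, Rabs (sum_f_R0 a n - l) <= r n) -> is_lim_seq r 0 -> is_series a l.
Proof.
  intros H Hr. apply is_series_Reals. intros eps He.
  apply is_lim_seq_spec in Hr.
  destruct (Hr (mkposreal eps He)) as [N HN]. exists N. intros n Hn.
  specialize (HN n Hn). simpl in HN. rewrite Rminus_0_r in HN.
  unfold Rdist. eapply Rle_lt_trans; [apply H|].
  eapply Rle_lt_trans; [apply Rle_abs| exact HN].
Qed.

Lemma remainder_lim (b : nat -> R) :
  ex_series b -> is_lim_seq (fun N => Series b - sum_f_R0 b N) 0.
Proof.
  intros Hb. apply Series_correct in Hb.
  assert (H : is_lim_seq (sum_n b) (Series b)) by exact Hb.
  evar_last.
  - apply is_lim_seq_minus'; [apply is_lim_seq_const|].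
    eapply is_lim_seq_ext; [intros n; apply sum_n_Reals | exact H].
  - simpl. f_equal. ring.
Qed.

Lemma is_series_finite_sum (U : nat -> nat -> R) (l : nat -> R) (N : nat) :
  (forall i, is_series (U i) (l i)) ->
  is_series (fun j => sum_f_R0 (fun i => U i j) N) (sum_f_R0 l N).
Proof.
  intros H. induction N as [|N IH]; simpl; [apply H|].
  exact (is_series_plus _ _ _ _ IH (H (S N))).
Qed.

(** The product majorant controls the error directly: what the first rows up to N miss is at most
    the tail of [A] after N times the sum of [B], and this tends to 0. *)
Lemma is_series_swap (A B : nat -> R) (U : nat -> nat -> R) :
  (forall i j, Rabs (U i j) <= A i * B j) -> (forall i, 0 <= A i) -> (forall j, 0 <= B j) ->
  ex_series A -> ex_series B ->
  is_series (fun i => Series (fun j => U i j)) (Series (fun j => Series (fun i => U i j))).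
Proof.
  intros H HA HB eA eB.
  assert (eAj : forall j, ex_series (fun i => A i * B j)).
  { intros j. apply ex_series_scal_r; auto. }
  assert (eBi : forall i, ex_series (fun j => A i * B j)).
  { intros j. apply (ex_series_scal_l (V := R_NormedModule) (A j) B); auto. }
  assert (eU1 : forall i, ex_series (fun j => U i j)).
  { intros i. apply ex_series_dominated with (2 := eBi i). intros; apply H. }
  apply is_series_of_remainder with (r := fun N => (Series A - sum_f_R0 A N) * Series B).
  2:{ replace (Finite 0) with (Rbar_mult 0 (Series B)) by (simpl; f_equal; ring).
      apply is_lim_seq_scal_r. apply remainder_lim; auto. }
  intros N.
  rewrite <- (is_series_unique _ _ (is_series_finite_sum U _ N (fun i => Series_correct _ (eU1 i)))).
  rewrite <- Series_minus.
  - rewrite <- Series_scal_l. apply Series_abs_le.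
    2: apply (ex_series_scal_l (V := R_NormedModule)); auto.
    intros j. rewrite Rabs_minus_sym.
    eapply Rle_trans.
    + apply Series_tail_le with (b := fun i => A i * B j); auto.
    + rewrite Series_scal_r, <- (scal_sum A N (B j)). lra.
  - eexists. apply is_series_finite_sum. intros i. apply Series_correct; auto.
  - apply ex_series_dominated with (b := fun j => Series A * B j).
    + intros j. rewrite <- Series_scal_r. apply Series_abs_le; auto.
    + apply (ex_series_scal_l (V := R_NormedModule)); auto.
Qed.

Lemma Series_swap (A B : nat -> R) (U : nat -> nat -> R) :
  (forall i j, Rabs (U i j) <= A i * B j) -> (forall i, 0 <= A i) -> (forall j, 0 <= B j) ->
  ex_series A -> ex_series B ->
  Series (fun i => Series (fun j => U i j)) = Series (fun j => Series (fun i => U i j)).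
Proof.
  intros. apply is_series_unique. eapply is_series_swap; eauto.
Qed.

Lemma is_series_finite_support (a : nat -> R) (N : nat) :
  (forall n, (N < n)%nat -> a n = 0) -> is_series a (sum_f_R0 a N).
Proof.
  intros H. apply is_series_of_remainder with (r := fun n => Rabs (sum_f_R0 a n - sum_f_R0 a N)).
  - intros; lra.
  - apply is_lim_seq_ext_loc with (u := fun _ => 0); [|apply is_lim_seq_const].
    exists N. intros n Hn. replace (sum_f_R0 a n) with (sum_f_R0 a N).
    + rewrite Rminus_diag, Rabs_R0; auto.
    + induction n as [|n IH].
      * f_equal; lia.
      * destruct (Nat.eq_dec N (S n)) as [->|]; auto.
        simpl. rewrite H by lia. rewrite Rplus_0_r. apply IH. lia.
Qed.

(** The partial sum of the sparse series up to index N consists of the first (N + 1) / D terms of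
    the dense one, with integer division. *)
Lemma Series_multiples (h : nat -> R) (D : nat) :
  (0 < D)%nat ->
  ex_series (fun n => if (S n mod D =? 0)%nat then h (S n) else 0) ->
  Series (fun n => if (S n mod D =? 0)%nat then h (S n) else 0) =
  Series (fun e => h (D * S e)%nat).
Proof.
  intros HD Hex. set (v := fun n => if (S n mod D =? 0)%nat then h (S n) else 0) in *.
  set (w := fun e => h (D * S e)%nat).
  (* [G m] is the sum of the first m terms: [sum_f_R0] always contains the term of index 0, so the
     empty sum needs its own case. *)
  set (G := fun m => match m with O => 0 | S p => sum_f_R0 w p end).
  assert (HG : forall m, G (S m) = G m + w m).
  { intros [|m]; simpl; unfold G; simpl; ring. }
  assert (key : forall N, sum_f_R0 v N = G (S N / D)%nat).
  { assert (step : forall N, G (S N / D)%nat = G (N / D)%nat + v N).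
    { intros N. unfold v. 
      pose proof (Nat.div_mod_eq (S N) D) as e1. pose proof (Nat.div_mod_eq N D) as e2.
      pose proof (Nat.mod_upper_bound (S N) D ltac:(lia)) as b1.
      pose proof (Nat.mod_upper_bound N D ltac:(lia)) as b2.
      destruct (Nat.eqb_spec (S N mod D) 0) as [E|E].
      - assert (S N / D = S (N / D))%nat as Hq by nia.
        rewrite Hq, HG. unfold w. f_equal. f_equal. nia.
      - assert (S N / D = N / D)%nat as -> by nia. ring. }
    induction N as [|N IH].
    - rewrite step. rewrite Nat.div_0_l by lia. simpl. unfold G. ring.
    - simpl sum_f_R0. rewrite IH. rewrite (step (S N)). auto. }
  symmetry. apply is_series_unique.
  assert (Hl : is_lim_seq (sum_n v) (Series v)) by exact (Series_correct _ Hex).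
  (* At the indices D (E + 1) - 1 the partial sums of [v] are exactly those of [w], so the known
     limit is read along this subsequence. *)
  assert (Hs : is_lim_seq (fun E => sum_n v (D * S E - 1)) (Series v)).
  { apply (is_lim_seq_subseq _ _ (fun E => (D * S E - 1)%nat)); auto.
    apply eventually_subseq. intros n. nia. }
  apply (is_lim_seq_ext _ (sum_n w)) in Hs; auto.
  intros n. rewrite !sum_n_Reals, key.
  replace (S (D * S n - 1) / D)%nat with (S n); auto.
  replace (S (D * S n - 1)) with (S n * D)%nat by nia.
  rewrite Nat.div_mul; lia.
Qed.

(* Regrouping by divisors is an interchange of summations for
   [v d n = f d n] if [d] divides [n], and [0] otherwise. *)
Lemma Series_divsum (A B : nat -> R) (f : nat -> nat -> R) :
  (forall d n, (d <= n)%nat -> Rabs (f (S d) (S n)) <= A d * B n) ->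
  (forall d, 0 <= A d) -> (forall n, 0 <= B n) -> ex_series A -> ex_series B ->
  Series (fun n => divsum (S n) (fun d => f d (S n))) =
  Series (fun d => Series (fun e => f (S d) (S d * S e)%nat)).
Proof.
  intros H HA HB eA eB.
  set (v := fun n d => if (S n mod S d =? 0)%nat then f (S d) (S n) else 0).
  assert (Hv : forall n d, Rabs (v n d) <= B n * A d).
  { intros n d. unfold v. destruct (Nat.eqb_spec (S n mod S d) 0) as [E|E].
    - rewrite Rmult_comm. apply H. 
      pose proof (Nat.div_mod_eq (S n) (S d)). destruct (S n / S d)%nat; nia.
    - rewrite Rabs_R0. apply Rmult_le_pos; auto. }
  transitivity (Series (fun n => Series (fun d => v n d))).
  - apply Series_ext. intros n. symmetry. apply is_series_unique.
    unfold divsum. simpl pred. apply (is_series_finite_support (v n)).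
    intros d Hd. unfold v. rewrite Nat.mod_small by lia. auto.
  - rewrite (Series_swap B A); auto. apply Series_ext. intros d.
    apply (Series_multiples (f (S d)) (S d)); [lia|].
    apply ex_series_dominated with (b := fun n => B n * A d); [intros; apply Hv|].
    apply ex_series_scal_r; auto.
Qed.

(** The right side is the maximum of y^q e^(-y), taken at y = q; the inequality is ln r <= r - 1 at
    r = y / q. It is the source of all power bounds for exponentials below. *)
Lemma Rpower_exp_le (q y : R) : 0 < q -> 0 < y ->
  Rpower y q * exp (- y) <= exp (q * ln q - q).
Proof.
  intros Hq Hy. unfold Rpower. rewrite <- exp_plus.
  assert (ln (y / q) <= y / q - 1).
  { assert (Hyq : 0 < y / q) by (apply Rdiv_lt_0_compat; auto).
    pose proof (exp_ineq1_le (ln (y / q))) as E. rewrite exp_ln in E by auto. lra. }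
  rewrite ln_div in H by auto.
  assert (q * (ln y - ln q) <= q * (y / q - 1)) by (apply Rmult_le_compat_l; lra).
  replace (q * (y / q - 1)) with (y - q) in H0 by (field; lra).
  assert (E : q * ln y + - y <= q * ln q - q) by lra.
  destruct E as [E|E]; [left; apply exp_increasing; auto | right; rewrite E; auto].
Qed.

(** Comparison with a telescoping series: for g(n) = (n + 1)^(-d), the bound ln (x + 1) - ln x >= 1
    / (x + 1) makes g(n) - g(n + 1) at least d (n + 2)^(-1-d). *)
Lemma ex_series_zeta (d : R) : 0 < d -> ex_series (fun n => Rpower (INR n + 1) (- (1 + d))).
Proof.
  intros Hd.
  set (g := fun n => Rpower (INR n + 1) (- d)).
  assert (Hn : forall n, 0 < INR n + 1) by (intros n; pose proof (pos_INR n); lra).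
  assert (Hlim : is_lim_seq g 0).
  { unfold g, Rpower.
    apply (is_lim_seq_ext (fun n => exp (- d * ln (INR n + 1)))); [auto|].
    apply (is_lim_comp_seq exp (fun n => - d * ln (INR n + 1)) m_infty 0).
    - apply is_lim_exp_m.
    - exists 0%nat; intros; discriminate.
    - replace m_infty with (Rbar_mult (- d) p_infty).
      + apply is_lim_seq_scal_l.
        apply (is_lim_comp_seq ln (fun n => INR n + 1) p_infty p_infty).
        * apply is_lim_ln_p.
        * exists 0%nat; intros; discriminate.
        * apply (is_lim_seq_ext (fun n => INR (S n))); [intros; apply S_INR|].
          apply (is_lim_seq_incr_1 INR). apply is_lim_seq_INR.
      + simpl. destruct (Rle_dec 0 (-d)); [exfalso; lra|].
        destruct (Rle_dec 0 (- d)); auto; lra. }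
  assert (Htel : is_series (fun n => g n - g (S n)) (g 0%nat)).
  { apply is_series_of_remainder with (r := fun n => g (S n)).
    - intros n. assert (E : sum_f_R0 (fun n => g n - g (S n)) n = g 0%nat - g (S n)).
      { induction n as [|n IH]; simpl; [auto|]. rewrite IH. ring. }
      rewrite E. replace (g 0%nat - g (S n) - g 0%nat) with (- g (S n)) by ring.
      rewrite Rabs_Ropp, Rabs_pos_eq; [lra|]. left; apply exp_pos.
    - apply (is_lim_seq_incr_1 g). auto. }
  assert (bound : forall n, Rabs (Rpower (INR (S n) + 1) (- (1 + d))) <=
            (1 + d) / d * (g n - g (S n))).
  { intros n. set (x := INR (S n)). assert (Hx : 1 <= x).
    { unfold x. rewrite S_INR. pose proof (pos_INR n); lra. }
    assert (Ex : INR n + 1 = x) by (unfold x; rewrite S_INR; ring).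
    unfold g. rewrite Ex. fold x.
    rewrite Rabs_pos_eq by (left; apply exp_pos).
    assert (E1 : Rpower (x + 1) (- (1 + d)) = Rpower (x + 1) (- d) / (x + 1)).
    { replace (- (1 + d)) with (- d + Ropp 1) by ring. rewrite Rpower_plus.
      rewrite (Rpower_Ropp (x + 1) 1), Rpower_1 by lra. field. lra. }
    assert (E2 : Rpower x (- d) >= Rpower (x + 1) (- d) * exp (d / (x + 1))).
    { unfold Rpower. rewrite <- exp_plus. apply Rle_ge.
      assert (L : ln x <= ln (x + 1) + (- / (x + 1))).
      { assert (ln (x / (x + 1)) <= x / (x + 1) - 1).
        { assert (0 < x / (x + 1)) by (apply Rdiv_lt_0_compat; lra).
          pose proof (exp_ineq1_le (ln (x / (x + 1)))) as E. rewrite exp_ln in E by auto. lra. }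
        rewrite ln_div in H by lra.
        replace (x / (x + 1) - 1) with (- / (x + 1)) in H by (field; lra). lra. }
      assert (L2 : - d * ln (x + 1) + d / (x + 1) <= - d * ln x).
      { apply (Rmult_le_compat_l d) in L; [|lra]. unfold Rdiv. lra. }
      destruct L2 as [L2|L2]; [left; apply exp_increasing; auto | right; rewrite L2; auto]. }
    pose proof (exp_ineq1_le (d / (x + 1))) as E3.
    assert (P : 0 < Rpower (x + 1) (- d)) by apply exp_pos.
    set (p := Rpower (x + 1) (- d)) in *.
    rewrite E1.
    assert (E4 : p * (d / (x + 1)) <= Rpower x (- d) - p).
    { assert (p * (1 + d / (x + 1)) <= p * exp (d / (x + 1))) by (apply Rmult_le_compat_l; lra). lra. }
    apply Rle_trans with ((1 + d) / d * (p * (d / (x + 1)))).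
    - replace ((1 + d) / d * (p * (d / (x + 1)))) with ((1 + d) * (p / (x + 1))) by (field; lra).
      assert (0 < p / (x + 1)) by (apply Rdiv_lt_0_compat; lra). nra.
    - apply Rmult_le_compat_l; auto. apply Rlt_le, Rdiv_lt_0_compat; lra. }
  apply ex_series_incr_1.
  apply ex_series_dominated with (1 := bound).
  apply (ex_series_scal_l (V := R_NormedModule)). eexists; apply Htel.
Qed.

(** Half of the exponent absorbs the polynomial factor, the other half leaves a geometric series. *)
Lemma ex_series_pow_exp (k : nat) (c y : R) : 0 <= c -> 0 < y ->
  ex_series (fun n => (INR n + c) ^ k * exp (- (INR n * y))).
Proof.
  intros Hc Hy.
  set (q := exp (- (y / 2))).
  assert (Hq : 0 < q < 1).
  { split; [apply exp_pos|]. unfold q. rewrite <- exp_0. apply exp_increasing. lra. }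
  (* One power more than k, so that [Rpower_exp_le] applies also for k = 0; the surplus factor t is
     removed by / t <= / (y / 2). *)
  set (K := INR k + 1).
  assert (HK : 0 < K) by (unfold K; pose proof (pos_INR k); lra).
  set (M := exp (K * ln K - K)).
  apply ex_series_dominated with
    (b := fun n => exp (c * y / 2 + y / 2) * / (y / 2) ^ k * M * (1 + / (y/2)) * q ^ n).
  2:{ apply (ex_series_scal_l (V := R_NormedModule)). apply ex_series_geom.
      rewrite Rabs_pos_eq; lra. }
  intros n. pose proof (pos_INR n) as Hn.
  rewrite Rabs_pos_eq by (apply Rmult_le_pos; [apply pow_le; lra | left; apply exp_pos]).
  assert (Eq : q ^ n = exp (- (INR n * (y / 2)))).
  { unfold q. induction n as [|n IH].
    - simpl. rewrite Rmult_0_l, Ropp_0, exp_0; auto.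
    - rewrite <- tech_pow_Rmult, IH by apply pos_INR. rewrite <- exp_plus. f_equal. rewrite S_INR. lra. }
  (* The summand 1 keeps t at least y / 2, even for n = 0 and c = 0. *)
  set (t := (INR n + c + 1) * (y / 2)).
  assert (Ht : 0 < t) by (unfold t; nra).
  pose proof (Rpower_exp_le K t HK Ht) as B. fold M in B.
  unfold K in B. rewrite Rpower_plus, Rpower_pow, Rpower_1 in B by auto.
  assert (E : exp (- (INR n * y)) = exp (- (INR n * (y / 2))) * (exp (c * y / 2 + y / 2) * exp (- t))).
  { rewrite <- !exp_plus. f_equal. unfold t. lra. }
  rewrite E, Eq.
  set (e1 := exp (- (INR n * (y / 2)))) in *. set (e2 := exp (c * y / 2 + y / 2)) in *.
  assert (P1 : 0 < e1) by apply exp_pos. assert (P2 : 0 < e2) by apply exp_pos.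
  assert (PM : 0 < M) by apply exp_pos.
  assert (P3 : 0 < exp (- t)) by apply exp_pos.
  assert (Hy2 : 0 < (y / 2) ^ k) by (apply pow_lt; lra).
  assert (Hit : / t <= / (y / 2) ).
  { apply Rinv_le_contravar; [lra|]. unfold t. nra. }
  assert (Htk : t ^ k * exp (- t) <= M * (1 + / (y/2))).
  { apply Rle_trans with (M * / t).
    - apply Rmult_le_reg_r with t; auto. replace (M * / t * t) with M by (field; lra). lra.
    - apply Rmult_le_compat_l; lra. }
  assert (Hbase : (INR n + c) ^ k <= / (y / 2) ^ k * t ^ k).
  { unfold t. rewrite Rpow_mult_distr. 
    replace (/ (y / 2) ^ k * ((INR n + c + 1) ^ k * (y / 2) ^ k)) with ((INR n + c + 1) ^ k) by (field; lra).
    apply pow_incr; lra. }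
  apply Rle_trans with (/ (y / 2) ^ k * t ^ k * (e1 * (e2 * exp (- t)))).
  - apply Rmult_le_compat_r; auto. left. repeat apply Rmult_lt_0_compat; auto.
  - replace (/ (y / 2) ^ k * t ^ k * (e1 * (e2 * exp (- t)))) with
      (e2 * / (y / 2) ^ k * e1 * (t ^ k * exp (- t))) by ring.
    replace (e2 * / (y / 2) ^ k * M * (1 + / (y / 2)) * e1) with
      (e2 * / (y / 2) ^ k * e1 * (M * (1 + / (y / 2)))) by ring.
    apply Rmult_le_compat_l; auto.
    left. repeat apply Rmult_lt_0_compat; auto. apply Rinv_0_lt_compat; auto.
Qed.

(** * Improper integrals and series of functions *)

Lemma is_RInt_sum_f_R0 (f : nat -> R -> R) (l : nat -> R) (a b : R) (N : nat) :
  (forall n, is_RInt (f n) a b (l n)) ->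
  is_RInt (fun t => sum_f_R0 (fun n => f n t) N) a b (sum_f_R0 l N).
Proof.
  intros H. induction N as [|N IH]; simpl; [apply H|].
  exact (is_RInt_plus _ _ _ _ _ _ IH (H (S N))).
Qed.

Lemma is_RInt_Series (f : nat -> R -> R) (l M : nat -> R) (a b : R) :
  a < b -> (forall n, is_RInt (f n) a b (l n)) ->
  (forall n t, a < t < b -> Rabs (f n t) <= M n) -> ex_series M ->
  ex_series l /\ is_RInt (fun t => Series (fun n => f n t)) a b (Series l).
Proof.
  intros Hab Hf HM eM.
  (* [filterlim_RInt] asks for uniform convergence on the whole line, whereas the majorant holds
     only between a and b; hence the functions are cut to 0 outside. *)
  set (restr := fun (u : R -> R) t =>
    if Rlt_dec a t then if Rlt_dec t b then u t else 0 else 0).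
  assert (restrE : forall u t, a < t < b -> restr u t = u t).
  { intros u t Ht. unfold restr.
    destruct (Rlt_dec a t); [|lra]. destruct (Rlt_dec t b); lra. }
  set (g := restr (fun t => Series (fun n => f n t))).
  destruct (filterlim_RInt (V := R_CompleteNormedModule)
    (fun N => restr (fun t => sum_f_R0 (fun n => f n t) N)) a b eventually _
    g (fun N => sum_f_R0 l N)) as [If [H1 H2]].
  - intros N. apply (is_RInt_ext (fun t => sum_f_R0 (fun n => f n t) N)).
    + rewrite Rmin_left, Rmax_right by lra. intros t Ht. rewrite restrE; auto.
    + apply is_RInt_sum_f_R0; auto.
  - apply filterlim_locally. intros eps.
    pose proof (remainder_lim M eM) as HR. apply is_lim_seq_spec in HR.
    destruct (HR eps) as [N HN]. exists N. intros n Hn t.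
    specialize (HN n Hn). simpl in HN. rewrite Rminus_0_r in HN.
    apply Rle_lt_trans with (2 := HN).
    unfold abs, minus, plus, opp; simpl.
    unfold g, restr. destruct (Rlt_dec a t); [destruct (Rlt_dec t b)|].
    + eapply Rle_trans; [|apply Rle_abs].
      change (Rabs (sum_f_R0 (fun m => f m t) n + - Series (fun m => f m t)) <= Series M - sum_f_R0 M n).
      fold (Rminus (sum_f_R0 (fun m => f m t) n) (Series (fun m => f m t))).
      rewrite Rabs_minus_sym. apply Series_tail_le; auto.
    + replace (0 + - 0) with 0 by ring. rewrite Rabs_R0. apply Rabs_pos.
    + replace (0 + - 0) with 0 by ring. rewrite Rabs_R0. apply Rabs_pos.
  - assert (Hl : is_series l If).
    { apply (filterlim_ext (fun N => sum_f_R0 l N)); [|exact H1].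
      intros n. symmetry. apply sum_n_Reals. }
    split; [exists If; auto|].
    rewrite (is_series_unique _ _ Hl).
    apply (is_RInt_ext g); auto.
    rewrite Rmin_left, Rmax_right by lra. intros t Ht. unfold g. apply restrE; auto.
Qed.

Lemma RInt_abs_le (f g : R -> R) (a b : R) : a <= b -> ex_RInt f a b -> ex_RInt g a b ->
  (forall t, a < t < b -> Rabs (f t) <= g t) -> Rabs (RInt f a b) <= RInt g a b.
Proof.
  intros Hab Hf Hg H. apply Rabs_le. split.
  - rewrite <- (RInt_opp (V := R_CompleteNormedModule) g) by auto.
    apply RInt_le; auto. { apply (ex_RInt_opp (V := R_NormedModule)); auto. }
    intros t Ht. unfold opp; simpl. specialize (H t Ht). apply Rabs_le_between in H. lra.
  - apply RInt_le; auto.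
    intros t Ht. specialize (H t Ht). apply Rabs_le_between in H. lra.
Qed.

(* [RInt_gen f (at_right 0) (Rbar_locally p_infty)] converges to [l], with both
   ends controlled by one parameter. *)
Definition improper (f : R -> R) (l : R) : Prop :=
  (forall a b, 0 < a < b -> ex_RInt f a b) /\
  forall eps, 0 < eps -> exists delta, 0 < delta /\
    forall a b, 0 < a < delta -> / delta < b -> a < b -> Rabs (RInt f a b - l) < eps.

(** The role of a dominating function in L^1(0, oo). [G] is only an upper bound for the integral, so
    that no majorant has to be integrated exactly. *)
Definition integrable_majorant (g : R -> R) (G : R) : Prop :=
  (forall t, 0 < t -> 0 <= g t /\ continuous g t) /\
  forall a b, 0 < a < b -> RInt g a b <= G.

Lemma improper_RInt_gen (f : R -> R) (l : R) : improper f l ->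
  RInt_gen f (at_right 0) (Rbar_locally p_infty) = l.
Proof.
  intros [Hex H]. apply is_RInt_gen_unique.
  intros P [eps HP].
  destruct (H eps (cond_pos eps)) as [d [Hd Hlim]].
  (* Cutting at 1 on both sides ensures a < b, which [improper] presupposes. *)
  apply (Filter_prod _ _ _ (fun a => 0 < a < Rmin d 1) (fun b => Rmax (/ d) 1 < b)).
  - exists (mkposreal (Rmin d 1) (Rmin_pos _ _ Hd Rlt_0_1)). intros y Hy Hy0. split; auto.
    unfold ball in Hy; simpl in Hy. unfold AbsRing_ball, abs, minus, plus, opp in Hy; simpl in Hy.
    rewrite Ropp_0, Rplus_0_r in Hy. rewrite Rabs_pos_eq in Hy; lra.
  - exists (Rmax (/ d) 1). auto.
  - intros a b [Ha1 Ha2] Hb. simpl.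
    pose proof (Rmin_l d 1). pose proof (Rmin_r d 1).
    pose proof (Rmax_l (/ d) 1). pose proof (Rmax_r (/ d) 1).
    exists (RInt f a b). split.
    + apply (RInt_correct (V := R_CompleteNormedModule)). apply Hex; lra.
    + apply HP. apply Hlim; lra.
Qed.

Lemma improper_ext (f g : R -> R) (l : R) :
  (forall t, 0 < t -> f t = g t) -> improper f l -> improper g l.
Proof.
  intros E [H1 H2]. split.
  - intros a b Hab. apply (ex_RInt_ext f); auto.
    rewrite Rmin_left, Rmax_right by lra. intros; apply E; lra.
  - intros eps He. destruct (H2 eps He) as [d [Hd H]]. exists d; split; auto.
    intros a b Ha Hb Hab. rewrite <- (RInt_ext f g); auto.
    rewrite Rmin_left, Rmax_right by lra. intros; apply E; lra.
Qed.

Lemma improper_scal (f : R -> R) (l c : R) :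
  improper f l -> improper (fun t => c * f t) (c * l).
Proof.
  intros [H1 H2]. split.
  - intros a b Hab. apply (ex_RInt_scal (V := R_NormedModule)); auto.
  - intros eps He.
    assert (Hc : 0 < Rabs c + 1) by (pose proof (Rabs_pos c); lra).
    destruct (H2 (eps / (Rabs c + 1)) (Rdiv_lt_0_compat _ _ He Hc)) as [d [Hd H]].
    exists d; split; auto. intros a b Ha Hb Hab.
    rewrite (RInt_scal (V := R_CompleteNormedModule) f) by (apply H1; lra).
    unfold scal; simpl; unfold mult; simpl.
    rewrite <- Rmult_minus_distr_l, Rabs_mult.
    specialize (H a b Ha Hb Hab).
    apply Rle_lt_trans with ((Rabs c + 1) * Rabs (RInt f a b - l)).
    + apply Rmult_le_compat_r; [apply Rabs_pos|lra].
    + apply (Rmult_lt_compat_l _ _ _ Hc) in H.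
      replace ((Rabs c + 1) * (eps / (Rabs c + 1))) with eps in H by (field; lra). auto.
Qed.

Lemma improper_plus (f g : R -> R) (l m : R) :
  improper f l -> improper g m -> improper (fun t => f t + g t) (l + m).
Proof.
  intros [H1 H2] [K1 K2]. split.
  - intros a b Hab. apply (ex_RInt_plus (V := R_NormedModule)); auto.
  - intros eps He.
    destruct (H2 (eps / 2)) as [d [Hd H]]; [lra|].
    destruct (K2 (eps / 2)) as [d' [Hd' K]]; [lra|].
    exists (Rmin d d'). split; [apply Rmin_pos; auto|].
    intros a b Ha Hb Hab.
    pose proof (Rmin_l d d'). pose proof (Rmin_r d d').
    assert (/ d <= / Rmin d d') by (apply Rinv_le_contravar; auto; apply Rmin_pos; auto).
    assert (/ d' <= / Rmin d d') by (apply Rinv_le_contravar; auto; apply Rmin_pos; auto).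
    rewrite (RInt_plus (V := R_CompleteNormedModule) f g) by (first [apply H1 | apply K1]; lra).
    unfold plus; simpl.
    replace (RInt f a b + RInt g a b - (l + m)) with ((RInt f a b - l) + (RInt g a b - m)) by ring.
    eapply Rle_lt_trans; [apply Rabs_triang|].
    assert (Rabs (RInt f a b - l) < eps / 2) by (apply H; lra).
    assert (Rabs (RInt g a b - m) < eps / 2) by (apply K; lra). lra.
Qed.

Lemma improper_minus (f g : R -> R) (l m : R) :
  improper f l -> improper g m -> improper (fun t => f t - g t) (l - m).
Proof.
  intros Hf Hg. apply (improper_scal _ _ (-1)) in Hg.
  pose proof (improper_plus _ _ _ _ Hf Hg) as H.
  replace (l - m) with (l + -1 * m) by ring.
  eapply improper_ext; [|exact H]. intros; simpl; ring.
Qed.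

Lemma improper_sum_f_R0 (f : nat -> R -> R) (l : nat -> R) (N : nat) :
  (forall n, improper (f n) (l n)) ->
  improper (fun t => sum_f_R0 (fun n => f n t) N) (sum_f_R0 l N).
Proof.
  intros H. induction N as [|N IH]; simpl; [apply H|].
  apply improper_plus; auto.
Qed.

Lemma improper_dilate (f : R -> R) (l c : R) : 0 < c ->
  improper f l -> improper (fun t => f (c * t)) (l / c).
Proof.
  intros Hc [H1 H2].
  assert (HI : forall a b, 0 < a < b -> is_RInt (fun t => c * f (c * t)) a b (RInt f (c * a) (c * b))).
  { intros a b Hab.
    pose proof (is_RInt_comp_lin (V := R_NormedModule) f c 0 a b (RInt f (c * a) (c * b))) as H.
    rewrite !Rplus_0_r in H.
    apply (is_RInt_ext (fun t => scal c (f (c * t + 0)))); [|apply H].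
    - intros t _. rewrite Rplus_0_r. reflexivity.
    - apply (RInt_correct (V := R_CompleteNormedModule)). apply H1. nra. }
  assert (K : improper (fun t => c * f (c * t)) l).
  { split.
    - intros a b Hab. eexists. apply HI; auto.
    - intros eps He. destruct (H2 eps He) as [d [Hd H]].
      (* The bound d / c gives c a < d, and the bound d c gives c b > 1 / d. *)
      exists (Rmin (d / c) (d * c)).
      assert (P : 0 < Rmin (d / c) (d * c)).
      { apply Rmin_pos; [apply Rdiv_lt_0_compat | apply Rmult_lt_0_compat]; auto. }
      split; auto. intros a b Ha Hb Hab.
      rewrite (is_RInt_unique _ _ _ _ (HI a b ltac:(lra))).
      apply H.
      + pose proof (Rmin_l (d / c) (d * c)). split; [apply Rmult_lt_0_compat; lra|].
        apply Rlt_le_trans with (c * (d / c)); [apply Rmult_lt_compat_l; lra|].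
        right; field; lra.
      + assert (/ (d * c) <= / Rmin (d / c) (d * c)) by (apply Rinv_le_contravar; auto; apply Rmin_r).
        apply Rle_lt_trans with (c * / (d * c)); [right; field; lra|].
        apply Rmult_lt_compat_l; lra.
      + apply Rmult_lt_compat_l; lra. }
  apply (improper_scal _ _ (/ c)) in K.
  replace (l / c) with (/ c * l) by (field; lra).
  eapply improper_ext; [|exact K]. intros t Ht. simpl. field. lra.
Qed.

Lemma continuous_ex_RInt_pos (f : R -> R) : (forall t, 0 < t -> continuous f t) ->
  forall a b, 0 < a < b -> ex_RInt f a b.
Proof.
  intros H a b Hab. apply (ex_RInt_continuous (V := R_CompleteNormedModule)).
  rewrite Rmin_left, Rmax_right by lra. intros t Ht. apply H. lra.
Qed.

Lemma majorant_ex_RInt (g : R -> R) (G : R) : integrable_majorant g G ->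
  forall a b, 0 < a < b -> ex_RInt g a b.
Proof. intros [H _]. apply continuous_ex_RInt_pos. intros t Ht; apply H; auto. Qed.

Lemma majorant_nonneg (g : R -> R) (G : R) : integrable_majorant g G -> 0 <= G.
Proof.
  intros Hg. pose proof (majorant_ex_RInt g G Hg 1 2 ltac:(lra)). destruct Hg as [Hg K].
  apply Rle_trans with (RInt g 1 2); [|apply K; lra].
  apply RInt_ge_0; auto; try lra. intros t Ht; apply Hg; lra.
Qed.

Lemma majorant_bounded (g : R -> R) (G a b : R) : integrable_majorant g G -> 0 < a < b ->
  exists K, forall t, a < t < b -> g t <= K.
Proof.
  intros [H _] Hab.
  destruct (continuity_ab_maj g a b) as [x [Hx _]]; [lra| |].
  - intros c Hc. apply continuity_pt_filterlim. apply H. lra.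
  - exists (g x). intros t Ht. apply Hx. lra.
Qed.

Lemma improper_abs_le (f g : R -> R) (l G : R) : improper f l -> integrable_majorant g G ->
  (forall t, 0 < t -> Rabs (f t) <= g t) -> Rabs l <= G.
Proof.
  intros [H1 H2] Hg H. apply le_epsilon. intros eps He.
  destruct (H2 eps He) as [d [Hd Hl]].
  set (a := Rmin (d / 2) 1). set (b := Rmax (/ d + 1) 2).
  assert (Ha : 0 < a) by (apply Rmin_pos; lra).
  pose proof (Rmin_l (d / 2) 1 : a <= _). pose proof (Rmin_r (d / 2) 1 : a <= _).
  pose proof (Rmax_l (/ d + 1) 2 : _ <= b). pose proof (Rmax_r (/ d + 1) 2 : _ <= b).
  assert (A : Rabs (RInt f a b - l) < eps) by (apply Hl; lra).
  assert (B : Rabs (RInt f a b) <= RInt g a b).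
  { apply RInt_abs_le; [lra| apply H1; lra | apply (majorant_ex_RInt g G); auto; lra|].
    intros; apply H; lra. }
  destruct Hg as [_ Hg]. specialize (Hg a b ltac:(lra)).
  replace l with (RInt f a b - (RInt f a b - l)) by ring.
  eapply Rle_trans; [apply Rabs_triang|]. rewrite Rabs_Ropp. lra.
Qed.

(** The limit is the supremum of the integrals over compact intervals, which increase with the
    interval; some interval comes within eps of it, and all larger ones stay there. *)
Lemma improper_nonneg (f : R -> R) (G : R) :
  (forall t, 0 < t -> 0 <= f t) -> (forall a b, 0 < a < b -> ex_RInt f a b) ->
  (forall a b, 0 < a < b -> RInt f a b <= G) -> exists l, improper f l.
Proof.
  intros Hp Hex HG.
  destruct (completeness (fun x => exists a b, 0 < a < b /\ x = RInt f a b)) as [l [Hl1 Hl2]].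
  - exists G. intros x [a [b [Hab ->]]]. auto.
  - exists (RInt f 1 2), 1, 2. split; [lra|auto].
  - exists l. split; auto. intros eps He.
    destruct (Classical_Prop.classic (exists a b, 0 < a < b /\ l - eps < RInt f a b))
      as [[a0 [b0 [Hab0 Hlt]]]|Hn].
    + assert (Hb0 : 0 < / b0) by (apply Rinv_0_lt_compat; lra).
      exists (Rmin a0 (/ b0)). split; [apply Rmin_pos; lra|].
      intros a b Ha Hb Hab.
      pose proof (Rmin_l a0 (/ b0)).
      assert (Hbb : b0 < b).
      { apply Rle_lt_trans with (2 := Hb). rewrite <- (Rinv_inv b0) at 1.
        apply Rinv_le_contravar; [apply Rmin_pos; lra | apply Rmin_r]. }
      assert (RInt f a b <= l) by (apply Hl1; exists a, b; split; auto; lra).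
      assert (RInt f a0 b0 <= RInt f a b).
      { rewrite <- (RInt_Chasles (V := R_CompleteNormedModule) f a a0 b) by (apply Hex; lra).
        rewrite <- (RInt_Chasles (V := R_CompleteNormedModule) f a0 b0 b) by (apply Hex; lra).
        unfold plus; simpl.
        assert (0 <= RInt f a a0) by (apply RInt_ge_0; [lra|apply Hex; lra|intros; apply Hp; lra]).
        assert (0 <= RInt f b0 b) by (apply RInt_ge_0; [lra|apply Hex; lra|intros; apply Hp; lra]).
        lra. }
      apply Rabs_def1; lra.
    + exfalso. assert (l <= l - eps); [|lra].
      apply Hl2. intros x [a [b [Hab ->]]].
      apply Rnot_lt_le. intros C. apply Hn. exists a, b. auto.
Qed.

(** Write f = (f + g) - g, a difference of two nonnegative functions with bounded integrals. *)
Lemma improper_dominated (f g : R -> R) (G : R) :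
  (forall t, 0 < t -> continuous f t) -> integrable_majorant g G ->
  (forall t, 0 < t -> Rabs (f t) <= g t) -> exists l, improper f l.
Proof.
  intros Hf Hg H.
  pose proof (majorant_ex_RInt g G Hg) as Eg.
  pose proof (continuous_ex_RInt_pos f Hf) as Ef.
  destruct (improper_nonneg g G) as [l2 H2]; [intros; apply Hg; auto | auto | apply Hg |].
  destruct (improper_nonneg (fun t => f t + g t) (2 * G)) as [l1 H1].
  - intros t Ht. specialize (H t Ht). apply Rabs_le_between in H. lra.
  - intros a b Hab. apply (ex_RInt_plus (V := R_NormedModule)); auto.
  - intros a b Hab. rewrite (RInt_plus (V := R_CompleteNormedModule) f g) by auto.
    unfold plus; simpl. destruct Hg as [_ Hg]. specialize (Hg a b Hab).
    assert (Rabs (RInt f a b) <= RInt g a b).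
    { apply RInt_abs_le; auto; [lra|]. intros; apply H; lra. }
    pose proof (Rle_abs (RInt f a b)). lra.
  - exists (l1 - l2). eapply improper_ext; [|apply improper_minus; eauto].
    intros; simpl; ring.
Qed.

(** Dominated termwise integration in elementary form: the tails after N terms are at most the tail
    of the series of M_n G, whatever the interval, so the limit in (a, b) is only needed for a
    finite sum. *)
Lemma improper_Series (f : nat -> R -> R) (L M : nat -> R) (g : R -> R) (G : R) :
  (forall n, improper (f n) (L n)) -> integrable_majorant g G ->
  (forall n t, 0 < t -> Rabs (f n t) <= M n * g t) -> (forall n, 0 <= M n) -> ex_series M ->
  ex_series L /\ improper (fun t => Series (fun n => f n t)) (Series L).
Proof.
  intros Hf Hg HM HM0 eM.
  pose proof (majorant_nonneg g G Hg) as HG0.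
  pose proof (majorant_ex_RInt g G Hg) as Eg.
  assert (Hfin : forall a b, 0 < a < b ->
    is_RInt (fun t => Series (fun n => f n t)) a b (Series (fun n => RInt (f n) a b))).
  { intros a b Hab. destruct (majorant_bounded g G a b Hg Hab) as [K HK].
    apply is_RInt_Series with (M := fun n => M n * K); [lra| | |].
    - intros n. apply (RInt_correct (V := R_CompleteNormedModule)). apply Hf; auto.
    - intros n t Ht. eapply Rle_trans; [apply HM; lra|].
      apply Rmult_le_compat_l; auto.
    - apply ex_series_scal_r; auto. }
  assert (Hmaj : forall n, integrable_majorant (fun t => M n * g t) (M n * G)).
  { intros n. split.
    - intros t Ht. destruct Hg as [Hg _]. destruct (Hg t Ht) as [P Q]. split.
      + apply Rmult_le_pos; auto.
      + apply (continuous_scal_r (V := R_NormedModule) (M n) g); auto.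
    - intros a b Hab. rewrite (RInt_scal (V := R_CompleteNormedModule) g) by auto.
      unfold scal; simpl; unfold mult; simpl. apply Rmult_le_compat_l; auto. apply Hg; auto. }
  assert (HL : forall n, Rabs (L n) <= M n * G).
  { intros n. apply improper_abs_le with (f := f n) (g := fun t => M n * g t); auto. }
  assert (eMG : ex_series (fun n => M n * G)) by (apply ex_series_scal_r; auto).
  assert (Hfn : forall a b n, 0 < a < b -> Rabs (RInt (f n) a b) <= M n * G).
  { intros a b n Hab. eapply Rle_trans; [|apply (proj2 (Hmaj n) a b Hab)].
    apply RInt_abs_le; [lra | apply Hf; auto | apply (majorant_ex_RInt _ _ (Hmaj n)); auto |].
    intros; apply HM; lra. }
  split; [apply ex_series_dominated with (1 := HL); auto|].
  split.
  { intros a b Hab. eexists; apply Hfin; auto. }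
  intros eps He.
  pose proof (remainder_lim _ eMG) as HR. apply is_lim_seq_spec in HR.
  destruct (HR (mkposreal (eps / 3) ltac:(lra))) as [N HN].
  specialize (HN N (le_n N)). simpl in HN. rewrite Rminus_0_r in HN.
  apply Rle_lt_trans with (1 := Rle_abs _) in HN.
  destruct (improper_sum_f_R0 f L N Hf) as [_ HS].
  destruct (HS (eps / 3)) as [d [Hd HD]]; [lra|].
  exists d. split; auto. intros a b Ha Hb Hab.
  specialize (HD a b Ha Hb Hab).
  rewrite (is_RInt_unique _ _ _ _ (Hfin a b ltac:(lra))).
  rewrite (is_RInt_unique _ _ _ _ (is_RInt_sum_f_R0 f (fun n => RInt (f n) a b) a b N
    (fun n => RInt_correct (V := R_CompleteNormedModule) _ _ _ (proj1 (Hf n) a b ltac:(lra))))) in HD.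
  pose proof (Series_tail_le _ _ N HL eMG) as T1.
  pose proof (Series_tail_le (fun n => RInt (f n) a b) _ N (fun n => Hfn a b n ltac:(lra)) eMG) as T2.
  replace (Series (fun n => RInt (f n) a b) - Series L) with
    ((Series (fun n => RInt (f n) a b) - sum_f_R0 (fun n => RInt (f n) a b) N)
     + (sum_f_R0 (fun n => RInt (f n) a b) N - sum_f_R0 L N)
     - (Series L - sum_f_R0 L N)) by ring.
  eapply Rle_lt_trans; [apply Rabs_triang|]. rewrite Rabs_Ropp.
  eapply Rle_lt_trans; [apply Rplus_le_compat_r, Rabs_triang|]. lra.
Qed.

(** How integrability is checked in practice: compare with the derivative of an explicit bounded
    function. An increment of [phi] is at most 2 B. *)
Lemma majorant_of_primitive (g phi dphi : R -> R) (B : R) :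
  (forall t, 0 < t -> 0 <= g t <= dphi t) ->
  (forall t, 0 < t -> continuous g t) -> (forall t, 0 < t -> continuous dphi t) ->
  (forall t, 0 < t -> is_derive phi t (dphi t)) ->
  (forall t, 0 < t -> Rabs (phi t) <= B) -> integrable_majorant g (2 * B).
Proof.
  intros H Hg Hd HD HB. split.
  - intros t Ht. split; [apply H|]; auto.
  - intros a b Hab.
    assert (I : is_RInt dphi a b (phi b - phi a)).
    { apply (is_RInt_derive (V := R_CompleteNormedModule) phi dphi);
      rewrite Rmin_left, Rmax_right by lra; intros t Ht; [apply HD | apply Hd]; lra. }
    apply Rle_trans with (RInt dphi a b).
    + apply RInt_le; [lra | apply continuous_ex_RInt_pos; auto | eexists; eauto |].
      intros t Ht. apply H. lra.
    + rewrite (is_RInt_unique _ _ _ _ I).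
      pose proof (HB a ltac:(lra)) as A1. pose proof (HB b ltac:(lra)) as A2.
      apply Rabs_le_between in A1. apply Rabs_le_between in A2. lra.
Qed.

(** * Uniqueness of Fourier coefficients *)

(** Restates an equality between elements of a normed module carrier as one between reals, the form
    in which [ring] and [field] recognise it. *)
Ltac eqR := match goal with |- ?a = ?b => change (@eq R a b) end.

Definition trig_orthogonal (E : R -> R) : Prop :=
  forall j : Z, is_RInt (fun t => E t * cos (2 * PI * IZR j * t)) 0 1 0 /\
                is_RInt (fun t => E t * sin (2 * PI * IZR j * t)) 0 1 0.

(** Five terms, because multiplication by a shifted cos^2 mixes frequency j with the cosines and
    sines of frequencies j + 1 and j - 1. *)
Lemma is_RInt_zero_comb (f1 f2 f3 f4 f5 : R -> R) (c1 c2 c3 c4 c5 a b : R) :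
  is_RInt f1 a b 0 -> is_RInt f2 a b 0 -> is_RInt f3 a b 0 -> is_RInt f4 a b 0 ->
  is_RInt f5 a b 0 ->
  is_RInt (fun t => c1 * f1 t + c2 * f2 t + c3 * f3 t + c4 * f4 t + c5 * f5 t) a b 0.
Proof.
  intros H1 H2 H3 H4 H5.
  replace 0 with (c1 * 0 + c2 * 0 + c3 * 0 + c4 * 0 + c5 * 0) by ring.
  refine (is_RInt_plus _ _ _ _ _ _ (is_RInt_plus _ _ _ _ _ _ (is_RInt_plus _ _ _ _ _ _
    (is_RInt_plus _ _ _ _ _ _ _ _) _) _) _);
  apply (is_RInt_scal (V := R_NormedModule)); assumption.
Qed.

(** The square is the trigonometric polynomial (1 + cos (2 pi (t - phi))) / 2, so it only moves
    frequencies by at most 1. Iteration makes [E] orthogonal to every even power of the cosine. *)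
Lemma trig_orthogonal_mul_cos2 (E : R -> R) (phi : R) : trig_orthogonal E ->
  trig_orthogonal (fun t => E t * (cos (PI * (t - phi)))²).
Proof.
  intros H j.
  assert (Q : forall t, (cos (PI * (t - phi)))² =
    / 2 + / 2 * (cos (2 * PI * t) * cos (2 * PI * phi) + sin (2 * PI * t) * sin (2 * PI * phi))).
  { intros t. rewrite <- cos_minus.
    replace (2 * PI * t - 2 * PI * phi) with (2 * (PI * (t - phi))) by ring.
    rewrite cos_2a_cos. unfold Rsqr. lra. }
  assert (Ep : forall t, 2 * PI * IZR (j + 1) * t = 2 * PI * IZR j * t + 2 * PI * t).
  { intros; rewrite plus_IZR; ring. }
  assert (Em : forall t, 2 * PI * IZR (j - 1) * t = 2 * PI * IZR j * t - 2 * PI * t).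
  { intros; rewrite minus_IZR; ring. }
  destruct (H j) as [C0 S0]. destruct (H (j + 1)%Z) as [C1 S1]. destruct (H (j - 1)%Z) as [C2 S2].
  set (a := cos (2 * PI * phi)) in *. set (b := sin (2 * PI * phi)) in *.
  split.
  - eapply is_RInt_ext;
      [|exact (is_RInt_zero_comb _ _ _ _ _ (/2) (a/4) (a/4) (b/4) (-b/4) 0 1 C0 C1 C2 S1 S2)].
    intros t _. cbv beta. rewrite Q, Ep, Em, cos_plus, cos_minus, sin_plus, sin_minus. eqR; field.
  - eapply is_RInt_ext;
      [|exact (is_RInt_zero_comb _ _ _ _ _ (/2) (a/4) (a/4) (b/4) (-b/4) 0 1 S0 S1 S2 C2 C1)].
    intros t _. cbv beta. rewrite Q, Ep, Em, cos_plus, cos_minus, sin_plus, sin_minus. eqR; field.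
Qed.

(* Tests [E] against [cos^(2N) (PI (t - phi))], which concentrates at [phi]. *)
Lemma trig_orthogonal_nonpos (E : R -> R) (B phi : R) :
  0 < phi < 1 -> trig_orthogonal E -> (forall t, 0 < t < 1 -> Rabs (E t) <= B) ->
  continuous E phi -> E phi <= 0.
Proof.
  intros Hphi HE HB Hc. apply Rnot_lt_le. intros Hpos.
  set (q := fun t => (cos (PI * (t - phi)))²).
  assert (HN : forall N, is_RInt (fun t => E t * q t ^ N) 0 1 0).
  { intros N. assert (T : trig_orthogonal (fun t => E t * q t ^ N)).
    { induction N as [|N IH].
      - intros j. destruct (HE j) as [K1 K2].
        split; [eapply is_RInt_ext; [|exact K1] | eapply is_RInt_ext; [|exact K2]];
        intros; simpl; ring.
      - intros j. destruct (trig_orthogonal_mul_cos2 _ phi IH j) as [K1 K2].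
        split; [eapply is_RInt_ext; [|exact K1] | eapply is_RInt_ext; [|exact K2]];
        intros; unfold q; simpl; ring. }
    destruct (T 0%Z) as [K _]. eapply is_RInt_ext; [|exact K].
    intros t _. simpl. rewrite Rmult_0_r, Rmult_0_l, cos_0. ring. }
  set (c := E phi / 2). assert (Hc0 : 0 < c) by (unfold c; lra).
  assert (Hnear : exists d, 0 < d /\ forall t, Rabs (t - phi) < d -> c < E t).
  { assert (L : locally phi (fun t => c < E t)).
    { apply (Hc (fun y => c < y)). apply open_gt. unfold c; lra. }
    destruct L as [d Hd]. exists d. split; [apply cond_pos|].
    intros t Ht. apply Hd. exact Ht. }
  destruct Hnear as [d0 [Hd0 Hnear]].
  (* The interval of radius 2h about phi lies in [0, 1] and, inside it, E > c. Three zones follow: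
     within h the kernel is at least q1; beyond 2h it is at most q2 < q1; in between, the integrand
     is positive. *)
  set (h := Rmin d0 (Rmin phi (1 - phi)) / 2).
  pose proof (Rmin_l d0 (Rmin phi (1 - phi))). pose proof (Rmin_r d0 (Rmin phi (1 - phi))).
  pose proof (Rmin_l phi (1 - phi)). pose proof (Rmin_r phi (1 - phi)).
  assert (Hh : 0 < h).
  { unfold h. apply Rdiv_lt_0_compat; [|lra]. repeat apply Rmin_pos; lra. }
  assert (Hh1 : 2 * h <= d0) by (unfold h; lra).
  assert (Hh2 : 2 * h <= phi) by (unfold h; lra).
  assert (Hh3 : 2 * h <= 1 - phi) by (unfold h; lra).
  clearbody h.
  pose proof PI_RGT_0 as Hpi.
  set (q1 := (cos (PI * h))²). set (q2 := (cos (PI * (2 * h)))²).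
  assert (Hc2 : 0 <= cos (PI * (2 * h))) by (apply cos_ge_0; nra).
  assert (Hc1 : cos (PI * (2 * h)) < cos (PI * h)) by (apply cos_decreasing_1; nra).
  assert (Hq12 : 0 <= q2 < q1) by (unfold q1, q2, Rsqr; nra).
  assert (Habs : forall t, cos (PI * (t - phi)) = cos (PI * Rabs (t - phi))).
  { intros t. unfold Rabs. destruct (Rcase_abs (t - phi)); auto.
    rewrite Ropp_mult_distr_r_reverse, cos_neg. auto. }
  assert (Hin : forall t, Rabs (t - phi) <= h -> q1 <= q t).
  { intros t Ht. unfold q, q1. rewrite Habs. pose proof (Rabs_pos (t - phi)).
    assert (cos (PI * h) <= cos (PI * Rabs (t - phi))).
    { apply cos_decr_1; nra. }
    unfold Rsqr; nra. }
  assert (Hout : forall t, 0 < t < 1 -> 2 * h <= Rabs (t - phi) -> q t <= q2).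
  { intros t Ht Ha. unfold q, q2. rewrite Habs.
    (* The kernel has period 1 and rises again as the distance nears 1; keeping the distance below 1
       - 2h bounds the cosine from below by - cos (2 pi h). *)
    assert (Rabs (t - phi) <= 1 - 2 * h) by (apply Rabs_le; lra).
    assert (cos (PI * Rabs (t - phi)) <= cos (PI * (2 * h))) by (apply cos_decr_1; nra).
    assert (- cos (PI * (2 * h)) <= cos (PI * Rabs (t - phi))).
    { replace (- cos (PI * (2 * h))) with (cos (PI * (1 - 2 * h))).
      - apply cos_decr_1; nra.
      - replace (PI * (1 - 2 * h)) with (- (PI * (2 * h)) + PI) by ring.
        rewrite neg_cos, cos_neg. auto. }
    unfold Rsqr; nra. }
  assert (Hq0 : forall t, 0 <= q t) by (intros; apply Rle_0_sqr).
  assert (HB0 : 0 <= B).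
  { eapply Rle_trans; [apply Rabs_pos|apply (HB phi); auto]. }
  (* The vanishing integral is at least 2h c q1^N from the central interval, minus B q2^N from the
     rest, whose length is at most 1. *)
  assert (main : forall N, 2 * h * c * q1 ^ N <= B * q2 ^ N).
  { intros N. specialize (HN N).
    assert (P2 : 0 <= q2 ^ N) by (apply pow_le; lra).
    assert (lowout : forall t, 0 < t < 1 -> h <= Rabs (t - phi) -> - (B * q2 ^ N) <= E t * q t ^ N).
    { intros t Ht Ha. pose proof (pow_le _ N (Hq0 t)).
      destruct (Rlt_dec (Rabs (t - phi)) (2 * h)) as [L|L].
      - assert (c < E t) by (apply Hnear; lra). nra.
      - assert (q t ^ N <= q2 ^ N) by (apply pow_incr; split; auto; apply Hout; auto; lra).
        specialize (HB t Ht). apply Rabs_le_between in HB. nra. }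
    assert (ex1 : ex_RInt (fun t => E t * q t ^ N) 0 1) by (eexists; eauto).
    assert (exa : ex_RInt (fun t => E t * q t ^ N) 0 (phi - h)).
    { apply (ex_RInt_Chasles_1 (V := R_CompleteNormedModule)) with 1; auto; lra. }
    assert (exb : ex_RInt (fun t => E t * q t ^ N) (phi - h) 1).
    { apply (ex_RInt_Chasles_2 (V := R_CompleteNormedModule)) with 0; auto; lra. }
    assert (exc : ex_RInt (fun t => E t * q t ^ N) (phi - h) (phi + h)).
    { apply (ex_RInt_Chasles_1 (V := R_CompleteNormedModule)) with 1; auto; lra. }
    assert (exd : ex_RInt (fun t => E t * q t ^ N) (phi + h) 1).
    { apply (ex_RInt_Chasles_2 (V := R_CompleteNormedModule)) with (phi - h); auto; lra. }
    apply (is_RInt_unique (V := R_CompleteNormedModule)) in HN.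
    rewrite <- (RInt_Chasles (V := R_CompleteNormedModule) _ 0 (phi - h) 1) in HN by auto.
    rewrite <- (RInt_Chasles (V := R_CompleteNormedModule) _ (phi - h) (phi + h) 1) in HN by auto.
    unfold plus in HN; simpl in HN.
    assert (low : forall a b k, a <= b -> ex_RInt (fun t => E t * q t ^ N) a b ->
      (forall t, a < t < b -> k <= E t * q t ^ N) -> (b - a) * k <= RInt (fun t => E t * q t ^ N) a b).
    { intros a b k Hab Hex Hk.
      apply Rle_trans with (RInt (fun _ => k) a b);
        [right; symmetry; exact (RInt_const (V := R_CompleteNormedModule) a b k)|].
      apply RInt_le; auto. apply (ex_RInt_const (V := R_NormedModule)). }
    assert (L1 := low 0 (phi - h) (- (B * q2 ^ N)) ltac:(lra) exa).
    assert (L2 := low (phi - h) (phi + h) (c * q1 ^ N) ltac:(lra) exc).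
    assert (L3 := low (phi + h) 1 (- (B * q2 ^ N)) ltac:(lra) exd).
    assert (A1 : forall t, 0 < t < phi - h -> - (B * q2 ^ N) <= E t * q t ^ N).
    { intros t Ht. apply lowout; [lra|]. rewrite Rabs_left by lra. lra. }
    assert (A3 : forall t, phi + h < t < 1 -> - (B * q2 ^ N) <= E t * q t ^ N).
    { intros t Ht. apply lowout; [lra|]. rewrite Rabs_pos_eq by lra. lra. }
    assert (A2 : forall t, phi - h < t < phi + h -> c * q1 ^ N <= E t * q t ^ N).
    { intros t Ht. assert (Rabs (t - phi) <= h) by (apply Rabs_le; lra).
      assert (c < E t) by (apply Hnear; lra).
      assert (q1 ^ N <= q t ^ N) by (apply pow_incr; split; [lra| apply Hin; auto]).
      assert (0 <= q1 ^ N) by (apply pow_le; lra). nra. }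
    specialize (L1 A1). specialize (L2 A2). specialize (L3 A3).
    assert (0 <= B * q2 ^ N) by (apply Rmult_le_pos; auto). nra. }
  (* Since q2 < q1, a large N contradicts [main]. The denominator B + 1 avoids a division by 0 when
     B = 0. *)
  destruct (pow_lt_1_zero (q2 / q1)) with (y := 2 * h * c / (B + 1)) as [N HNN].
  - rewrite Rabs_pos_eq; [|apply Rdiv_le_0_compat; lra].
    apply Rmult_lt_reg_r with q1; [lra|]. unfold Rdiv. rewrite Rmult_assoc, Rinv_l by lra. lra.
  - apply Rdiv_lt_0_compat; [|lra]. repeat apply Rmult_lt_0_compat; lra.
  - specialize (HNN N (le_n N)). specialize (main N).
    rewrite Rabs_pos_eq in HNN by (apply pow_le, Rdiv_le_0_compat; lra).
    unfold Rdiv at 1 in HNN. rewrite Rpow_mult_distr, pow_inv in HNN.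
    assert (P1 : 0 < q1 ^ N) by (apply pow_lt; lra).
    assert (P2 : 0 <= q2 ^ N) by (apply pow_le; lra).
    apply (Rmult_lt_compat_r (q1 ^ N * (B + 1))) in HNN; [|apply Rmult_lt_0_compat; lra].
    replace (q2 ^ N * / q1 ^ N * (q1 ^ N * (B + 1))) with (q2 ^ N * (B + 1)) in HNN by (field; lra).
    replace (2 * h * c / (B + 1) * (q1 ^ N * (B + 1))) with (2 * h * c * q1 ^ N) in HNN by (field; lra).
    nra.
Qed.

Lemma trig_orthogonal_zero (E : R -> R) (B phi : R) :
  0 < phi < 1 -> trig_orthogonal E -> (forall t, 0 < t < 1 -> Rabs (E t) <= B) ->
  continuous E phi -> E phi = 0.
Proof.
  intros Hphi HE HB Hc. apply Rle_antisym.
  - eapply trig_orthogonal_nonpos; eauto.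
  - assert (- E phi <= 0); [|lra].
    apply (trig_orthogonal_nonpos (fun t => - E t) B); auto.
    + intros j. destruct (HE j) as [K1 K2].
      apply (is_RInt_opp (V := R_NormedModule)) in K1. apply (is_RInt_opp (V := R_NormedModule)) in K2.
      change (@opp R_NormedModule 0) with (- 0) in K1, K2. rewrite Ropp_0 in K1, K2.
      split; [eapply is_RInt_ext; [|exact K1] | eapply is_RInt_ext; [|exact K2]];
      intros; unfold opp; simpl; ring.
    + intros t Ht. rewrite Rabs_Ropp; auto.
    + apply (continuous_opp (V := R_NormedModule)); auto.
Qed.

(** * Complex series, integrals and derivatives *)

Lemma C_ext (z w : C) : Re z = Re w -> Im z = Im w -> z = w.
Proof. destruct z, w; simpl; intros; subst; auto. Qed.

Ltac Ceq := apply C_ext; unfold Re, Im; simpl; unfold Re, Im; simpl.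

Lemma Re_le_Cmod (z : C) : Rabs (Re z) <= Cmod z.
Proof. eapply Rle_trans; [apply Rmax_l | apply Rmax_Cmod]. Qed.

Lemma Im_le_Cmod (z : C) : Rabs (Im z) <= Cmod z.
Proof. eapply Rle_trans; [apply Rmax_r | apply Rmax_Cmod]. Qed.

Lemma Cmod_le_Re_Im (z : C) : Cmod z <= Rabs (Re z) + Rabs (Im z).
Proof.
  replace z with (RtoC (Re z) + Ci * RtoC (Im z))%C at 1 by (Ceq; ring).
  eapply Rle_trans; [apply Cmod_triangle|].
  rewrite Cmod_mult, Cmod_Ci, !Cmod_R. lra.
Qed.

Definition is_Cseries (u : nat -> C) (l : C) : Prop :=
  is_series (fun n => Re (u n)) (Re l) /\ is_series (fun n => Im (u n)) (Im l).

Lemma is_Cseries_unique (u : nat -> C) (l : C) : is_Cseries u l -> CSeries u = l.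
Proof.
  intros [H1 H2]. unfold CSeries. 
  rewrite (is_series_unique _ _ H1), (is_series_unique _ _ H2). destruct l; auto.
Qed.

Lemma is_Cseries_ext (u v : nat -> C) (l : C) :
  (forall n, u n = v n) -> is_Cseries u l -> is_Cseries v l.
Proof.
  intros E [H1 H2]. split; [eapply is_series_ext; [|exact H1] | eapply is_series_ext; [|exact H2]];
  intros n; simpl; rewrite E; auto.
Qed.

Lemma CSeries_ext (u v : nat -> C) : (forall n, u n = v n) -> CSeries u = CSeries v.
Proof.
  intros E. unfold CSeries. f_equal; apply Series_ext; intros n; rewrite E; auto.
Qed.

Lemma is_Cseries_plus (u v : nat -> C) (l m : C) :
  is_Cseries u l -> is_Cseries v m -> is_Cseries (fun n => Cplus (u n) (v n)) (Cplus l m).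
Proof.
  intros [H1 H2] [K1 K2]. split.
  - exact (is_series_plus _ _ _ _ H1 K1).
  - exact (is_series_plus _ _ _ _ H2 K2).
Qed.

Lemma is_Cseries_scal (c : C) (u : nat -> C) (l : C) :
  is_Cseries u l -> is_Cseries (fun n => Cmult c (u n)) (Cmult c l).
Proof.
  intros [H1 H2]. split.
  - pose proof (is_series_minus _ _ _ _ (is_series_scal (V := R_NormedModule) (Re c) _ _ H1)
      (is_series_scal (V := R_NormedModule) (Im c) _ _ H2)) as H.
    exact H.
  - pose proof (is_series_plus _ _ _ _ (is_series_scal (V := R_NormedModule) (Re c) _ _ H2)
      (is_series_scal (V := R_NormedModule) (Im c) _ _ H1)) as H.
    exact H.
Qed.

Lemma is_Cseries_minus (u v : nat -> C) (l m : C) :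
  is_Cseries u l -> is_Cseries v m -> is_Cseries (fun n => Cminus (u n) (v n)) (Cminus l m).
Proof.
  intros H K. apply (is_Cseries_scal (RtoC (-1))) in K.
  replace (l - m)%C with (l + RtoC (-1) * m)%C by (Ceq; ring).
  eapply is_Cseries_ext; [|exact (is_Cseries_plus _ _ _ _ H K)].
  intros n. Ceq; ring.
Qed.

Lemma CSeries_correct (u : nat -> C) (b : nat -> R) :
  (forall n, Cmod (u n) <= b n) -> ex_series b -> is_Cseries u (CSeries u).
Proof.
  intros H eb. split; simpl; apply Series_correct; apply ex_series_dominated with b; auto;
  intros n; (eapply Rle_trans; [|apply H]); [apply Re_le_Cmod | apply Im_le_Cmod].
Qed.

(** The factor 2 comes from bounding the real and imaginary parts separately. *)
Lemma CSeries_abs_le (u : nat -> C) (b : nat -> R) :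
  (forall n, Cmod (u n) <= b n) -> ex_series b -> Cmod (CSeries u) <= 2 * Series b.
Proof.
  intros H eb. eapply Rle_trans; [apply Cmod_le_Re_Im|]. simpl.
  assert (Rabs (Series (fun n => Re (u n))) <= Series b).
  { apply Series_abs_le; auto. intros n; eapply Rle_trans; [apply Re_le_Cmod|apply H]. }
  assert (Rabs (Series (fun n => Im (u n))) <= Series b).
  { apply Series_abs_le; auto. intros n; eapply Rle_trans; [apply Im_le_Cmod|apply H]. }
  lra.
Qed.

Lemma CSeries_swap (A B : nat -> R) (U : nat -> nat -> C) :
  (forall i j, Cmod (U i j) <= A i * B j) -> (forall i, 0 <= A i) -> (forall j, 0 <= B j) ->
  ex_series A -> ex_series B ->
  CSeries (fun i => CSeries (fun j => U i j)) = CSeries (fun j => CSeries (fun i => U i j)).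
Proof.
  intros H HA HB eA eB. Ceq; apply (Series_swap A B); auto; intros i j;
  (eapply Rle_trans; [|apply H]); [apply Re_le_Cmod | apply Im_le_Cmod].
Qed.

Lemma is_Cseries_shift (u : nat -> C) (l : C) :
  is_Cseries u l -> is_Cseries (fun n => u (S n)) (Cminus l (u 0%nat)).
Proof.
  intros [H1 H2]. split.
  - apply (is_series_incr_1 (V := R_NormedModule) (fun n => Re (u n))).
    evar_last; [exact H1|]. unfold plus, Re, Im; simpl. eqR. ring.
  - apply (is_series_incr_1 (V := R_NormedModule) (fun n => Im (u n))).
    evar_last; [exact H2|]. unfold plus, Re, Im; simpl. eqR. ring.
Qed.

Lemma is_Cseries_telescope (J : nat -> C) :
  is_lim_seq (fun n => Cmod (J n)) 0 ->
  is_Cseries (fun n => Cminus (J (S n)) (J n)) (Copp (J 0%nat)).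
Proof.
  intros H. split.
  - apply is_series_of_remainder with (r := fun n => Cmod (J (S n))).
    + intros n. replace (sum_f_R0 _ n - _) with (Re (J (S n))); [apply Re_le_Cmod|].
      unfold Re, Im. simpl. induction n as [|n IH]; simpl in *; [ring|]. lra.
    + apply (is_lim_seq_incr_1 (fun n => Cmod (J n))); auto.
  - apply is_series_of_remainder with (r := fun n => Cmod (J (S n))).
    + intros n. replace (sum_f_R0 _ n - _) with (Im (J (S n))); [apply Im_le_Cmod|].
      unfold Re, Im. simpl. induction n as [|n IH]; simpl in *; [ring|]. lra.
    + apply (is_lim_seq_incr_1 (fun n => Cmod (J n))); auto.
Qed.

Lemma is_Cseries_single (c : C) (m : nat) :
  is_Cseries (fun n => if Nat.eqb n m then c else RtoC 0) c.
Proof.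
  assert (A : forall x : R, is_series (fun n => if Nat.eqb n m then x else 0) x).
  { intros x. evar_last.
    - apply is_series_finite_support with (N := m).
      intros n Hn. destruct (Nat.eqb_spec n m); [lia|auto].
    - destruct m as [|m]; [simpl; auto|]. simpl sum_f_R0. rewrite Nat.eqb_refl.
      rewrite (sum_eq _ (fun _ => 0)), sum_cte; [ring|].
      intros i Hi. destruct (Nat.eqb_spec i (S m)); [lia|auto]. }
  split; [eapply is_series_ext; [|exact (A (Re c))] | eapply is_series_ext; [|exact (A (Im c))]];
  intros n; simpl; destruct (Nat.eqb n m); auto.
Qed.

Lemma is_Cseries_zero (u : nat -> C) : (forall n, u n = RtoC 0) -> is_Cseries u (RtoC 0).
Proof.
  intros H. replace (RtoC 0) with (RtoC 0 * RtoC 0)%C by ring.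
  eapply is_Cseries_ext; [|apply (is_Cseries_scal (RtoC 0)), (is_Cseries_single (RtoC 0) 0)].
  intros n. rewrite H. destruct (Nat.eqb n 0); ring.
Qed.

Definition is_CRInt (f : R -> C) (a b : R) (l : C) : Prop :=
  is_RInt (fun t => Re (f t)) a b (Re l) /\ is_RInt (fun t => Im (f t)) a b (Im l).

Lemma is_CRInt_ext (f g : R -> C) (a b : R) (l : C) : a <= b ->
  (forall t, a < t < b -> f t = g t) -> is_CRInt f a b l -> is_CRInt g a b l.
Proof.
  intros Hab E [H1 H2]. split; [eapply is_RInt_ext; [|exact H1] | eapply is_RInt_ext; [|exact H2]];
  rewrite Rmin_left, Rmax_right by lra; intros t Ht; rewrite E; auto.
Qed.

Lemma is_CRInt_plus (f g : R -> C) (a b : R) (l m : C) :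
  is_CRInt f a b l -> is_CRInt g a b m -> is_CRInt (fun t => Cplus (f t) (g t)) a b (Cplus l m).
Proof.
  intros [H1 H2] [K1 K2]. split.
  - exact (is_RInt_plus _ _ _ _ _ _ H1 K1).
  - exact (is_RInt_plus _ _ _ _ _ _ H2 K2).
Qed.

Lemma is_CRInt_scal (c : C) (f : R -> C) (a b : R) (l : C) :
  is_CRInt f a b l -> is_CRInt (fun t => Cmult c (f t)) a b (Cmult c l).
Proof.
  intros [H1 H2]. split.
  - exact (is_RInt_minus _ _ _ _ _ _ (is_RInt_scal (V := R_NormedModule) _ _ _ (Re c) _ H1)
      (is_RInt_scal (V := R_NormedModule) _ _ _ (Im c) _ H2)).
  - exact (is_RInt_plus _ _ _ _ _ _ (is_RInt_scal (V := R_NormedModule) _ _ _ (Re c) _ H2)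
      (is_RInt_scal (V := R_NormedModule) _ _ _ (Im c) _ H1)).
Qed.

Lemma is_CRInt_CSeries (f : nat -> R -> C) (l : nat -> C) (M : nat -> R) (a b : R) :
  a < b -> (forall n, is_CRInt (f n) a b (l n)) ->
  (forall n t, a < t < b -> Cmod (f n t) <= M n) -> ex_series M ->
  is_CRInt (fun t => CSeries (fun n => f n t)) a b (CSeries l).
Proof.
  intros Hab Hf HM eM. split; simpl.
  - apply (is_RInt_Series (fun n t => Re (f n t)) (fun n => Re (l n)) M); auto.
    + intros n; exact (proj1 (Hf n)).
    + intros n t Ht. eapply Rle_trans; [apply Re_le_Cmod | auto].
  - apply (is_RInt_Series (fun n t => Im (f n t)) (fun n => Im (l n)) M); auto.
    + intros n; exact (proj2 (Hf n)).
    + intros n t Ht. eapply Rle_trans; [apply Im_le_Cmod | auto].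
Qed.

Definition is_Cderive (f : R -> C) (t : R) (l : C) : Prop :=
  is_derive (fun t => Re (f t)) t (Re l) /\ is_derive (fun t => Im (f t)) t (Im l).

Definition Ccontinuous (f : R -> C) (t : R) : Prop :=
  continuous (fun t => Re (f t)) t /\ continuous (fun t => Im (f t)) t.

Lemma is_Cderive_continuous (f : R -> C) (t : R) (l : C) : is_Cderive f t l -> Ccontinuous f t.
Proof.
  intros [H1 H2]. split; apply (ex_derive_continuous (V := R_NormedModule)); eexists; eauto.
Qed.

Lemma is_Cderive_plus (f g : R -> C) (t : R) (l m : C) :
  is_Cderive f t l -> is_Cderive g t m -> is_Cderive (fun t => Cplus (f t) (g t)) t (Cplus l m).
Proof.
  intros [H1 H2] [K1 K2]. split.
  - exact (is_derive_plus _ _ _ _ _ H1 K1).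
  - exact (is_derive_plus _ _ _ _ _ H2 K2).
Qed.

Lemma is_Cderive_mult (f g : R -> C) (t : R) (l m : C) :
  is_Cderive f t l -> is_Cderive g t m ->
  is_Cderive (fun t => Cmult (f t) (g t)) t (Cplus (Cmult l (g t)) (Cmult (f t) m)).
Proof.
  intros [H1 H2] [K1 K2]. split; simpl.
  - pose proof (is_derive_minus _ _ _ _ _ (is_derive_mult _ _ _ _ _ H1 K1 Rmult_comm)
      (is_derive_mult _ _ _ _ _ H2 K2 Rmult_comm)) as H.
    evar_last; [exact H|]. unfold minus, plus, opp, mult; simpl. unfold mult; simpl. unfold Re, Im; eqR. ring.
  - pose proof (is_derive_plus _ _ _ _ _ (is_derive_mult _ _ _ _ _ H1 K2 Rmult_comm)
      (is_derive_mult _ _ _ _ _ H2 K1 Rmult_comm)) as H.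
    evar_last; [exact H|]. unfold minus, plus, opp, mult; simpl. unfold mult; simpl. unfold Re, Im; eqR. ring.
Qed.

Lemma is_Cderive_const (c : C) (t : R) : is_Cderive (fun _ => c) t (RtoC 0).
Proof. split; apply (is_derive_const (V := R_NormedModule)). Qed.

Lemma is_Cderive_scal (c : C) (f : R -> C) (t : R) (l : C) :
  is_Cderive f t l -> is_Cderive (fun t => Cmult c (f t)) t (Cmult c l).
Proof.
  intros H. pose proof (is_Cderive_mult _ _ _ _ _ (is_Cderive_const c t) H) as K.
  replace (c * l)%C with (RtoC 0 * f t + c * l)%C by ring. exact K.
Qed.

Lemma is_Cderive_RtoC (f : R -> R) (t l : R) :
  is_derive f t l -> is_Cderive (fun t => RtoC (f t)) t (RtoC l).
Proof. intros H. split; simpl; [exact H | apply (is_derive_const (V := R_NormedModule))]. Qed.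

Lemma is_CRInt_derive (f df : R -> C) (a b : R) : a <= b ->
  (forall t, a <= t <= b -> is_Cderive f t (df t)) ->
  (forall t, a <= t <= b -> Ccontinuous df t) ->
  is_CRInt df a b (Cminus (f b) (f a)).
Proof.
  intros Hab Hd Hc. split.
  - apply (is_RInt_derive (V := R_CompleteNormedModule) (fun t => Re (f t)) (fun t => Re (df t)));
    rewrite Rmin_left, Rmax_right by lra; intros t Ht; [exact (proj1 (Hd t Ht)) | exact (proj1 (Hc t Ht))].
  - apply (is_RInt_derive (V := R_CompleteNormedModule) (fun t => Im (f t)) (fun t => Im (df t)));
    rewrite Rmin_left, Rmax_right by lra; intros t Ht; [exact (proj2 (Hd t Ht)) | exact (proj2 (Hc t Ht))].
Qed.

(** * The complex exponential and the characters e^(2 pi i x) *)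

Definition Cexp (z : C) : C := (exp (Re z) * cos (Im z), exp (Re z) * sin (Im z)).

Lemma Cexp_plus (z w : C) : Cexp (Cplus z w) = Cmult (Cexp z) (Cexp w).
Proof.
  Ceq; rewrite exp_plus; [rewrite cos_plus | rewrite sin_plus]; ring.
Qed.

Lemma Cexp_0 : Cexp (RtoC 0) = RtoC 1.
Proof. Ceq; rewrite exp_0; [rewrite cos_0 | rewrite sin_0]; ring. Qed.

Lemma Cmod_Cexp (z : C) : Cmod (Cexp z) = exp (Re z).
Proof.
  unfold Cmod, Cexp; simpl fst; simpl snd.
  replace ((exp (Re z) * cos (Im z)) ^ 2 + (exp (Re z) * sin (Im z)) ^ 2)
    with (exp (Re z) ^ 2).
  - apply sqrt_pow2. left; apply exp_pos.
  - pose proof (sin2_cos2 (Im z)) as H. unfold Rsqr in H. nra.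
Qed.

Lemma is_Cderive_Cexp (w : C) (t : R) :
  is_Cderive (fun t => Cexp (Cmult (RtoC t) w)) t (Cmult w (Cexp (Cmult (RtoC t) w))).
Proof.
  split; unfold Re, Im; simpl; unfold Re, Im; simpl; auto_derive; auto; unfold Rminus; ring.
Qed.

Definition ee (x : R) : C := (cos (2 * PI * x), sin (2 * PI * x)).

Lemma ee_plus (x y : R) : ee (x + y) = Cmult (ee x) (ee y).
Proof.
  Ceq; rewrite Rmult_plus_distr_l; [rewrite cos_plus | rewrite sin_plus]; ring.
Qed.

Lemma ee_Cexp (x : R) : ee x = Cexp (0, 2 * PI * x).
Proof. Ceq; rewrite exp_0; ring. Qed.

Lemma Cmod_ee (x : R) : Cmod (ee x) = 1.
Proof. rewrite ee_Cexp, Cmod_Cexp. apply exp_0. Qed.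

Lemma ee_IZR (n : Z) : ee (IZR n) = RtoC 1.
Proof.
  assert (E : sin (PI * IZR n) = 0).
  { apply sin_eq_0_1. exists n. ring. }
  Ceq; rewrite Rmult_assoc.
  - rewrite cos_2a_sin, E. ring.
  - rewrite sin_2a, E. ring.
Qed.

(** * The Lipschitz formula *)

(** Weierstrass test with a majorant near x only, because the bound available for [lip_exp] holds
    just for arguments in (0, 2). *)
Lemma continuous_Series (f : nat -> R -> R) (M : nat -> R) (x d : R) : 0 < d ->
  (forall n, continuous (f n) x) -> (forall n t, Rabs (t - x) < d -> Rabs (f n t) <= M n) ->
  ex_series M -> continuous (fun t => Series (fun n => f n t)) x.
Proof.
  intros Hd Hc HM eM. apply filterlim_locally. intros eps.
  pose proof (remainder_lim _ eM) as HR. apply is_lim_seq_spec in HR.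
  pose proof (cond_pos eps) as He.
  destruct (HR (mkposreal (eps / 3) ltac:(lra))) as [N HN].
  specialize (HN N (le_n N)). simpl in HN. rewrite Rminus_0_r in HN.
  apply Rle_lt_trans with (1 := Rle_abs _) in HN.
  assert (HS : continuous (fun t => sum_f_R0 (fun n => f n t) N) x).
  { clear HN. induction N as [|N IH]; simpl; auto.
    apply (continuous_plus (V := R_NormedModule)); auto. }
  assert (H3 : 0 < eps / 3) by lra.
  pose proof (proj1 (filterlim_locally _ _) HS (mkposreal _ H3)) as [d' Hd'].
  exists (mkposreal (Rmin d d') (Rmin_pos _ _ Hd (cond_pos d'))).
  intros t Ht. 
  assert (Ht' : Rabs (t - x) < Rmin d d') by exact Ht.
  pose proof (Rmin_l d d'). pose proof (Rmin_r d d').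
  assert (B1 : Rabs (sum_f_R0 (fun n => f n t) N - sum_f_R0 (fun n => f n x) N) < eps / 3).
  { apply Hd'. change (Rabs (t - x) < d'). lra. }
  assert (T1 := Series_tail_le (fun n => f n t) M N (fun n => HM n t ltac:(lra)) eM).
  assert (T2 := Series_tail_le (fun n => f n x) M N
    (fun n => HM n x ltac:(rewrite Rminus_diag, Rabs_R0; lra)) eM).
  change (Rabs (Series (fun n => f n t) - Series (fun n => f n x)) < eps).
  replace (Series (fun n => f n t) - Series (fun n => f n x)) with
    ((Series (fun n => f n t) - sum_f_R0 (fun n => f n t) N)
     + (sum_f_R0 (fun n => f n t) N - sum_f_R0 (fun n => f n x) N)
     - (Series (fun n => f n x) - sum_f_R0 (fun n => f n x) N)) by ring.
  eapply Rle_lt_trans; [apply Rabs_triang|]. rewrite Rabs_Ropp.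
  eapply Rle_lt_trans; [apply Rplus_le_compat_r, Rabs_triang|]. lra.
Qed.

Lemma Ccontinuous_CSeries (f : nat -> R -> C) (M : nat -> R) (x d : R) : 0 < d ->
  (forall n, Ccontinuous (f n) x) -> (forall n t, Rabs (t - x) < d -> Cmod (f n t) <= M n) ->
  ex_series M -> Ccontinuous (fun t => CSeries (fun n => f n t)) x.
Proof.
  intros Hd Hc HM eM. split.
  - apply (continuous_Series (fun n t => Re (f n t)) M x d); auto.
    + intros n; exact (proj1 (Hc n)).
    + intros n t Ht. eapply Rle_trans; [apply Re_le_Cmod | auto].
  - apply (continuous_Series (fun n t => Im (f n t)) M x d); auto.
    + intros n; exact (proj2 (Hc n)).
    + intros n t Ht. eapply Rle_trans; [apply Im_le_Cmod | auto].
Qed.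

Lemma Ccontinuous_plus (f g : R -> C) (x : R) :
  Ccontinuous f x -> Ccontinuous g x -> Ccontinuous (fun t => Cplus (f t) (g t)) x.
Proof.
  intros [H1 H2] [K1 K2]. split.
  - exact (continuous_plus (V := R_NormedModule) _ _ _ H1 K1).
  - exact (continuous_plus (V := R_NormedModule) _ _ _ H2 K2).
Qed.

Lemma Ccontinuous_scal (c : C) (f : R -> C) (x : R) :
  Ccontinuous f x -> Ccontinuous (fun t => Cmult c (f t)) x.
Proof.
  intros [H1 H2]. split.
  - exact (continuous_minus (V := R_NormedModule) _ _ _
      (continuous_scal_r (V := R_NormedModule) (Re c) _ _ H1)
      (continuous_scal_r (V := R_NormedModule) (Im c) _ _ H2)).
  - exact (continuous_plus (V := R_NormedModule) _ _ _
      (continuous_scal_r (V := R_NormedModule) (Re c) _ _ H2)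
      (continuous_scal_r (V := R_NormedModule) (Im c) _ _ H1)).
Qed.

(** Carries an identity known on the open interval (0, 1) to the endpoint 1. *)
Lemma continuous_zero_left (h : R -> R) (x d : R) : 0 < d -> continuous h x ->
  (forall t, x - d < t < x -> h t = 0) -> h x = 0.
Proof.
  intros Hd Hc H. destruct (Req_dec (h x) 0) as [|Hn]; auto. exfalso.
  assert (L : locally x (fun t => h t <> 0)).
  { apply (Hc (fun y => y <> 0)). apply open_neq; auto. }
  destruct L as [e He]. pose proof (cond_pos e).
  pose proof (Rmin_l d e). pose proof (Rmin_r d e). pose proof (Rmin_pos d e Hd ltac:(auto)).
  apply (He (x - Rmin d e / 2)).
  - change (Rabs (x - Rmin d e / 2 - x) < e).
    replace (x - Rmin d e / 2 - x) with (- (Rmin d e / 2)) by ring.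
    rewrite Rabs_Ropp, Rabs_pos_eq; lra.
  - apply H. lra.
Qed.

(** The coefficients at j and -j, added and subtracted, separate the real from the imaginary part of
    [E]; each part is then orthogonal to all real trigonometric functions. *)
Lemma fourier_unique (E : R -> C) (B phi : R) : 0 < phi < 1 ->
  (forall j : Z, is_CRInt (fun t => Cmult (E t) (ee (- IZR j * t))) 0 1 (RtoC 0)) ->
  (forall t, 0 < t < 1 -> Cmod (E t) <= B) -> Ccontinuous E phi -> E phi = RtoC 0.
Proof.
  intros Hphi HE HB [C1 C2].
  assert (Es : forall j t, Cmult (E t) (ee (- IZR j * t)) =
    ((Re (E t) * cos (2 * PI * IZR j * t) + Im (E t) * sin (2 * PI * IZR j * t)),
     (Im (E t) * cos (2 * PI * IZR j * t) - Re (E t) * sin (2 * PI * IZR j * t)))).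
  { intros j t. replace (ee (- IZR j * t)) with
      (cos (2 * PI * IZR j * t), - sin (2 * PI * IZR j * t)).
    - Ceq; ring.
    - unfold ee. replace (2 * PI * (- IZR j * t)) with (- (2 * PI * IZR j * t)) by ring.
      rewrite cos_neg, sin_neg; auto. }
  assert (En : forall j t, 2 * PI * IZR (- j) * t = - (2 * PI * IZR j * t)).
  { intros j t. rewrite opp_IZR. ring. }
  assert (comb : forall (f g : R -> R) (c d : R), is_RInt f 0 1 0 -> is_RInt g 0 1 0 ->
    is_RInt (fun t => c * f t + d * g t) 0 1 0).
  { intros f g c d Hf Hg.
    pose proof (is_RInt_plus _ _ _ _ _ _ (is_RInt_scal (V := R_NormedModule) _ _ _ c _ Hf)
      (is_RInt_scal (V := R_NormedModule) _ _ _ d _ Hg)) as K.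
    evar_last; [exact K|]. unfold plus, scal; simpl. unfold mult; simpl. eqR. ring. }
  Ceq.
  - apply (trig_orthogonal_zero (fun t => Re (E t)) B); auto.
    + intros j. destruct (HE j) as [A1 A2]. destruct (HE (- j)%Z) as [B1 B2].
      split.
      * eapply is_RInt_ext; [|exact (comb _ _ (/2) (/2) A1 B1)].
        intros t _. cbv beta. rewrite !Es, En, cos_neg, sin_neg. simpl. eqR. field.
      * eapply is_RInt_ext; [|exact (comb _ _ (-/2) (/2) A2 B2)].
        intros t _. cbv beta. rewrite !Es, En, cos_neg, sin_neg. simpl. eqR. field.
    + intros t Ht. eapply Rle_trans; [apply Re_le_Cmod|auto].
  - apply (trig_orthogonal_zero (fun t => Im (E t)) B); auto.
    + intros j. destruct (HE j) as [A1 A2]. destruct (HE (- j)%Z) as [B1 B2].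
      split.
      * eapply is_RInt_ext; [|exact (comb _ _ (/2) (/2) A2 B2)].
        intros t _. cbv beta. rewrite !Es, En, cos_neg, sin_neg. simpl. eqR. field.
      * eapply is_RInt_ext; [|exact (comb _ _ (/2) (-/2) A1 B1)].
        intros t _. cbv beta. rewrite !Es, En, cos_neg, sin_neg. simpl. eqR. field.
    + intros t Ht. eapply Rle_trans; [apply Im_le_Cmod|auto].
Qed.

(* [prim k w] is the antiderivative of [t^k e^(-tw)] that vanishes at infinity. *)
Fixpoint prim (k : nat) (w : C) (t : R) : C :=
  match k with
  | O => Cmult (Copp (Cinv w)) (Cexp (Cmult (RtoC t) (Copp w)))
  | S k' => Cmult (Cinv w) (Cplus (Copp (Cmult (RtoC (t ^ k)) (Cexp (Cmult (RtoC t) (Copp w)))))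
                                  (Cmult (RtoC (INR k)) (prim k' w t)))
  end.

Lemma prim_S (k : nat) (w : C) (t : R) : prim (S k) w t =
  Cmult (Cinv w) (Cplus (Copp (Cmult (RtoC (t ^ S k)) (Cexp (Cmult (RtoC t) (Copp w)))))
                        (Cmult (RtoC (INR (S k))) (prim k w t))).
Proof. reflexivity. Qed.

Lemma RtoC_0_neq (w : C) : 0 < Re w -> w <> RtoC 0.
Proof. intros H E. rewrite E in H. simpl in H. unfold Re in H; simpl in H. lra. Qed.

Lemma is_Cderive_prim (k : nat) (w : C) (t : R) : w <> RtoC 0 ->
  is_Cderive (prim k w) t (Cmult (RtoC (t ^ k)) (Cexp (Cmult (RtoC t) (Copp w)))).
Proof.
  intros Hw. induction k as [|k IH].
  - simpl prim. pose proof (is_Cderive_scal (Copp (Cinv w)) _ _ _ (is_Cderive_Cexp (Copp w) t)) as H.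
    simpl pow. match type of H with is_Cderive _ _ ?a => match goal with |- is_Cderive _ _ ?b =>
      replace b with a; [exact H|] end end.
    field. auto.
  - pose proof (is_Cderive_RtoC (fun t => t ^ S k) t (INR (S k) * t ^ k)) as D.
    assert (D0 : is_derive (fun t => t ^ S k) t (INR (S k) * t ^ k)).
    { evar_last; [apply (is_derive_pow (fun t => t) (S k) t 1); apply (is_derive_id (K := R_AbsRing))|].
      unfold pred. ring. }
    specialize (D D0).
    pose proof (is_Cderive_mult _ _ _ _ _ D (is_Cderive_Cexp (Copp w) t)) as H.
    apply (is_Cderive_scal (RtoC (-1))) in H.
    pose proof (is_Cderive_scal (RtoC (INR (S k))) _ _ _ IH) as H2.
    pose proof (is_Cderive_scal (Cinv w) _ _ _ (is_Cderive_plus _ _ _ _ _ H H2)) as H3.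
    match type of H3 with is_Cderive _ _ ?a => match goal with |- is_Cderive _ _ ?b =>
      replace b with a end end.
    + split; [eapply is_derive_ext; [|exact (proj1 H3)] | eapply is_derive_ext; [|exact (proj2 H3)]];
      intros s; cbv beta; apply f_equal; rewrite prim_S; ring.
    + rewrite RtoC_mult. field. auto.
Qed.

(** For Re w > 0 this evaluates the integral of t^k e^(-tw) over the half-line. Repeated integration
    by parts handles complex w without moving a contour. *)
Lemma prim_at_0 (k : nat) (w : C) : w <> RtoC 0 ->
  Copp (prim k w 0) = Cmult (RtoC (INR (fact k))) (Cinv (Cpow w (S k))).
Proof.
  intros Hw. induction k as [|k IH].
  - simpl. rewrite Cmult_0_l, Cexp_0. field. auto.
  - rewrite prim_S, fact_simpl, mult_INR, RtoC_mult.
    replace (0 ^ S k) with 0 by (simpl; ring).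
    replace (prim k w 0) with (- (RtoC (INR (fact k)) * / w ^ S k))%C by (rewrite <- IH; ring).
    rewrite (Cpow_S w (S k)).
    assert (Cpow w (S k) <> RtoC 0) by (apply Cpow_nz; auto).
    field. auto.
Qed.

Lemma prim_lim (k : nat) (w : C) : 0 < Re w ->
  is_lim_seq (fun n => Cmod (prim k w (INR n))) 0.
Proof.
  intros Hw.
  assert (Hw0 := RtoC_0_neq w Hw).
  assert (P : forall j, is_lim_seq (fun n => Cmod (Cmult (RtoC (INR n ^ j)) (Cexp (Cmult (RtoC (INR n)) (Copp w))))) 0).
  { intros j. apply (is_lim_seq_ext (fun n => (INR n + 0) ^ j * exp (- (INR n * Re w)))).
    - intros n. rewrite Cmod_mult, Cmod_R, Cmod_Cexp. rewrite Rplus_0_r.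
      rewrite Rabs_pos_eq by (apply pow_le, pos_INR). f_equal. f_equal. unfold Re; simpl. ring.
    - apply ex_series_lim_0. apply ex_series_pow_exp; auto. lra. }
  induction k as [|k IH].
  - simpl prim. apply (is_lim_seq_ext (fun n => Cmod (Copp (Cinv w)) *
      Cmod (Cmult (RtoC (INR n ^ 0)) (Cexp (Cmult (RtoC (INR n)) (Copp w)))))).
    + intros n. simpl. rewrite Cmult_1_l, Cmod_mult. auto.
    + replace (Finite 0) with (Rbar_mult (Cmod (Copp (Cinv w))) 0) by (simpl; f_equal; ring).
      apply is_lim_seq_scal_l. apply P.
  - apply (is_lim_seq_le_le (fun _ => 0) _ (fun n => Cmod (Cinv w) *
      (Cmod (Cmult (RtoC (INR n ^ S k)) (Cexp (Cmult (RtoC (INR n)) (Copp w)))) +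
       INR (S k) * Cmod (prim k w (INR n))))).
    + intros n. split; [apply Cmod_ge_0|]. rewrite prim_S.
      rewrite Cmod_mult. apply Rmult_le_compat_l; [apply Cmod_ge_0|].
      eapply Rle_trans; [apply Cmod_triangle|]. rewrite Cmod_opp, (Cmod_mult (RtoC (INR (S k)))), Cmod_R.
      rewrite (Rabs_pos_eq (INR (S k))) by apply pos_INR. apply Rle_refl.
    + apply is_lim_seq_const.
    + replace (Finite 0) with (Rbar_mult (Cmod (Cinv w)) (0 + INR (S k) * 0)) by (simpl; f_equal; ring).
      apply is_lim_seq_scal_l. apply is_lim_seq_plus'; [apply P|].
      apply (is_lim_seq_scal_l _ (INR (S k)) 0) in IH. exact IH.
Qed.

(** The point z + 2 pi i x; integers x give the denominators of the Lipschitz formula. *)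
Definition ishift (z : C) (x : R) : C := (Re z, Im z + 2 * PI * x).

Lemma is_CRInt_ee (m : Z) :
  is_CRInt (fun t => ee (IZR m * t)) 0 1 (if Z.eqb m 0 then RtoC 1 else RtoC 0).
Proof.
  destruct (Z.eqb_spec m 0) as [->|Hm].
  - apply (is_CRInt_ext (fun _ => RtoC 1)); [lra| |].
    + intros t _. rewrite Rmult_0_l. symmetry. apply (ee_IZR 0).
    + split; unfold Re, Im; simpl.
      * evar_last; [apply (is_RInt_const (V := R_NormedModule))|].
        unfold scal; simpl; unfold mult; simpl. eqR. ring.
      * evar_last; [apply (is_RInt_const (V := R_NormedModule))|].
        unfold scal; simpl; unfold mult; simpl. eqR. ring.
  - set (w := (0, 2 * PI * IZR m) : C).
    assert (Hw : w <> RtoC 0).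
    { intros E. apply (f_equal Im) in E. unfold Im in E; simpl in E.
      apply Rmult_integral in E. destruct E as [E|E].
      - pose proof PI_RGT_0; lra.
      - apply eq_IZR in E. auto. }
    assert (Ew : forall t, ee (IZR m * t) = Cexp (Cmult (RtoC t) w)).
    { intros t. rewrite ee_Cexp. f_equal. unfold w. Ceq; ring. }
    assert (D : forall t, is_Cderive (fun t => Cmult (Cinv w) (ee (IZR m * t))) t (ee (IZR m * t))).
    { intros t. pose proof (is_Cderive_scal (Cinv w) _ _ _ (is_Cderive_Cexp w t)) as H.
      replace (ee (IZR m * t)) with (/ w * (w * Cexp (t * w)))%C.
      - split; [eapply is_derive_ext; [|exact (proj1 H)] | eapply is_derive_ext; [|exact (proj2 H)]];
        intros s; cbv beta; rewrite Ew; auto.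
      - rewrite Ew. field. auto. }
    pose proof (is_CRInt_derive _ _ 0 1 ltac:(lra) (fun t _ => D t)) as H.
    replace (RtoC 0) with (/ w * ee (IZR m * 1) - / w * ee (IZR m * 0))%C.
    + apply H. intros t _.
      pose proof (is_Cderive_Cexp w t) as K. apply is_Cderive_continuous in K.
      destruct K as [K1 K2]. 
      split; [eapply continuous_ext; [|exact K1] | eapply continuous_ext; [|exact K2]];
      intros s; cbv beta; rewrite Ew; auto.
    + rewrite Rmult_1_r, Rmult_0_r, ee_IZR, (ee_IZR 0). field. auto.
Qed.

(* Uniform in [x]: [|z + 2 pi i x|] is at least [Re z] and at least [2 pi |x| - |Im z|]. *)
Lemma ishift_lower (z : C) : 0 < Re z ->
  exists rho, 0 < rho /\ forall x, rho * (1 + Rabs x) <= Cmod (ishift z x).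
Proof.
  intros Hz. set (r := Re z) in *. set (y := Rabs (Im z)).
  assert (Hy : 0 <= y) by apply Rabs_pos.
  exists (/ (/ r + 1 + y / r)).
  assert (Hir : 0 < / r) by (apply Rinv_0_lt_compat; auto).
  assert (Hyr : 0 <= y / r) by (apply Rdiv_le_0_compat; auto).
  split; [apply Rinv_0_lt_compat; lra|].
  intros x. set (m := Cmod (ishift z x)).
  assert (H1 : r <= m).
  { pose proof (Re_le_Cmod (ishift z x)) as H. unfold ishift in H at 1. unfold Re at 1 in H. simpl in H.
    rewrite Rabs_pos_eq in H; [exact H|]. fold r. lra. }
  assert (H2 : Rabs x <= m + y).
  { pose proof (Im_le_Cmod (ishift z x)) as H. fold m in H. unfold ishift, Im at 1 in H; simpl in H.
    assert (Hx : Rabs (2 * PI * x) <= m + y).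
    { replace (2 * PI * x) with ((Im z + 2 * PI * x) + - Im z) by ring.
      eapply Rle_trans; [apply Rabs_triang|]. rewrite Rabs_Ropp. unfold y. lra. }
    rewrite Rabs_mult, (Rabs_pos_eq (2 * PI)) in Hx by (pose proof PI_RGT_0; lra).
    pose proof PI2_1. pose proof (Rabs_pos x). nra. }
  apply Rmult_le_reg_l with (/ r + 1 + y / r); [lra|].
  rewrite <- Rmult_assoc, Rinv_r by lra. rewrite Rmult_1_l.
  assert (1 <= m * / r). { apply Rmult_le_reg_r with r; auto. rewrite Rmult_assoc, Rinv_l; lra. }
  unfold Rdiv. nra.
Qed.

(** Stated for all x with |x| >= n so as to serve both x = n and x = -(n + 1). The exponent is -2
    since k + 1 >= 2. *)
Lemma W_bound (z : C) (k : nat) : 0 < Re z -> (1 <= k)%nat ->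
  exists K, 0 <= K /\ forall n x, INR n <= Rabs x ->
    Cmod (Cinv (Cpow (ishift z x) (S k))) <= K * Rpower (INR n + 1) (- (1 + 1)).
Proof.
  intros Hz Hk. destruct (ishift_lower z Hz) as [rho [Hr H]].
  exists (/ rho ^ S k). split; [left; apply Rinv_0_lt_compat, pow_lt; auto|].
  intros n x Hn. pose proof (pos_INR n) as Hn0.
  assert (Hnz : ishift z x <> RtoC 0) by (apply RtoC_0_neq; exact Hz).
  rewrite Cmod_inv, Cmod_pow by (apply Cpow_nz; auto).
  replace (Rpower (INR n + 1) (- (1 + 1))) with (/ (INR n + 1) ^ 2).
  2:{ rewrite Rpower_Ropp. replace (1 + 1) with (INR 2) by (simpl; ring). rewrite Rpower_pow; auto; lra. }
  rewrite <- Rinv_mult. 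
  apply Rinv_le_contravar.
  { apply Rmult_lt_0_compat; apply pow_lt; lra. }
  apply Rle_trans with (rho ^ S k * (INR n + 1) ^ S k).
  - apply Rmult_le_compat_l; [apply pow_le; lra|]. apply Rle_pow; [lra|lia].
  - rewrite <- Rpow_mult_distr. apply pow_incr. split; [apply Rmult_le_pos; lra|].
    eapply Rle_trans; [|apply H]. apply Rmult_le_compat_l; lra.
Qed.

Definition lip_exp (k : nat) (z : C) (n : nat) (t : R) : C :=
  Cmult (RtoC ((INR n + t) ^ k)) (Cexp (Cmult (RtoC (INR n + t)) (Copp z))).

(** The sum over all integers is split into e = n here and e = -(n + 1) in [lip_neg], so that e = 0
    is counted once. *)
Definition lip_pos (k : nat) (z : C) (n : nat) (t : R) : C :=
  Cmult (ee (INR n * t)) (Cinv (Cpow (ishift z (INR n)) (S k))).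

Definition lip_neg (k : nat) (z : C) (n : nat) (t : R) : C :=
  Cmult (ee (- INR (S n) * t)) (Cinv (Cpow (ishift z (- INR (S n))) (S k))).

(** The range extends beyond 1 so that t = 1 has a full neighbourhood on which the majorant
    holds. *)
Lemma lip_exp_bound (k : nat) (z : C) (n : nat) (t : R) : 0 < Re z -> 0 < t < 2 ->
  Cmod (lip_exp k z n t) <= (INR n + 2) ^ k * exp (- (INR n * Re z)).
Proof.
  intros Hz Ht. pose proof (pos_INR n) as Hn. unfold lip_exp.
  rewrite Cmod_mult, Cmod_R, Cmod_Cexp, Rabs_pos_eq by (apply pow_le; lra).
  apply Rmult_le_compat.
  - apply pow_le; lra.
  - left; apply exp_pos.
  - apply pow_incr; lra.
  - replace (Re (RtoC (INR n + t) * - z)%C) with (- ((INR n + t) * Re z)) by (unfold Re; simpl; ring).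
    assert (- ((INR n + t) * Re z) <= - (INR n * Re z)) by nra.
    destruct H as [H|H]; [left; apply exp_increasing; auto | rewrite H; lra].
Qed.

Lemma lip_pos_bound (k : nat) (z : C) : 0 < Re z -> (1 <= k)%nat ->
  exists K, 0 <= K /\ forall n t, Cmod (lip_pos k z n t) <= K * Rpower (INR n + 1) (- (1 + 1))
    /\ Cmod (lip_neg k z n t) <= K * Rpower (INR n + 1) (- (1 + 1)).
Proof.
  intros Hz Hk. destruct (W_bound z k Hz Hk) as [K [HK H]]. exists K. split; auto.
  intros n t. pose proof (pos_INR n). unfold lip_pos, lip_neg.
  rewrite !Cmod_mult, !Cmod_ee, !Rmult_1_l. split; apply H.
  - rewrite Rabs_pos_eq; lra.
  - rewrite Rabs_Ropp, Rabs_pos_eq by apply pos_INR. rewrite S_INR. lra.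
Qed.

Lemma ex_series_zeta2 (K : R) : ex_series (fun n => K * Rpower (INR n + 1) (- (1 + 1))).
Proof. apply (ex_series_scal_l (V := R_NormedModule)). apply ex_series_zeta. lra. Qed.

Lemma is_Cderive_shift (f : R -> C) (c t : R) (l : C) :
  is_Cderive f (c + t) l -> is_Cderive (fun t => f (c + t)) t l.
Proof.
  assert (D : is_derive (fun t => c + t) t 1) by (auto_derive; auto).
  intros [H1 H2]. split.
  - evar_last; [exact (is_derive_comp (V := R_NormedModule) (fun t => Re (f t)) (fun t => c + t) t _ _ H1 D)|].
    unfold scal; simpl; unfold mult; simpl. eqR; ring.
  - evar_last; [exact (is_derive_comp (V := R_NormedModule) (fun t => Im (f t)) (fun t => c + t) t _ _ H2 D)|].
    unfold scal; simpl; unfold mult; simpl. eqR; ring.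
Qed.

Lemma is_Cderive_lip_exp (k : nat) (z : C) (n : nat) (t : R) :
  exists l, is_Cderive (lip_exp k z n) t l.
Proof.
  eexists. unfold lip_exp.
  apply (is_Cderive_shift (fun t => Cmult (RtoC (t ^ k)) (Cexp (Cmult (RtoC t) (Copp z))))).
  apply is_Cderive_mult; [apply is_Cderive_RtoC | apply is_Cderive_Cexp].
  apply (is_derive_pow (fun t => t) k _ 1). apply (is_derive_id (K := R_AbsRing)).
Qed.

Lemma Ccontinuous_ee (c t : R) : Ccontinuous (fun t => ee (c * t)) t.
Proof.
  split; unfold ee, Re, Im; simpl; apply (ex_derive_continuous (V := R_NormedModule)); auto_derive; auto.
Qed.

(** As e^(2 pi i j n) = 1, the character e^(-2 pi i j t) merges with the exponential into
    e^(-(n+t)w), where w = z + 2 pi i j. The integrals over [0, 1] are then the pieces over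
    [n, n + 1] of one integral over the half-line. *)
Lemma lip_exp_coeff (k : nat) (z : C) (j : Z) : 0 < Re z ->
  is_CRInt (fun t => Cmult (CSeries (fun n => lip_exp k z n t)) (ee (- IZR j * t))) 0 1
    (Cmult (RtoC (INR (fact k))) (Cinv (Cpow (ishift z (IZR j)) (S k)))).
Proof.
  intros Hz. set (w := ishift z (IZR j)).
  assert (Hw : 0 < Re w) by exact Hz.
  assert (Hw0 := RtoC_0_neq w Hw).
  assert (E : forall n t, Cmult (ee (- IZR j * t)) (lip_exp k z n t) =
    Cmult (RtoC ((INR n + t) ^ k)) (Cexp (Cmult (RtoC (INR n + t)) (Copp w)))).
  { intros n t. unfold lip_exp.
    replace (Cexp (RtoC (INR n + t) * - z)) with (Cexp (RtoC (INR n + t) * - w) * ee (IZR j * (INR n + t)))%C.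
    - replace (IZR j * (INR n + t)) with (IZR (j * Z.of_nat n) + IZR j * t)
        by (rewrite mult_IZR, <- INR_IZR_INZ; ring).
      rewrite ee_plus, ee_IZR.
      assert (I : (ee (- IZR j * t) * ee (IZR j * t))%C = RtoC 1).
      { rewrite <- ee_plus. replace (- IZR j * t + IZR j * t) with 0 by ring. apply (ee_IZR 0). }
      transitivity (RtoC ((INR n + t) ^ k) * Cexp (RtoC (INR n + t) * - w) * (ee (- IZR j * t) * ee (IZR j * t)))%C;
      [ring | rewrite I; ring].
    - rewrite ee_Cexp, <- Cexp_plus. f_equal. unfold w, ishift. Ceq; ring. }
  assert (HI : forall n, is_CRInt (fun t => Cmult (ee (- IZR j * t)) (lip_exp k z n t)) 0 1
     (Cminus (prim k w (INR (S n))) (prim k w (INR n)))).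
  { intros n. rewrite S_INR. replace (prim k w (INR n)) with (prim k w (INR n + 0)) by (f_equal; ring).
    apply (is_CRInt_derive (fun t => prim k w (INR n + t))); [lra| |].
    - intros t _. rewrite E. apply is_Cderive_shift. apply is_Cderive_prim; auto.
    - intros t _. destruct (is_Cderive_lip_exp k w n t) as [l Hl].
      apply is_Cderive_continuous in Hl.
      destruct Hl as [K1 K2].
      split; [eapply continuous_ext; [|exact K1] | eapply continuous_ext; [|exact K2]];
      intros s; cbv beta; rewrite E; auto. }
  pose proof (is_Cseries_telescope _ (prim_lim k w Hw)) as HT. cbv beta in HT. change (INR 0) with 0 in HT.
  rewrite prim_at_0 in HT by auto. apply is_Cseries_unique in HT. rewrite <- HT.
  assert (eM : ex_series (fun n => (INR n + 2) ^ k * exp (- (INR n * Re z)))).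
  { apply ex_series_pow_exp; auto; lra. }
  eapply is_CRInt_ext; [lra| |apply (is_CRInt_CSeries (fun n t => Cmult (ee (- IZR j * t)) (lip_exp k z n t)) _
    (fun n => (INR n + 2) ^ k * exp (- (INR n * Re z)))); auto; [lra|]].
  - intros t Ht. cbv beta. rewrite Cmult_comm. apply is_Cseries_unique, is_Cseries_scal.
    apply CSeries_correct with (2 := eM). intros n. apply lip_exp_bound; auto; lra.
  - intros n t Ht. rewrite Cmod_mult, Cmod_ee, Rmult_1_l. apply lip_exp_bound; auto; lra.
Qed.

Lemma is_CRInt_ee_shift (a b : Z) (c : C) :
  is_CRInt (fun t => Cmult (ee (- IZR b * t)) (Cmult (ee (IZR a * t)) c)) 0 1
    (if Z.eqb a b then c else RtoC 0).
Proof.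
  replace (if Z.eqb a b then c else RtoC 0) with (Cmult c (if Z.eqb (a - b) 0 then RtoC 1 else RtoC 0)).
  - eapply is_CRInt_ext; [lra| |apply is_CRInt_scal, is_CRInt_ee].
    intros t _. cbv beta. 
    replace (IZR (a - b) * t) with (- IZR b * t + IZR a * t) by (rewrite minus_IZR; ring).
    rewrite ee_plus. ring.
  - destruct (Z.eqb_spec a b); destruct (Z.eqb_spec (a - b) 0); try lia; ring.
Qed.

Lemma lip_poles_coeff (k : nat) (z : C) (j : Z) : 0 < Re z -> (1 <= k)%nat ->
  is_CRInt (fun t => Cmult (Cplus (CSeries (fun n => lip_pos k z n t))
                                  (CSeries (fun n => lip_neg k z n t))) (ee (- IZR j * t))) 0 1
    (Cinv (Cpow (ishift z (IZR j)) (S k))).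
Proof.
  intros Hz Hk. destruct (lip_pos_bound k z Hz Hk) as [K [HK HB]].
  assert (eM := ex_series_zeta2 K).
  set (W := fun x => Cinv (Cpow (ishift z x) (S k))).
  assert (I1 := is_CRInt_CSeries (fun n t => Cmult (ee (- IZR j * t)) (lip_pos k z n t))
    (fun n => if Z.eqb (Z.of_nat n) j then W (INR n) else RtoC 0)
    (fun n => K * Rpower (INR n + 1) (- (1 + 1))) 0 1 Rlt_0_1).
  assert (I2 := is_CRInt_CSeries (fun n t => Cmult (ee (- IZR j * t)) (lip_neg k z n t))
    (fun n => if Z.eqb (- Z.of_nat (S n)) j then W (- INR (S n)) else RtoC 0)
    (fun n => K * Rpower (INR n + 1) (- (1 + 1))) 0 1 Rlt_0_1).
  (* By orthogonality a single term survives, in the first half-sum if j >= 0 and in the second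
     otherwise. *)
  assert (S1 : CSeries (fun n => if Z.eqb (Z.of_nat n) j then W (INR n) else RtoC 0) =
     if Z.leb 0 j then W (IZR j) else RtoC 0).
  { apply is_Cseries_unique. destruct (Z.leb_spec 0 j) as [Hj|Hj].
    - eapply is_Cseries_ext; [|apply (is_Cseries_single (W (IZR j)) (Z.to_nat j))].
      intros n. cbv beta. destruct (Nat.eqb_spec n (Z.to_nat j)); destruct (Z.eqb_spec (Z.of_nat n) j); try lia; auto.
      rewrite INR_IZR_INZ. f_equal. f_equal. auto.
    - apply is_Cseries_zero. intros n. destruct (Z.eqb_spec (Z.of_nat n) j); auto; lia. }
  assert (S2 : CSeries (fun n => if Z.eqb (- Z.of_nat (S n)) j then W (- INR (S n)) else RtoC 0) =
     if Z.leb 0 j then RtoC 0 else W (IZR j)).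
  { apply is_Cseries_unique. destruct (Z.leb_spec 0 j) as [Hj|Hj].
    - apply is_Cseries_zero. intros n. destruct (Z.eqb_spec (- Z.of_nat (S n)) j); auto; lia.
    - eapply is_Cseries_ext; [|apply (is_Cseries_single (W (IZR j)) (Z.to_nat (- j) - 1)%nat)].
      intros n. cbv beta. destruct (Nat.eqb_spec n (Z.to_nat (- j) - 1)%nat);
      destruct (Z.eqb_spec (- Z.of_nat (S n)) j); try lia; auto.
      rewrite INR_IZR_INZ, <- opp_IZR. f_equal. f_equal. auto. }
  rewrite S1 in I1. rewrite S2 in I2.
  replace (Cinv (Cpow (ishift z (IZR j)) (S k))) with
    ((if Z.leb 0 j then W (IZR j) else RtoC 0) + (if Z.leb 0 j then RtoC 0 else W (IZR j)))%C
    by (unfold W; destruct (Z.leb 0 j); ring).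
  eapply is_CRInt_ext; [lra| |apply is_CRInt_plus; [apply I1 | apply I2]]; auto.
  - intros t Ht. cbv beta.
    rewrite (is_Cseries_unique _ _ (is_Cseries_scal (ee (- IZR j * t)) _ _
      (CSeries_correct (fun n => lip_pos k z n t) _ (fun n => proj1 (HB n t)) eM))).
    rewrite (is_Cseries_unique _ _ (is_Cseries_scal (ee (- IZR j * t)) _ _
      (CSeries_correct (fun n => lip_neg k z n t) _ (fun n => proj2 (HB n t)) eM))).
    ring.
  - intros n. unfold lip_pos. rewrite INR_IZR_INZ. apply (is_CRInt_ee_shift (Z.of_nat n) j).
  - intros n t Ht. rewrite Cmod_mult, Cmod_ee, Rmult_1_l. apply HB.
  - intros n. unfold lip_neg. rewrite INR_IZR_INZ, <- (opp_IZR (Z.of_nat (S n))). apply (is_CRInt_ee_shift (- Z.of_nat (S n)) j).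
  - intros n t Ht. rewrite Cmod_mult, Cmod_ee, Rmult_1_l. apply HB.
Qed.

(* Both sides have the same Fourier coefficients in [t], and [k >= 1] makes them continuous. *)
Lemma lipschitz_formula (k : nat) (z : C) (t : R) : 0 < Re z -> (1 <= k)%nat -> 0 < t <= 1 ->
  CSeries (fun n => lip_exp k z n t) =
  Cmult (RtoC (INR (fact k))) (Cplus (CSeries (fun n => lip_pos k z n t))
                                     (CSeries (fun n => lip_neg k z n t))).
Proof.
  intros Hz Hk.
  destruct (lip_pos_bound k z Hz Hk) as [K [HK HB]].
  assert (eM := ex_series_zeta2 K).
  assert (eF : ex_series (fun n => (INR n + 2) ^ k * exp (- (INR n * Re z)))).
  { apply ex_series_pow_exp; auto; lra. }
  set (c := Copp (RtoC (INR (fact k)))).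
  set (E := fun t => Cplus (CSeries (fun n => lip_exp k z n t))
    (Cmult c (Cplus (CSeries (fun n => lip_pos k z n t)) (CSeries (fun n => lip_neg k z n t))))).
  assert (HC : forall t, 0 < t <= 1 -> Ccontinuous E t).
  { intros s Hs. apply Ccontinuous_plus.
    (* The radius min (s, 1) keeps the neighbourhood of s inside (0, 2). *)
    - apply (Ccontinuous_CSeries (lip_exp k z) (fun n => (INR n + 2) ^ k * exp (- (INR n * Re z))) s (Rmin s 1)); auto.
      + apply Rmin_pos; lra.
      + intros n. destruct (is_Cderive_lip_exp k z n s) as [l Hl]. eapply is_Cderive_continuous; eauto.
      + intros n u Hu. pose proof (Rmin_l s 1). pose proof (Rmin_r s 1).
        assert (Hu' : Rabs (u - s) <= Rmin s 1) by lra. apply Rabs_le_between in Hu'.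
        assert (0 < u < 2).
        { split; [|apply Rabs_def2 in Hu; lra]. apply Rabs_def2 in Hu. lra. }
        apply lip_exp_bound; auto.
    - apply Ccontinuous_scal, Ccontinuous_plus.
      + apply (Ccontinuous_CSeries (lip_pos k z) _ s 1 Rlt_0_1) with (3 := eM).
        * intros n. unfold lip_pos.
          pose proof (Ccontinuous_scal (Cinv (Cpow (ishift z (INR n)) (S k))) _ _ (Ccontinuous_ee (INR n) s)) as [K1 K2].
          split; [eapply continuous_ext; [|exact K1] | eapply continuous_ext; [|exact K2]];
          intros u; cbv beta; rewrite Cmult_comm; auto.
        * intros n u _. apply HB.
      + apply (Ccontinuous_CSeries (lip_neg k z) _ s 1 Rlt_0_1) with (3 := eM).
        * intros n. unfold lip_neg.
          pose proof (Ccontinuous_scal (Cinv (Cpow (ishift z (- INR (S n))) (S k))) _ _ (Ccontinuous_ee (- INR (S n)) s)) as [K1 K2].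
          split; [eapply continuous_ext; [|exact K1] | eapply continuous_ext; [|exact K2]];
          intros u; cbv beta; rewrite Cmult_comm; auto.
        * intros n u _. apply HB. }
  assert (H0 : forall t, 0 < t < 1 -> E t = RtoC 0).
  { intros s Hs.
    apply (fourier_unique E (2 * Series (fun n => (INR n + 2) ^ k * exp (- (INR n * Re z))) +
       Cmod c * (2 * Series (fun n => K * Rpower (INR n + 1) (- (1 + 1)))
               + 2 * Series (fun n => K * Rpower (INR n + 1) (- (1 + 1)))))); auto.
    - intros j. pose proof (is_CRInt_plus _ _ _ _ _ _ (lip_exp_coeff k z j Hz)
        (is_CRInt_scal c _ _ _ _ (lip_poles_coeff k z j Hz Hk))) as H.
      replace (RtoC 0) with (RtoC (INR (fact k)) * / ishift z (IZR j) ^ S k + c * / ishift z (IZR j) ^ S k)%C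
        by (unfold c; ring).
      eapply is_CRInt_ext; [lra| |exact H]. intros u _. unfold E. cbv beta. ring.
    - intros u Hu. unfold E. eapply Rle_trans; [apply Cmod_triangle|]. apply Rplus_le_compat.
      + apply CSeries_abs_le; auto. intros n; apply lip_exp_bound; auto; lra.
      + rewrite Cmod_mult. apply Rmult_le_compat_l; [apply Cmod_ge_0|].
        eapply Rle_trans; [apply Cmod_triangle|]. apply Rplus_le_compat;
        apply CSeries_abs_le; auto; intros n; apply HB.
    - apply HC; lra. }
  intros Ht. assert (HE : E t = RtoC 0).
  (* The endpoint t = 1 is reached by continuity from the left; there the exponential series runs
     over the positive integers, the form needed for the sum over divisors. *)
  { destruct (Rlt_dec t 1); [apply H0; lra|]. assert (t = 1) as -> by lra.
    destruct (HC 1 ltac:(lra)) as [C1 C2].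
    Ceq.
    - apply (continuous_zero_left (fun t => Re (E t)) 1 1); auto; try lra.
      intros u Hu. cbv beta. rewrite H0 by lra. auto.
    - apply (continuous_zero_left (fun t => Im (E t)) 1 1); auto; try lra.
      intros u Hu. cbv beta. rewrite H0 by lra. auto. }
  unfold E, c in HE.
  match goal with |- ?a = ?b => replace a with ((a + - (RtoC (INR (fact k))) * (CSeries (fun n => lip_pos k z n t) + CSeries (fun n => lip_neg k z n t))) + b)%C by ring end.
  rewrite HE. ring.
Qed.

(** * The theta-type identity *)

Lemma RtoC_pow (r : R) (n : nat) : RtoC (r ^ n) = Cpow (RtoC r) n.
Proof.
  induction n as [|n IH]; [reflexivity|]. rewrite Cpow_S, <- IH, <- RtoC_mult. reflexivity.
Qed.

Lemma Cexp_R (x : R) : Cexp (RtoC x) = RtoC (exp x).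
Proof. Ceq; [rewrite cos_0 | rewrite sin_0]; ring. Qed.

Definition Wk (k : nat) (z : C) : C := Cinv (Cpow z (S k)).

(** A mean value estimate: the difference decays by one power more than either term. Induction on j
    through a^(-j-1) - b^(-j-1) = a^(-1) (a^(-j) - b^(-j)) + b^(-j) (a^(-1) - b^(-1)). *)
Lemma Cinv_pow_diff (a b : C) (r : R) (j : nat) : 0 < r -> r <= Cmod a -> r <= Cmod b ->
  Cmod (Cminus (Cinv (Cpow a j)) (Cinv (Cpow b j))) <= INR j * Cmod (Cminus a b) / r ^ (S j).
Proof.
  intros Hr Ha Hb.
  assert (Ha0 : a <> RtoC 0) by (apply Cmod_gt_0; lra).
  assert (Hb0 : b <> RtoC 0) by (apply Cmod_gt_0; lra).
  set (D := Cmod (a - b)%C). assert (HD : 0 <= D) by apply Cmod_ge_0.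
  induction j as [|j IH].
  - simpl. replace (/ RtoC 1 - / RtoC 1)%C with (RtoC 0) by ring. rewrite Cmod_0.
    unfold Rdiv. rewrite !Rmult_0_l. lra.
  - assert (Hbj := Cpow_nz b j Hb0). assert (Haj := Cpow_nz a j Ha0).
    replace (/ Cpow a (S j) - / Cpow b (S j))%C with
      (/ a * (/ Cpow a j - / Cpow b j) + / Cpow b j * (/ (a * b) * - (a - b)))%C.
    2:{ rewrite !Cpow_S. field. repeat split; auto. }
    assert (Hri : / Cmod a <= / r) by (apply Rinv_le_contravar; auto).
    assert (Hrb : / Cmod b <= / r) by (apply Rinv_le_contravar; auto).
    assert (Hbi : / Cmod b ^ j <= / r ^ j).
    { apply Rinv_le_contravar; [apply pow_lt; auto | apply pow_incr; lra]. }
    assert (pa : 0 < / Cmod a) by (apply Rinv_0_lt_compat; lra).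
    assert (pb : 0 < / Cmod b) by (apply Rinv_0_lt_compat; lra).
    assert (pbj : 0 < / Cmod b ^ j) by (apply Rinv_0_lt_compat, pow_lt; lra).
    eapply Rle_trans; [apply Cmod_triangle|].
    rewrite (Cmod_mult (/ a)), (Cmod_mult (/ Cpow b j)), (Cmod_mult (/ (a * b))).
    rewrite Cmod_opp. fold D.
    rewrite !Cmod_inv, Cmod_mult, Cmod_pow; auto using Cmult_neq_0.
    rewrite Rinv_mult.
    apply Rle_trans with (/ r * (INR j * D / r ^ S j) + / r ^ j * (/ r * / r * D)).
    + apply Rplus_le_compat.
      * apply Rmult_le_compat; auto; [lra|apply Cmod_ge_0].
      * apply Rmult_le_compat; auto; [lra| |].
        -- apply Rmult_le_pos; auto. apply Rmult_le_pos; lra.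
        -- apply Rmult_le_compat_r; auto. apply Rmult_le_compat; lra.
    + rewrite S_INR. right. simpl. field. repeat split; try lra. apply pow_nonzero; lra.
Qed.

(** Frequencies e + 1 and -(e + 1) are subtracted because the Lipschitz expansions at psi and 1 -
    psi differ by coefficients that are odd in the frequency. *)
Definition pole_diff (k : nat) (tau : R) (e : nat) (v : R) : C :=
  Cminus (Wk k (ishift (RtoC (tau * v)) (INR (S e)))) (Wk k (ishift (RtoC (tau * v)) (- INR (S e)))).

(** A difference of (k + 1)-st powers decays like k + 2 half-powers in each index; k + 2 >= 3 gives
    the summable exponent -3/2. *)
Lemma Rpower_half_pow (y : R) (k : nat) : 1 <= y -> (1 <= k)%nat ->
  / (Rpower y (1 / 2)) ^ (S (S k)) <= Rpower y (- (1 + 1 / 2)).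
Proof.
  intros Hy Hk. rewrite Rpower_Ropp.
  assert (H1 : 1 <= Rpower y (1 / 2)).
  { apply Rle_trans with (Rpower y 0); [rewrite Rpower_O; lra | apply Rle_Rpower; lra]. }
  apply Rinv_le_contravar; [apply exp_pos|].
  apply Rle_trans with (Rpower y (1 / 2) ^ 3).
  - right. rewrite <- Rpower_pow by apply exp_pos. rewrite Rpower_mult. f_equal. simpl. field.
  - apply Rle_pow; auto. lia.
Qed.

(* [|a|^2 >= 2 |Re a| |Im a|] splits the decay evenly between the two indices. *)
Lemma Wk_diff_bound (k : nat) (tau theta : R) : 0 < tau -> 0 < theta < 1 -> (1 <= k)%nat ->
  exists K, 0 <= K /\ forall m e x, Rabs x = INR (S e) ->
    Cmod (Cminus (Wk k (ishift (RtoC (tau * (INR m + theta))) x))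
                 (Wk k (ishift (RtoC (tau * (INR m + 1 - theta))) x))) <=
    K * (Rpower (INR m + 1) (- (1 + 1 / 2)) * Rpower (INR e + 1) (- (1 + 1 / 2))).
Proof.
  intros Ht Hth Hk. set (rho := Rmin theta (1 - theta)).
  assert (Hrho : 0 < rho) by (apply Rmin_pos; lra).
  pose proof (Rmin_l theta (1 - theta) : rho <= _) as Hr1.
  pose proof (Rmin_r theta (1 - theta) : rho <= _) as Hr2.
  assert (Htr : 0 < tau * rho) by (apply Rmult_lt_0_compat; auto).
  (* The real part is at least tau rho (m + 1) and the imaginary part at least e + 1 in modulus, so
     the squared modulus is at least tau rho (m + 1)(e + 1). *)
  set (c := sqrt (tau * rho)). assert (Hc : 0 < c) by (apply sqrt_lt_R0; auto).
  exists (INR (S k) * tau / c ^ S (S k)). split.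
  { apply Rdiv_le_0_compat; [|apply pow_lt; auto]. apply Rmult_le_pos; [apply pos_INR|lra]. }
  intros m e x Hx. pose proof (pos_INR m) as Hm. pose proof (pos_INR e) as He.
  set (p := Rpower (INR m + 1) (1 / 2)). set (q := Rpower (INR e + 1) (1 / 2)).
  assert (Hp : 0 < p) by apply exp_pos. assert (Hq : 0 < q) by apply exp_pos.
  assert (Hp2 : p * p = INR m + 1).
  { unfold p. rewrite <- Rpower_plus. replace (1 / 2 + 1 / 2) with 1 by lra. apply Rpower_1; lra. }
  assert (Hq2 : q * q = INR e + 1).
  { unfold q. rewrite <- Rpower_plus. replace (1 / 2 + 1 / 2) with 1 by lra. apply Rpower_1; lra. }
  assert (low : forall v, rho * (INR m + 1) <= v -> c * p * q <= Cmod (ishift (RtoC (tau * v)) x)).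
  { intros v Hv. unfold Cmod.
    rewrite <- (sqrt_pow2 (c * p * q)) by (left; repeat apply Rmult_lt_0_compat; auto).
    apply sqrt_le_1_alt. unfold ishift; simpl fst; simpl snd.
    replace ((c * p * q) ^ 2) with ((c * c) * (p * p) * (q * q)) by ring.
    unfold c. rewrite sqrt_sqrt by lra. rewrite Hp2, Hq2.
    unfold Re, Im; simpl fst; simpl snd. rewrite Rplus_0_l.
    assert (Hx2 : (INR e + 1) ^ 2 = x ^ 2) by (rewrite <- S_INR, <- Hx; apply pow2_abs).
    assert (Hx3 : (INR e + 1) ^ 2 <= (2 * PI * x) ^ 2).
    { rewrite Hx2, !Rpow_mult_distr. pose proof PI2_1. pose proof (pow2_ge_0 x).
      assert (1 <= 2 ^ 2 * PI ^ 2) by nra.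
      apply Rle_trans with (1 * x ^ 2); [lra|]. apply Rmult_le_compat_r; auto. }
    assert (Hv2 : tau * rho * (INR m + 1) <= tau * v).
    { rewrite Rmult_assoc. apply Rmult_le_compat_l; lra. }
    assert (Hv0 : 0 <= tau * rho * (INR m + 1)) by (apply Rmult_le_pos; lra).
    set (al := tau * rho * (INR m + 1)) in *. set (tv := tau * v) in *. set (X := (2 * PI * x) ^ 2) in *.
    assert (al * (INR e + 1) <= al ^ 2 + (INR e + 1) ^ 2) by nra.
    assert (al ^ 2 <= tv ^ 2) by (apply pow_incr; lra). lra. }
  assert (Hpos : 0 < c * p * q) by (repeat apply Rmult_lt_0_compat; auto).
  eapply Rle_trans.
  { apply (Cinv_pow_diff _ _ (c * p * q) (S k) Hpos); apply low.
    - nra.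
    - nra. }
  (* The two points differ by tau (2 theta - 1), independently of m and x: this is where the extra
     power is gained. *)
  assert (Hd : Cmod (ishift (RtoC (tau * (INR m + theta))) x - ishift (RtoC (tau * (INR m + 1 - theta))) x) <= tau).
  { replace (ishift (RtoC (tau * (INR m + theta))) x - ishift (RtoC (tau * (INR m + 1 - theta))) x)%C
      with (RtoC (tau * (2 * theta - 1))) by (unfold ishift; Ceq; ring).
    rewrite Cmod_R, Rabs_mult, (Rabs_pos_eq tau) by lra.
    assert (Rabs (2 * theta - 1) <= 1) by (apply Rabs_le; lra). nra. }
  assert (Hp1 := Rpower_half_pow (INR m + 1) k ltac:(lra) Hk). fold p in Hp1.
  assert (Hq1 := Rpower_half_pow (INR e + 1) k ltac:(lra) Hk). fold q in Hq1.
  assert (P1 : 0 < / p ^ S (S k)) by (apply Rinv_0_lt_compat, pow_lt; auto).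
  assert (Q1 : 0 < / q ^ S (S k)) by (apply Rinv_0_lt_compat, pow_lt; auto).
  assert (C1 : 0 < / c ^ S (S k)) by (apply Rinv_0_lt_compat, pow_lt; auto).
  rewrite !Rpow_mult_distr. unfold Rdiv. rewrite !Rinv_mult.
  assert (Hk0 : 0 <= INR (S k)) by apply pos_INR.
  set (P := Rpower (INR m + 1) (- (1 + 1 * / 2))) in *. set (Q := Rpower (INR e + 1) (- (1 + 1 * / 2))) in *.
  apply Rle_trans with (INR (S k) * tau * (/ c ^ S (S k) * / p ^ S (S k) * / q ^ S (S k))).
  - apply Rmult_le_compat_r; [|apply Rmult_le_compat_l; auto].
    left; repeat apply Rmult_lt_0_compat; auto.
  - replace (INR (S k) * tau * (/ c ^ S (S k) * / p ^ S (S k) * / q ^ S (S k))) with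
      (INR (S k) * tau * / c ^ S (S k) * (/ p ^ S (S k) * / q ^ S (S k))) by ring.
    apply Rmult_le_compat_l.
    + apply Rmult_le_pos; [|lra]. apply Rmult_le_pos; lra.
    + apply Rmult_le_compat; auto; lra.
Qed.

Lemma Cpow_Ci_even (j : nat) : Cpow (Copp Ci) (2 * j) = RtoC ((-1) ^ j).
Proof.
  rewrite Cpow_mult_r, RtoC_pow. f_equal. Ceq; ring.
Qed.

(* Multiplication by [tau / (2 pi i)] carries the poles [w + 2 pi i x] to [tau x - i tau w / (2 pi)]. *)
Lemma Wk_rotate (j : nat) (tau a b : R) : 0 < tau -> 0 < a ->
  Wk (2 * j + 1) (tau / (2 * PI) * b, - (tau / (2 * PI) * a)) =
  Cmult (RtoC ((-1) ^ (j + 1) * (2 * PI / tau) ^ (2 * j + 2))) (Wk (2 * j + 1) (a, b)).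
Proof.
  intros Ht Ha. pose proof PI_RGT_0 as Hpi. unfold Wk.
  replace (tau / (2 * PI) * b, - (tau / (2 * PI) * a)) with
    (RtoC (tau / (2 * PI)) * (- Ci) * (a, b))%C by (Ceq; ring).
  rewrite !Cpow_mult_l. replace (S (2 * j + 1)) with (2 * (j + 1))%nat by lia.
  rewrite Cpow_Ci_even, <- RtoC_pow.
  assert (Hr : (tau / (2 * PI)) ^ (2 * (j + 1)) <> 0).
  { apply pow_nonzero. apply Rgt_not_eq, Rdiv_lt_0_compat; lra. }
  assert (Hs : (-1) ^ (j + 1) <> 0) by (apply pow_nonzero; lra).
  assert (Hab : (Cpow (a, b) (2 * (j + 1))) <> RtoC 0) by (apply Cpow_nz, RtoC_0_neq; exact Ha).
  replace ((2 * PI / tau) ^ (2 * j + 2)) with (/ (tau / (2 * PI)) ^ (2 * (j + 1))).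
  2:{ rewrite <- pow_inv. replace (2 * (j + 1))%nat with (2 * j + 2)%nat by lia. f_equal. field. lra. }
  replace ((-1) ^ (j + 1)) with (/ (-1) ^ (j + 1)) at 2.
  2:{ rewrite <- pow_inv. f_equal. lra. }
  rewrite RtoC_mult, !RtoC_inv by auto.
  assert (RtoC ((tau / (2 * PI)) ^ (2 * (j + 1))) <> RtoC 0) by (intros E; apply RtoC_inj in E; auto).
  assert (RtoC ((-1) ^ (j + 1)) <> RtoC 0) by (intros E; apply RtoC_inj in E; auto).
  field. auto.
Qed.

Lemma Cpow_Cconj (z : C) (n : nat) : Cpow (Cconj z) n = Cconj (Cpow z n).
Proof.
  induction n as [|n IH].
  - simpl. Ceq; ring.
  - rewrite !Cpow_S, IH. Ceq; ring.
Qed.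

Lemma Wk_Cconj (k : nat) (z : C) : Wk k (Cconj z) = Cconj (Wk k z).
Proof.
  unfold Wk. rewrite Cpow_Cconj. set (w := Cpow z (S k)).
  Ceq; unfold Rdiv; [|rewrite Ropp_mult_distr_l]; f_equal; f_equal; ring.
Qed.

(** The exponent k + 1 = 2 (j + 1) is even, so a pole may be reflected in the origin. *)
Lemma Wk_opp (j : nat) (z : C) : Wk (2 * j + 1) (Copp z) = Wk (2 * j + 1) z.
Proof.
  unfold Wk. f_equal. replace (- z)%C with (RtoC (-1) * z)%C by ring.
  rewrite Cpow_mult_l, <- RtoC_pow. replace (S (2 * j + 1)) with (2 * (j + 1))%nat by lia.
  rewrite pow_1_even. ring.
Qed.

Lemma ee_minus_opp (x : R) : Cminus (ee x) (ee (- x)) = Cmult (0, 2) (RtoC (sin (2 * PI * x))).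
Proof.
  Ceq; rewrite ?Ropp_mult_distr_r_reverse, ?cos_neg, ?sin_neg; ring.
Qed.

Lemma ee_reflect (n : Z) (psi : R) : ee (IZR n * (1 - psi)) = ee (- (IZR n * psi)).
Proof.
  replace (IZR n * (1 - psi)) with (IZR n + - (IZR n * psi)) by ring.
  rewrite ee_plus, ee_IZR. ring.
Qed.

Lemma lip_exp_real (k : nat) (y : R) (n : nat) (t : R) :
  lip_exp k (RtoC y) n t = RtoC ((INR n + t) ^ k * exp (- ((INR n + t) * y))).
Proof.
  unfold lip_exp. rewrite <- RtoC_opp, <- RtoC_mult, Cexp_R, <- RtoC_mult.
  f_equal. f_equal. f_equal. ring.
Qed.

Definition alt_pair (k : nat) (tau psi : R) (n : nat) (v : R) : R :=
  (INR n + psi) ^ k * exp (- (tau * ((INR n + psi) * v)))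
  - (INR n + 1 - psi) ^ k * exp (- (tau * ((INR n + 1 - psi) * v))).

(** First use of the Lipschitz formula, at psi and at 1 - psi. For an integer e, e^(2 pi i e (1 -
    psi)) is conjugate to e^(2 pi i e psi), so the difference has coefficients 2i sin (2 pi e
    psi). *)
Lemma alt_pair_series (k : nat) (tau v psi : R) :
  0 < tau -> 0 < v -> 0 < psi < 1 -> (1 <= k)%nat ->
  is_Cseries (fun n => RtoC (alt_pair k tau psi n v))
   (Cmult (Cmult (RtoC (INR (fact k))) (0, 2))
     (CSeries (fun e => Cmult (RtoC (sin (2 * PI * (INR (S e) * psi)))) (pole_diff k tau e v)))).
Proof.
  intros Ht Hv Hp Hk.
  set (z := RtoC (tau * v)).
  assert (Hz : 0 < Re z) by (unfold z, Re; simpl; apply Rmult_lt_0_compat; auto).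
  destruct (lip_pos_bound k z Hz Hk) as [K [HK HB]].
  assert (eM := ex_series_zeta2 K).
  assert (eF : ex_series (fun n => (INR n + 2) ^ k * exp (- (INR n * Re z)))).
  { apply ex_series_pow_exp; auto; lra. }
  assert (F1 := CSeries_correct (fun n => lip_exp k z n psi) _ (fun n => lip_exp_bound k z n psi Hz ltac:(lra)) eF).
  assert (F2 := CSeries_correct (fun n => lip_exp k z n (1 - psi)) _ (fun n => lip_exp_bound k z n (1 - psi) Hz ltac:(lra)) eF).
  assert (F := is_Cseries_minus _ _ _ _ F1 F2).
  rewrite !lipschitz_formula in F by (auto; lra).
  assert (A1 := CSeries_correct (fun n => lip_pos k z n psi) _ (fun n => proj1 (HB n psi)) eM).
  assert (A2 := CSeries_correct (fun n => lip_pos k z n (1 - psi)) _ (fun n => proj1 (HB n (1 - psi))) eM).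
  assert (B1 := CSeries_correct (fun n => lip_neg k z n psi) _ (fun n => proj2 (HB n psi)) eM).
  assert (B2 := CSeries_correct (fun n => lip_neg k z n (1 - psi)) _ (fun n => proj2 (HB n (1 - psi))) eM).
  (* The frequency 0 cancels in the difference; dropping it aligns frequency n + 1 with the
     frequency -(n + 1) of [lip_neg]. *)
  assert (A := is_Cseries_shift _ _ (is_Cseries_minus _ _ _ _ A1 A2)).
  assert (B := is_Cseries_minus _ _ _ _ B1 B2).
  assert (AB := is_Cseries_plus _ _ _ _ A B). cbv beta in AB.
  assert (E0 : Cminus (lip_pos k z 0 psi) (lip_pos k z 0 (1 - psi)) = RtoC 0).
  { unfold lip_pos. simpl INR. rewrite !Rmult_0_l. ring. }
  rewrite E0 in AB.
  (* The scalar -i / 2 is the inverse of the 2i in front of the sine. *)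
  apply (is_Cseries_scal (Cmult (RtoC (/ 2)) (- Ci))) in AB.
  eapply is_Cseries_ext in AB.
  2:{ intros e. 
      instantiate (1 := fun e => Cmult (RtoC (sin (2 * PI * (INR (S e) * psi)))) (pole_diff k tau e v)).
      cbv beta. unfold lip_pos, lip_neg, pole_diff, Wk. fold z.
      replace (- INR (S e) * psi) with (- (INR (S e) * psi)) by ring.
      replace (- INR (S e) * (1 - psi)) with (IZR (- Z.of_nat (S e)) * (1 - psi))
        by (rewrite opp_IZR, <- INR_IZR_INZ; ring).
      rewrite ee_reflect, opp_IZR.
      rewrite (INR_IZR_INZ (S e)), ee_reflect.
      replace (- (- IZR (Z.of_nat (S e)) * psi)) with (IZR (Z.of_nat (S e)) * psi) by ring.
      set (x := IZR (Z.of_nat (S e)) * psi).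
      set (Wa := (/ Cpow _ _)%C). set (Wb := (/ Cpow _ _)%C).
      transitivity ((RtoC (/ 2) * - Ci) * ((ee x - ee (- x)) * (Wa - Wb)))%C; [ring|].
      rewrite ee_minus_opp. 
      replace ((RtoC (/ 2) * - Ci * ((0, 2) * RtoC (sin (2 * PI * x)) * (Wa - Wb)))%C) with
       ((RtoC (/ 2) * - Ci * (0, 2)) * (RtoC (sin (2 * PI * x)) * (Wa - Wb)))%C by ring.
      replace (RtoC (/ 2) * - Ci * (0, 2))%C with (RtoC 1) by (Ceq; field). ring. }
  apply is_Cseries_unique in AB. rewrite AB.
  eapply is_Cseries_ext; [|evar_last; [exact F|]].
  - intros n. cbv beta. unfold z. rewrite !lip_exp_real, <- RtoC_minus. f_equal. unfold alt_pair.
    f_equal; f_equal; [| |f_equal]; try (f_equal; ring).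
    all: try ring.
  - set (S1 := CSeries _). set (S2 := CSeries _). set (S3 := CSeries _). set (S4 := CSeries _).
    replace (RtoC (INR (fact k)) * (0, 2) * (RtoC (/ 2) * - Ci * (S1 - S3 - RtoC 0 + (S2 - S4))))%C with
     (((0, 2) * RtoC (/ 2) * - Ci) * (RtoC (INR (fact k)) * (S1 - S3 + (S2 - S4))))%C by ring.
    replace ((0, 2) * RtoC (/ 2) * - Ci)%C with (RtoC 1) by (Ceq; field). ring.
Qed.

(** Second use of the Lipschitz formula, from poles back to exponentials. After rotation, each m
    contributes the poles z + 2 pi i m and z - 2 pi i (m + 1) with their conjugates, so -2i times
    the imaginary part of the Lipschitz sum at z remains: a sine series. *)
Lemma pole_diff_series (j : nat) (tau theta : R) (e : nat) : 0 < tau -> 0 < theta < 1 ->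
  let k := (2 * j + 1)%nat in
  Cmult (RtoC (INR (fact k)))
    (CSeries (fun m => Cminus (pole_diff k tau e (INR m + theta)) (pole_diff k tau e (INR m + 1 - theta)))) =
  (0, 2 * ((-1) ^ (j + 1) * (2 * PI / tau) ^ (k + 1)) *
      Series (fun d => INR (S d) ^ k * exp (- (INR (S d) * (INR (S e) * (4 * PI ^ 2 / tau))))
                       * sin (2 * PI * (INR (S d) * theta)))).
Proof.
  intros Ht Hth k. pose proof PI_RGT_0 as Hpi.
  set (kap := (-1) ^ (j + 1) * (2 * PI / tau) ^ (k + 1)).
  set (w := INR (S e) * (4 * PI ^ 2 / tau)).
  assert (HSe : 0 < INR (S e)) by (apply lt_0_INR; lia).
  assert (Hw : 0 < w).
  { apply Rmult_lt_0_compat; auto. apply Rdiv_lt_0_compat; auto. nra. }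
  set (Sg := Series _).
  set (z := (w, 2 * PI * theta) : C).
  assert (Hz : 0 < Re z) by exact Hw.
  assert (Hk : (1 <= k)%nat) by (unfold k; lia).
  destruct (lip_pos_bound k z Hz Hk) as [K [HK HB]].
  assert (eM := ex_series_zeta2 K).
  assert (A := CSeries_correct (fun n => lip_pos k z n 1) _ (fun n => proj1 (HB n 1)) eM).
  assert (B := CSeries_correct (fun n => lip_neg k z n 1) _ (fun n => proj2 (HB n 1)) eM).
  assert (AB := is_Cseries_plus _ _ _ _ A B). cbv beta in AB.
  assert (L := lipschitz_formula k z 1 Hz Hk ltac:(lra)).
  assert (Erot : forall b, Wk k (tau / (2 * PI) * b, - (2 * PI * INR (S e))) =
                 Cmult (RtoC kap) (Wk k (w, b))).
  { intros b. unfold kap, k. replace (2 * j + 1 + 1)%nat with (2 * j + 2)%nat by lia.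
    rewrite <- (Wk_rotate j tau w b Ht Hw). f_equal. f_equal. f_equal. unfold w. field. lra. }
  set (beta := fun m => Cplus (lip_pos k z m 1) (lip_neg k z m 1)).
  assert (Ebeta : forall m, beta m = Cplus (Wk k (w, 2 * PI * theta + 2 * PI * INR m))
                                           (Wk k (w, 2 * PI * theta + 2 * PI * - INR (S m)))).
  { intros m. unfold beta, lip_pos, lip_neg. rewrite !Rmult_1_r.
    rewrite (INR_IZR_INZ (S m)), (INR_IZR_INZ m), <- opp_IZR, !ee_IZR, !Cmult_1_l. reflexivity. }
  assert (ED : forall m, Cminus (pole_diff k tau e (INR m + theta)) (pole_diff k tau e (INR m + 1 - theta)) =
     (0, -2 * kap * Im (beta m))).
  { intros m. rewrite Ebeta. unfold pole_diff, ishift.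
    set (W1 := Wk k (w, 2 * PI * theta + 2 * PI * INR m)).
    set (W2 := Wk k (w, 2 * PI * theta + 2 * PI * - INR (S m))).
    assert (R1 : Wk k (Re (RtoC (tau * (INR m + theta))), Im (RtoC (tau * (INR m + theta))) + 2 * PI * - INR (S e))
              = Cmult (RtoC kap) W1).
    { unfold W1. rewrite <- Erot. f_equal. unfold Re, Im; simpl fst; simpl snd. f_equal; [field; lra | ring]. }
    assert (R2 : Wk k (Re (RtoC (tau * (INR m + theta))), Im (RtoC (tau * (INR m + theta))) + 2 * PI * INR (S e))
              = Cconj (Cmult (RtoC kap) W1)).
    { rewrite <- R1, <- Wk_Cconj. f_equal. Ceq; ring. }
    (* Here the point must first be negated: the rotated imaginary part is 2 pi (theta - (m + 1)), a
       pole of negative index. *)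
    assert (R3 : Wk k (Re (RtoC (tau * (INR m + 1 - theta))), Im (RtoC (tau * (INR m + 1 - theta))) + 2 * PI * INR (S e))
              = Cmult (RtoC kap) W2).
    { unfold W2. rewrite <- Erot. unfold k. rewrite <- Wk_opp. f_equal.
      rewrite (S_INR m). Ceq; field; lra. }
    assert (R4 : Wk k (Re (RtoC (tau * (INR m + 1 - theta))), Im (RtoC (tau * (INR m + 1 - theta))) + 2 * PI * - INR (S e))
              = Cconj (Cmult (RtoC kap) W2)).
    { rewrite <- R3, <- Wk_Cconj. f_equal. Ceq; ring. }
    rewrite R1, R2, R3, R4. Ceq; ring. }
  rewrite (CSeries_ext _ _ ED).
  assert (ES : CSeries (fun m => (0, -2 * kap * Im (beta m)) : C) =
    (0, -2 * kap * Im (CSeries (fun n => lip_pos k z n 1) + CSeries (fun n => lip_neg k z n 1))%C)).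
  { apply is_Cseries_unique. split.
    - apply (is_Cseries_zero (fun _ => RtoC 0)). auto.
    - apply (is_series_scal (V := R_NormedModule) (-2 * kap)). exact (proj2 AB). }
  rewrite ES.
  assert (EI : INR (fact k) * Im (CSeries (fun n => lip_pos k z n 1) + CSeries (fun n => lip_neg k z n 1))%C =
     - Sg).
  { transitivity (Im (CSeries (fun n => lip_exp k z n 1))).
    - rewrite L. unfold Im; simpl. ring.
    - unfold Sg. rewrite <- Series_opp. unfold Im at 1, CSeries. simpl snd. apply Series_ext. intros d.
      unfold lip_exp, z. rewrite S_INR. unfold Cexp, Re, Im; simpl fst; simpl snd. unfold Re, Im; simpl fst; simpl snd.
      replace ((INR d + 1) * - (2 * PI * theta) + 0 * - w) with (- (2 * PI * ((INR d + 1) * theta))) by ring.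
      rewrite sin_neg. 
      replace ((INR d + 1) * - w - 0 * - (2 * PI * theta)) with (- ((INR d + 1) * w)) by ring.
      ring. }
  Ceq; [ring|].
  transitivity (-2 * kap * (INR (fact k) * Im (CSeries (fun n => lip_pos k z n 1) + CSeries (fun n => lip_neg k z n 1))%C)).
  - unfold Im; simpl; ring.
  - rewrite EI. ring.
Qed.

Definition divisor_coeff (k : nat) (theta psi : R) (n : nat) : R :=
  divsum n (fun d => INR d ^ k * sin (2 * PI * INR d * theta) * sin (2 * PI * INR n * psi / INR d)).

Definition quad_term (k : nat) (tau theta psi : R) (m n : nat) : R :=
  alt_pair k tau psi n (INR m + theta) - alt_pair k tau psi n (INR m + 1 - theta).

(** For one fixed v, with a constant depending on v: enough to split the series over e. Decay in
    both indices comes from [Wk_diff_bound]. *)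
Lemma pole_diff_bound (k : nat) (tau v : R) : 0 < tau -> 0 < v -> (1 <= k)%nat ->
  exists K, forall e, Cmod (pole_diff k tau e v) <= K * Rpower (INR e + 1) (- (1 + 1)).
Proof.
  intros Ht Hv Hk. set (z := RtoC (tau * v)).
  assert (Hz : 0 < Re z) by (unfold z, Re; simpl; apply Rmult_lt_0_compat; auto).
  destruct (W_bound z k Hz Hk) as [K [HK H]]. exists (2 * K). intros e.
  unfold pole_diff, Wk. fold z. unfold Cminus.
  eapply Rle_trans; [apply Cmod_triangle|]. rewrite Cmod_opp.
  pose proof (pos_INR e).
  assert (A1 := H e (INR (S e))). assert (A2 := H e (- INR (S e))).
  rewrite Rabs_Ropp in A2. rewrite Rabs_pos_eq in A1, A2 by apply pos_INR.
  specialize (A1 ltac:(rewrite S_INR; lra)). specialize (A2 ltac:(rewrite S_INR; lra)). lra.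
Qed.

Lemma Cmod_sin_mult (x : R) (z : C) : Cmod (Cmult (RtoC (sin x)) z) <= Cmod z.
Proof.
  rewrite Cmod_mult, Cmod_R. pose proof (Cmod_ge_0 z).
  assert (Rabs (sin x) <= 1) by (apply Rabs_le; apply SIN_bound). nra.
Qed.

Lemma quad_term_series (j : nat) (tau theta psi : R) :
  0 < tau -> 0 < theta < 1 -> 0 < psi < 1 ->
  let k := (2 * j + 1)%nat in
  Series (fun m => Series (fun n => quad_term k tau theta psi m n)) =
  -4 * ((-1) ^ (j + 1) * (2 * PI / tau) ^ (k + 1)) *
  Series (fun e => sin (2 * PI * (INR (S e) * psi)) *
    Series (fun d => INR (S d) ^ k * exp (- (INR (S d) * (INR (S e) * (4 * PI ^ 2 / tau))))
                       * sin (2 * PI * (INR (S d) * theta)))).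
Proof.
  intros Ht Hth Hp k.
  assert (Hk : (1 <= k)%nat) by (unfold k; lia).
  set (G := fun e => Series (fun d => INR (S d) ^ k * exp (- (INR (S d) * (INR (S e) * (4 * PI ^ 2 / tau))))
                       * sin (2 * PI * (INR (S d) * theta)))).
  set (kap := (-1) ^ (j + 1) * (2 * PI / tau) ^ (k + 1)).
  set (sn := fun e => sin (2 * PI * (INR (S e) * psi))).
  set (U := fun m e => Cmult (RtoC (sn e))
     (Cminus (pole_diff k tau e (INR m + theta)) (pole_diff k tau e (INR m + 1 - theta)))).
  set (c := Cmult (RtoC (INR (fact k))) (0, 2)).
  destruct (Wk_diff_bound k tau theta Ht Hth Hk) as [K [HK HW]].
  set (B := fun e => Rpower (INR e + 1) (- (1 + 1 / 2))).
  set (A := fun m => 2 * K * B m).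
  assert (HB0 : forall e, 0 <= B e) by (intros; left; apply exp_pos).
  assert (HA0 : forall m, 0 <= A m).
  { intros m. apply Rmult_le_pos; auto. lra. }
  assert (eB : ex_series B) by (apply ex_series_zeta; lra).
  assert (eA : ex_series A) by (apply (ex_series_scal_l (V := R_NormedModule)); auto).
  assert (HD : forall m e, Cmod (Cminus (pole_diff k tau e (INR m + theta)) (pole_diff k tau e (INR m + 1 - theta))) <= A m * B e).
  { intros m e. unfold pole_diff.
    (* Regrouped so that theta is compared with 1 - theta at the same frequency; only these
       differences have the joint decay. *)
    match goal with |- Cmod ((?a - ?b) - (?c - ?d)) <= _ =>
      replace ((a - b) - (c - d))%C with ((a - c) + - (b - d))%C by ring end.
    eapply Rle_trans; [apply Cmod_triangle|]. rewrite Cmod_opp.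
    assert (H1 := HW m e (INR (S e)) ltac:(apply Rabs_pos_eq, pos_INR)).
    assert (H2 := HW m e (- INR (S e)) ltac:(rewrite Rabs_Ropp; apply Rabs_pos_eq, pos_INR)).
    unfold A, B. lra. }
  assert (HU : forall m e, Cmod (U m e) <= A m * B e).
  { intros m e. eapply Rle_trans; [apply Cmod_sin_mult|apply HD]. }
  assert (Hin : forall m, CSeries (fun n => RtoC (quad_term k tau theta psi m n)) =
                          Cmult c (CSeries (fun e => U m e))).
  { intros m. pose proof (pos_INR m).
    destruct (pole_diff_bound k tau (INR m + theta) Ht ltac:(lra) Hk) as [K1 P1].
    destruct (pole_diff_bound k tau (INR m + 1 - theta) Ht ltac:(lra) Hk) as [K2 P2].
    assert (D1 := CSeries_correct (fun e => Cmult (RtoC (sn e)) (pole_diff k tau e (INR m + theta))) _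
      (fun e => Rle_trans _ _ _ (Cmod_sin_mult _ _) (P1 e)) (ex_series_zeta2 K1)).
    assert (D2 := CSeries_correct (fun e => Cmult (RtoC (sn e)) (pole_diff k tau e (INR m + 1 - theta))) _
      (fun e => Rle_trans _ _ _ (Cmod_sin_mult _ _) (P2 e)) (ex_series_zeta2 K2)).
    assert (E1 := alt_pair_series k tau (INR m + theta) psi Ht ltac:(lra) Hp Hk).
    assert (E2 := alt_pair_series k tau (INR m + 1 - theta) psi Ht ltac:(lra) Hp Hk).
    assert (E := is_Cseries_minus _ _ _ _ E1 E2). cbv beta in E.
    apply is_Cseries_unique.
    eapply is_Cseries_ext; [|evar_last; [exact E|]].
    - intros n. cbv beta. rewrite <- RtoC_minus. reflexivity.
    - assert (D := is_Cseries_unique _ _ (is_Cseries_minus _ _ _ _ D1 D2)).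
      rewrite (CSeries_ext (fun e => U m e) (fun e => Cminus
        (Cmult (RtoC (sn e)) (pole_diff k tau e (INR m + theta)))
        (Cmult (RtoC (sn e)) (pole_diff k tau e (INR m + 1 - theta))))) by (intros; unfold U; ring).
      rewrite D. unfold c. fold sn. 
      change (fun e : nat => (RtoC (sin (2 * PI * (INR (S e) * psi))) * pole_diff k tau e (INR m + theta))%C)
        with (fun e : nat => (RtoC (sn e) * pole_diff k tau e (INR m + theta))%C).
      change (fun e : nat => (RtoC (sin (2 * PI * (INR (S e) * psi))) * pole_diff k tau e (INR m + 1 - theta))%C)
        with (fun e : nat => (RtoC (sn e) * pole_diff k tau e (INR m + 1 - theta))%C).
      ring. }
  assert (HmU : forall m, Cmod (CSeries (fun e => U m e)) <= 2 * Series B * A m).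
  { intros m. eapply Rle_trans; [apply (CSeries_abs_le _ (fun e => A m * B e)); auto|].
    - apply (ex_series_scal_l (V := R_NormedModule)); auto.
    - rewrite Series_scal_l. right. ring. }
  assert (HeU : forall e, Cmod (CSeries (fun m => U m e)) <= 2 * Series A * B e).
  { intros m. eapply Rle_trans; [apply (CSeries_abs_le _ (fun e => A e * B m)); auto|].
    - apply ex_series_scal_r; auto.
    - rewrite Series_scal_r. right. ring. }
  (* One factor 2i comes from [alt_pair_series], the other from [pole_diff_series]; their product is
     the -4 of the statement. *)
  assert (main : CSeries (fun m => CSeries (fun n => RtoC (quad_term k tau theta psi m n))) =
    Cmult (0, 2) (CSeries (fun e => Cmult (RtoC (sn e)) (0, 2 * kap * G e)))).
  { rewrite (CSeries_ext _ _ Hin).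
    rewrite (is_Cseries_unique _ _ (is_Cseries_scal c _ _ (CSeries_correct _ _ HmU
       ltac:(apply (ex_series_scal_l (V := R_NormedModule)); auto)))).
    rewrite (CSeries_swap A B U) by auto.
    unfold c.
    replace (RtoC (INR (fact k)) * (0, 2) * CSeries (fun e => CSeries (fun m => U m e)))%C with
      ((0, 2) * (RtoC (INR (fact k)) * CSeries (fun e => CSeries (fun m => U m e))))%C by ring.
    rewrite <- (is_Cseries_unique _ _ (is_Cseries_scal (RtoC (INR (fact k))) _ _ (CSeries_correct _ _ HeU
       ltac:(apply (ex_series_scal_l (V := R_NormedModule)); auto)))).
    f_equal. apply CSeries_ext. intros e.
    assert (HeD := CSeries_correct (fun m => Cminus (pole_diff k tau e (INR m + theta)) (pole_diff k tau e (INR m + 1 - theta)))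
       (fun m => A m * B e) (fun m => HD m e) ltac:(apply ex_series_scal_r; auto)).
    assert (E := is_Cseries_unique _ _ (is_Cseries_scal (RtoC (sn e)) _ _ HeD)).
    unfold U. rewrite E. assert (Y := pole_diff_series j tau theta e Ht Hth). cbv zeta in Y. fold k in Y. fold kap in Y. fold (G e) in Y.
    rewrite <- Y.
    ring. }
  apply (f_equal Re) in main.
  transitivity (Re (CSeries (fun m => CSeries (fun n => RtoC (quad_term k tau theta psi m n))))); [reflexivity|].
  rewrite main.
  change (0 * Series (fun e => Re (Cmult (RtoC (sn e)) (0, 2 * kap * G e)))
    - 2 * Series (fun e => Im (Cmult (RtoC (sn e)) (0, 2 * kap * G e)))
    = -4 * kap * Series (fun e => sn e * G e)).
  rewrite (Series_ext (fun e => Im _) (fun e => (2 * kap) * (sn e * G e)))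
    by (intros e; unfold Im; simpl; ring).
  rewrite Series_scal_l. ring.
Qed.

Lemma divisor_series (k : nat) (theta psi y : R) : 0 < y ->
  Series (fun e => sin (2 * PI * (INR (S e) * psi)) *
    Series (fun d => INR (S d) ^ k * exp (- (INR (S d) * (INR (S e) * y)))
                       * sin (2 * PI * (INR (S d) * theta)))) =
  Series (fun n => divisor_coeff k theta psi (S n) * exp (- (INR (S n) * y))).
Proof.
  intros Hy.
  (* The rate y / 2 serves both interchanges: (d + e) / 2 <= (d + 1)(e + 1) for the double series,
     and (d + n) / 2 <= n + 1 when d <= n for the regrouping by divisors. *)
  set (A := fun d => (INR d + 1) ^ k * exp (- (INR d * (y / 2)))).
  set (B := fun e => (INR e + 1) ^ 0 * exp (- (INR e * (y / 2)))).
  assert (HB : forall e, 0 <= B e).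
  { intros e. unfold B. simpl. rewrite Rmult_1_l. left; apply exp_pos. }
  assert (HA : forall e, 0 <= A e).
  { intros e. apply Rmult_le_pos; [apply pow_le; pose proof (pos_INR e); lra | left; apply exp_pos]. }
  assert (eA : ex_series A) by (apply ex_series_pow_exp; lra).
  assert (eB : ex_series B) by (apply ex_series_pow_exp; lra).
  assert (sb : forall x, Rabs (sin x) <= 1) by (intros; apply Rabs_le, SIN_bound).
  assert (bound : forall x1 x2 d e t, (INR d + INR e) * (y / 2) <= t ->
     Rabs (INR (S d) ^ k * sin x1 * sin x2 * exp (- t)) <= A d * B e).
  { intros x1 x2 d e t H. rewrite !Rabs_mult.
    rewrite (Rabs_pos_eq (INR (S d) ^ k)) by (apply pow_le, pos_INR).
    rewrite (Rabs_pos_eq (exp (- t))) by (left; apply exp_pos).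
    unfold A, B. rewrite <- S_INR. set (P := INR (S d) ^ k).
    assert (HP : 0 <= P) by (apply pow_le, pos_INR).
    assert (He : exp (- t) <= exp (- (INR d * (y / 2))) * exp (- (INR e * (y / 2)))).
    { rewrite <- exp_plus. assert (Hle : - t <= - (INR d * (y / 2)) + - (INR e * (y / 2))) by lra.
      destruct Hle as [Hl|Hl]; [left; apply exp_increasing; auto | rewrite Hl; lra]. }
    apply Rle_trans with (P * 1 * 1 * exp (- t)).
    - apply Rmult_le_compat_r; [left; apply exp_pos|].
      apply Rmult_le_compat; auto using Rabs_pos.
      + apply Rmult_le_pos; auto using Rabs_pos.
      + apply Rmult_le_compat_l; auto.
    - simpl. rewrite !Rmult_1_r, Rmult_1_l, Rmult_assoc. apply Rmult_le_compat_l; auto. }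
  set (f := fun d n => INR d ^ k * sin (2 * PI * INR d * theta) * sin (2 * PI * INR n * psi / INR d)
     * exp (- (INR n * y))).
  transitivity (Series (fun d => Series (fun e => f (S d) (S d * S e)%nat))).
  - transitivity (Series (fun e => Series (fun d => INR (S d) ^ k * sin (2 * PI * INR (S d) * theta)
      * sin (2 * PI * (INR (S e) * psi)) * exp (- (INR (S d) * (INR (S e) * y)))))).
    + apply Series_ext. intros e. rewrite <- Series_scal_l. apply Series_ext. intros d.
      rewrite <- (Rmult_assoc (2 * PI) (INR (S d)) theta). ring.
    + rewrite (Series_swap B A); auto.
      * apply Series_ext. intros d. apply Series_ext. intros e. unfold f.
        assert (0 < INR (S d)) by (apply lt_0_INR; lia).
        rewrite mult_INR. f_equal; [f_equal; f_equal; field; lra | f_equal; ring].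
      * intros e d. rewrite (Rmult_comm (B e)). apply bound.
        rewrite !S_INR. pose proof (pos_INR d). pose proof (pos_INR e).
        assert (0 <= INR d * INR e) by (apply Rmult_le_pos; auto). nra.
  - rewrite <- (Series_divsum A B f); auto.
    + apply Series_ext. intros n. unfold divisor_coeff, divsum.
      rewrite Rmult_comm, scal_sum. apply sum_eq. intros i _.
      destruct (Nat.eqb (S n mod S i) 0); [reflexivity|ring].
    + intros d n Hdn. apply bound. apply le_INR in Hdn.
      rewrite !S_INR. pose proof (pos_INR d). nra.
Qed.

(** * Gamma and Bessel integrals *)

Lemma cpowR_Cexp (y : R) (s : C) : cpowR y s = Cexp (Cmult s (RtoC (ln y))).
Proof.
  unfold cpowR, Cexp.
  replace (Re (s * RtoC (ln y))%C) with (Re s * ln y) by (unfold Re; simpl; ring).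
  replace (Im (s * RtoC (ln y))%C) with (Im s * ln y) by (unfold Re, Im; simpl; ring).
  reflexivity.
Qed.

Lemma cpowR_plus (y : R) (s t : C) : cpowR y (Cplus s t) = Cmult (cpowR y s) (cpowR y t).
Proof. rewrite !cpowR_Cexp, <- Cexp_plus. f_equal. ring. Qed.

Lemma cpowR_mult (y z : R) (s : C) : 0 < y -> 0 < z ->
  cpowR (y * z) s = Cmult (cpowR y s) (cpowR z s).
Proof.
  intros Hy Hz. rewrite !cpowR_Cexp, <- Cexp_plus, ln_mult, RtoC_plus by auto. f_equal. ring.
Qed.

Lemma cpowR_R (y r : R) : cpowR y (RtoC r) = RtoC (Rpower y r).
Proof.
  rewrite cpowR_Cexp, <- RtoC_mult. unfold Rpower. Ceq; [rewrite cos_0 | rewrite sin_0]; ring.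
Qed.

Lemma Cmod_cpowR (y : R) (s : C) : Cmod (cpowR y s) = Rpower y (Re s).
Proof. rewrite cpowR_Cexp, Cmod_Cexp. unfold Rpower. f_equal. unfold Re; simpl; ring. Qed.

Lemma cpowR_neq_0 (y : R) (s : C) : cpowR y s <> RtoC 0.
Proof. apply Cmod_gt_0. rewrite Cmod_cpowR. apply exp_pos. Qed.

Definition is_Cimp (f : R -> C) (l : C) : Prop :=
  improper (fun t => Re (f t)) (Re l) /\ improper (fun t => Im (f t)) (Im l).

Lemma is_Cimp_CInt (f : R -> C) (l : C) : is_Cimp f l -> CInt_0_inf f = l.
Proof.
  intros [H1 H2]. unfold CInt_0_inf.
  rewrite (improper_RInt_gen _ _ H1), (improper_RInt_gen _ _ H2). destruct l; auto.
Qed.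

Lemma is_Cimp_unique (f : R -> C) (l m : C) : is_Cimp f l -> is_Cimp f m -> l = m.
Proof. intros H K. rewrite <- (is_Cimp_CInt _ _ H). apply is_Cimp_CInt; auto. Qed.

Lemma is_Cimp_ext (f g : R -> C) (l : C) :
  (forall t, 0 < t -> f t = g t) -> is_Cimp f l -> is_Cimp g l.
Proof.
  intros E [H1 H2]. split; [eapply improper_ext; [|exact H1] | eapply improper_ext; [|exact H2]];
  intros t Ht; cbv beta; rewrite E; auto.
Qed.

Lemma is_Cimp_plus (f g : R -> C) (l m : C) :
  is_Cimp f l -> is_Cimp g m -> is_Cimp (fun t => Cplus (f t) (g t)) (Cplus l m).
Proof.
  intros [H1 H2] [K1 K2]. split.
  - exact (improper_plus _ _ _ _ H1 K1).
  - exact (improper_plus _ _ _ _ H2 K2).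
Qed.

Lemma is_Cimp_scal (c : C) (f : R -> C) (l : C) :
  is_Cimp f l -> is_Cimp (fun t => Cmult c (f t)) (Cmult c l).
Proof.
  intros [H1 H2]. split.
  - exact (improper_minus _ _ _ _ (improper_scal _ _ (Re c) H1) (improper_scal _ _ (Im c) H2)).
  - exact (improper_plus _ _ _ _ (improper_scal _ _ (Re c) H2) (improper_scal _ _ (Im c) H1)).
Qed.

Lemma is_Cimp_dilate (f : R -> C) (l : C) (c : R) : 0 < c ->
  is_Cimp f l -> is_Cimp (fun t => f (c * t)) (Cmult l (RtoC (/ c))).
Proof.
  intros Hc [H1 H2].
  pose proof (improper_dilate _ _ c Hc H1) as K1. pose proof (improper_dilate _ _ c Hc H2) as K2.
  split.
  - replace (Re (l * RtoC (/ c))%C) with (Re l / c); [exact K1|]. unfold Rdiv, Re; simpl; ring.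
  - replace (Im (l * RtoC (/ c))%C) with (Im l / c); [exact K2|]. unfold Rdiv, Im; simpl; ring.
Qed.

Lemma is_Cimp_dominated (f : R -> C) (g : R -> R) (G : R) :
  (forall t, 0 < t -> Ccontinuous f t) -> integrable_majorant g G ->
  (forall t, 0 < t -> Cmod (f t) <= g t) -> exists l, is_Cimp f l.
Proof.
  intros Hf Hg H.
  destruct (improper_dominated (fun t => Re (f t)) g G) as [l1 H1]; auto.
  { intros t Ht; exact (proj1 (Hf t Ht)). }
  { intros t Ht; eapply Rle_trans; [apply Re_le_Cmod|auto]. }
  destruct (improper_dominated (fun t => Im (f t)) g G) as [l2 H2]; auto.
  { intros t Ht; exact (proj2 (Hf t Ht)). }
  { intros t Ht; eapply Rle_trans; [apply Im_le_Cmod|auto]. }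
  exists (l1, l2). split; auto.
Qed.

Lemma CSeries_scal_R (c : C) (r : nat -> R) :
  CSeries (fun n => Cmult c (RtoC (r n))) = Cmult c (RtoC (Series r)).
Proof.
  Ceq.
  - rewrite <- (Rmult_comm (Series r)), <- Series_scal_r. rewrite Rmult_0_r, Rminus_0_r.
    apply Series_ext; intros n; ring.
  - rewrite Rmult_0_r, Rplus_0_l, (Rmult_comm (snd c)), <- Series_scal_r.
    apply Series_ext; intros n; ring.
Qed.

(** The complex weight does not depend on n, so the series under the integral remains a real one. *)
Lemma is_Cimp_Series (Phi : R -> C) (r : nat -> R -> R) (L : nat -> C) (M : nat -> R) (g : R -> R) (G : R) :
  (forall n, is_Cimp (fun t => Cmult (Phi t) (RtoC (r n t))) (L n)) -> integrable_majorant g G ->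
  (forall n t, 0 < t -> Cmod (Phi t) * Rabs (r n t) <= M n * g t) -> (forall n, 0 <= M n) -> ex_series M ->
  is_Cseries L (CSeries L) /\
  is_Cimp (fun t => Cmult (Phi t) (RtoC (Series (fun n => r n t)))) (CSeries L).
Proof.
  intros Hf Hg HM HM0 eM.
  assert (HB : forall n t, 0 < t -> Cmod (Cmult (Phi t) (RtoC (r n t))) <= M n * g t).
  { intros n t Ht. rewrite Cmod_mult, Cmod_R. auto. }
  destruct (improper_Series (fun n t => Re (Cmult (Phi t) (RtoC (r n t)))) (fun n => Re (L n)) M g G)
    as [E1 I1]; auto.
  { intros n; exact (proj1 (Hf n)). }
  { intros n t Ht; eapply Rle_trans; [apply Re_le_Cmod|auto]. }
  destruct (improper_Series (fun n t => Im (Cmult (Phi t) (RtoC (r n t)))) (fun n => Im (L n)) M g G)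
    as [E2 I2]; auto.
  { intros n; exact (proj2 (Hf n)). }
  { intros n t Ht; eapply Rle_trans; [apply Im_le_Cmod|auto]. }
  split.
  - split; apply Series_correct; auto.
  - apply (is_Cimp_ext (fun t => CSeries (fun n => Cmult (Phi t) (RtoC (r n t))))).
    + intros t _. apply CSeries_scal_R.
    + split; assumption.
Qed.

(** The comparison primitive is -(M / p) / (1 + t^p), bounded on the whole half-line. Its derivative
    M t^(p-1) / (1 + t^p)^2 dominates because e^(-t) (1 + t^p)^2 <= 2 + 2 t^(2p) e^(-t) <= M. *)
Lemma gamma_majorant (p : R) : 0 < p ->
  exists G, integrable_majorant (fun t => Rpower t (p - 1) * exp (- t)) G.
Proof.
  intros Hp. set (M := 2 + 2 * exp (2 * p * ln (2 * p) - 2 * p)).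
  assert (HM : 0 < M) by (unfold M; pose proof (exp_pos (2 * p * ln (2 * p) - 2 * p)); lra).
  set (phi := fun t => - (M / p) * / (1 + exp (p * ln t))).
  set (dphi := fun t => M * (exp ((p - 1) * ln t) * / ((1 + exp (p * ln t)) * (1 + exp (p * ln t))))).
  exists (2 * (M / p)). apply (majorant_of_primitive _ phi dphi).
  - intros t Ht. unfold dphi, Rpower.
    set (a := exp ((p - 1) * ln t)). assert (Ha : 0 < a) by apply exp_pos.
    set (b := exp (p * ln t)). assert (Hb : 0 < b) by apply exp_pos.
    split; [apply Rmult_le_pos; left; [auto|apply exp_pos]|].
    assert (H1 := Rpower_exp_le (2 * p) t ltac:(lra) Ht).
    assert (Hb2 : Rpower t (2 * p) = b * b).
    { unfold Rpower, b. rewrite <- exp_plus. f_equal. ring. }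
    rewrite Hb2 in H1.
    assert (H2 : exp (- t) <= 1) by (rewrite <- exp_0; left; apply exp_increasing; lra).
    assert (Hq : 0 < (1 + b) * (1 + b)) by nra.
    assert (H3 : exp (- t) * ((1 + b) * (1 + b)) <= M).
    { unfold M. pose proof (exp_pos (- t)). pose proof (pow2_ge_0 (1 - b)). nra. }
    apply Rmult_le_reg_r with ((1 + b) * (1 + b)); auto.
    replace (M * (a * / ((1 + b) * (1 + b))) * ((1 + b) * (1 + b))) with (a * M) by (field; lra).
    rewrite Rmult_assoc. apply Rmult_le_compat_l; lra.
  - intros t Ht. apply (ex_derive_continuous (V := R_NormedModule)). unfold Rpower. auto_derive. auto.
  - intros t Ht. apply (ex_derive_continuous (V := R_NormedModule)). unfold dphi. 
    pose proof (exp_pos (p * ln t)). auto_derive. split; auto. split; auto. split; auto. nra.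
  - intros t Ht. unfold phi, dphi. pose proof (exp_pos (p * ln t)). auto_derive.
    + split; auto. lra.
    + replace (exp ((p - 1) * ln t)) with (exp (p * ln t) / t).
      * field. repeat split; lra.
      * unfold Rminus. rewrite Rmult_plus_distr_r, exp_plus.
        replace (- (1) * ln t) with (- ln t) by ring. rewrite exp_Ropp, exp_ln by auto. reflexivity.
  - intros t Ht. unfold phi. pose proof (exp_pos (p * ln t)).
    assert (HMp : 0 < M / p) by (apply Rdiv_lt_0_compat; auto).
    rewrite Rabs_mult, Rabs_Ropp, (Rabs_pos_eq (M / p)) by lra.
    rewrite Rabs_pos_eq by (left; apply Rinv_0_lt_compat; lra).
    rewrite <- (Rmult_1_r (M / p)) at 2. apply Rmult_le_compat_l; [lra|].
    rewrite <- Rinv_1. apply Rinv_le_contravar; lra.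
Qed.

Lemma Ccontinuous_cpowR_exp (s : C) (b t : R) : 0 < t ->
  Ccontinuous (fun t => Cmult (cpowR t s) (RtoC (exp (- (b * t))))) t.
Proof.
  intros Ht. split; apply (ex_derive_continuous (V := R_NormedModule));
  unfold cpowR, Re, Im; simpl; auto_derive; auto.
Qed.

Lemma is_Cimp_CGamma (s : C) : 0 < Re s ->
  is_Cimp (fun t => Cmult (cpowR t (Cminus s (RtoC 1))) (RtoC (exp (- t)))) (CGamma s).
Proof.
  intros Hs. destruct (gamma_majorant (Re s) Hs) as [G HG].
  assert (Hc : forall t, 0 < t ->
    Ccontinuous (fun t => Cmult (cpowR t (Cminus s (RtoC 1))) (RtoC (exp (- t)))) t).
  { intros t Ht. destruct (Ccontinuous_cpowR_exp (Cminus s (RtoC 1)) 1 t Ht) as [K1 K2].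
    split; [eapply continuous_ext; [|exact K1] | eapply continuous_ext; [|exact K2]];
    intros u; cbv beta; rewrite Rmult_1_l; auto. }
  destruct (is_Cimp_dominated _ _ _ Hc HG) as [l Hl].
  - intros t Ht. rewrite Cmod_mult, Cmod_cpowR, Cmod_R, Rabs_pos_eq by (left; apply exp_pos).
    replace (Re (s - RtoC 1)%C) with (Re s - 1) by (unfold Re; simpl; ring). lra.
  - assert (E : CGamma s = l) by (apply is_Cimp_CInt; auto). rewrite E. auto.
Qed.

Lemma is_Cimp_CGamma_scale (s : C) (b : R) : 0 < Re s -> 0 < b ->
  is_Cimp (fun t => Cmult (cpowR t (Cminus s (RtoC 1))) (RtoC (exp (- (b * t)))))
    (Cdiv (CGamma s) (cpowR b s)).
Proof.
  intros Hs Hb.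
  pose proof (is_Cimp_dilate _ _ b Hb (is_Cimp_CGamma s Hs)) as H.
  apply (is_Cimp_scal (Cinv (cpowR b (Cminus s (RtoC 1))))) in H.
  pose proof (cpowR_neq_0 b (Cminus s (RtoC 1))) as N1. pose proof (cpowR_neq_0 b s) as N2.
  replace (CGamma s / cpowR b s)%C with (/ cpowR b (s - RtoC 1) * (CGamma s * RtoC (/ b)))%C.
  - eapply is_Cimp_ext; [|exact H]. intros t Ht. cbv beta.
    rewrite cpowR_mult by auto. field. auto.
  - assert (E : cpowR b s = (cpowR b (s - RtoC 1) * RtoC b)%C).
    { replace (cpowR b s) with (cpowR b ((s - RtoC 1) + RtoC 1)%C) by (f_equal; ring).
      rewrite cpowR_plus, cpowR_R, Rpower_1; auto. }
    rewrite E, RtoC_inv by lra. field. split; auto.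
    intros E'; apply RtoC_inj in E'; lra.
Qed.

(** The substitution t = q e^w turns the half-line into the whole line, whose two halves are given
    as integrals over (0, oo), the negative one reflected. *)
Lemma improper_exp_subst (h : R -> R) (Lp Lm q : R) : 0 < q -> (forall w, continuous h w) ->
  improper h Lp -> improper (fun w => h (- w)) Lm ->
  improper (fun t => h (ln (t / q)) / t) (Lp + Lm).
Proof.
  intros Hq Hc [Hp1 Hp2] [Hm1 Hm2].
  assert (Hex : forall a b, ex_RInt h a b).
  { intros a b. apply (ex_RInt_continuous (V := R_CompleteNormedModule)). auto. }
  assert (HI : forall a b, 0 < a < b -> is_RInt (fun t => h (ln (t / q)) / t) a b (RInt h (ln (a / q)) (ln (b / q)))).
  { intros a b Hab.
    apply (is_RInt_ext (fun t => scal (/ t) (h (ln (t / q))))).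
    { intros t _. unfold scal; simpl; unfold mult; simpl. eqR. unfold Rdiv; ring. }
    apply (is_RInt_comp (V := R_CompleteNormedModule) h (fun t => ln (t / q)) (fun t => / t)).
    - auto.
    - rewrite Rmin_left, Rmax_right by lra. intros t Ht. split.
      + auto_derive.
        * apply Rdiv_lt_0_compat; lra.
        * field. lra.
      + apply (ex_derive_continuous (V := R_NormedModule)). auto_derive. lra. }
  split.
  { intros a b Hab. eexists; apply HI; auto. }
  intros eps He.
  destruct (Hp2 (eps / 4)) as [d1 [Hd1 H1]]; [lra|].
  destruct (Hm2 (eps / 4)) as [d2 [Hd2 H2]]; [lra|].
  destruct (continuity_ab_maj (fun w => Rabs (h w)) (-1) 1) as [x0 [Hx0 _]]; [lra| |].
  { intros c _. apply continuity_pt_filterlim. apply continuous_Rabs_comp. auto. }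
  set (K := Rabs (h x0)) in *. assert (HK : 0 <= K) by apply Rabs_pos.
  (* The hypotheses control integrals starting at a positive point only; the gap from -al to al
     contributes at most 2 al K <= eps / 4. *)
  set (al := Rmin (Rmin 1 (eps / (8 * (K + 1)))) (Rmin (d1 / 2) (d2 / 2))).
  assert (Hal : 0 < al).
  { repeat apply Rmin_pos; try lra. apply Rdiv_lt_0_compat; lra. }
  assert (Hal1 : al <= 1) by (unfold al; eapply Rle_trans; [apply Rmin_l|apply Rmin_l]).
  assert (Hal2 : al <= eps / (8 * (K + 1))) by (unfold al; eapply Rle_trans; [apply Rmin_l|apply Rmin_r]).
  assert (Hal3 : al <= d1 / 2) by (unfold al; eapply Rle_trans; [apply Rmin_r|apply Rmin_l]).
  assert (Hal4 : al <= d2 / 2) by (unfold al; eapply Rle_trans; [apply Rmin_r|apply Rmin_r]).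
  set (T := Rmax al (Rmax (/ d1) (/ d2)) + 1).
  assert (HT1 : al < T) by (unfold T; pose proof (Rmax_l al (Rmax (/ d1) (/ d2))); lra).
  assert (HT2 : / d1 < T).
  { unfold T. pose proof (Rmax_r al (Rmax (/ d1) (/ d2))). pose proof (Rmax_l (/ d1) (/ d2)). lra. }
  assert (HT3 : / d2 < T).
  { unfold T. pose proof (Rmax_r al (Rmax (/ d1) (/ d2))). pose proof (Rmax_r (/ d1) (/ d2)). lra. }
  clearbody al T.
  set (x := exp T). assert (Hx : 0 < x) by apply exp_pos.
  (* With x = e^T this forces a < q e^(-T) and b > q e^T, so both logarithmic endpoints exceed T in
     modulus. *)
  exists (Rmin (q / x) (/ (q * x))).
  assert (Hqx : 0 < q / x) by (apply Rdiv_lt_0_compat; auto).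
  assert (Hqx2 : 0 < q * x) by (apply Rmult_lt_0_compat; auto).
  split; [apply Rmin_pos; auto; apply Rinv_0_lt_compat; auto|].
  intros a b Ha Hb Hab.
  assert (Ha' : a < q / x) by (pose proof (Rmin_l (q / x) (/ (q * x))); lra).
  assert (Hb' : q * x < b).
  { apply Rle_lt_trans with (2 := Hb). rewrite <- (Rinv_inv (q * x)) at 1.
    apply Rinv_le_contravar; [|apply Rmin_r]. apply Rmin_pos; auto. apply Rinv_0_lt_compat; auto. }
  rewrite (is_RInt_unique _ _ _ _ (HI a b ltac:(lra))).
  set (A := - ln (a / q)). set (B := ln (b / q)).
  assert (HA : T < A).
  { unfold A. rewrite <- (ln_exp T). fold x. rewrite <- ln_Rinv by (apply Rdiv_lt_0_compat; lra).
    apply ln_increasing; auto. replace (/ (a / q)) with (q / a) by (field; lra).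
    apply Rmult_lt_reg_r with a; [lra|]. replace (q / a * a) with q by (field; lra).
    apply (Rmult_lt_compat_r x) in Ha'; auto. replace (q / x * x) with q in Ha' by (field; lra). lra. }
  assert (HB : T < B).
  { unfold B. rewrite <- (ln_exp T). fold x. apply ln_increasing; auto.
    apply Rmult_lt_reg_r with q; auto. replace (b / q * q) with b by (field; lra). lra. }
  replace (ln (a / q)) with (- A) by (unfold A; ring).
  clearbody A B.
  rewrite <- (RInt_Chasles (V := R_CompleteNormedModule) h (- A) (- al) B) by auto.
  rewrite <- (RInt_Chasles (V := R_CompleteNormedModule) h (- al) al B) by auto.
  unfold plus; simpl.
  assert (R1 : Rabs (RInt h al B - Lp) < eps / 4) by (apply H1; lra).
  assert (R2 : RInt h (- A) (- al) = RInt (fun w => h (- w)) al A).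
  { assert (Hsw : is_RInt (fun w => h (- w)) al A (RInt h (- A) (- al))).
    { apply (is_RInt_ext (fun w => opp (opp (h (- w))))).
      { intros; apply (opp_opp (G := R_AbelianGroup)). }
      replace (RInt h (- A) (- al)) with (opp (RInt h (- al) (- A))).
      2:{ apply (opp_RInt_swap (V := R_CompleteNormedModule)); auto. }
      apply (is_RInt_opp (V := R_NormedModule)). apply (is_RInt_comp_opp (V := R_NormedModule)).
      apply (RInt_correct (V := R_CompleteNormedModule)); auto. }
    symmetry. apply is_RInt_unique; auto. }
  assert (R3 : Rabs (RInt (fun w => h (- w)) al A - Lm) < eps / 4) by (apply H2; lra).
  assert (R4 : Rabs (RInt h (- al) al) <= eps / 4).
  { eapply Rle_trans.
    - apply (RInt_abs_le h (fun _ => K)); auto; [lra|apply (ex_RInt_const (V := R_NormedModule))|].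
      intros w Hw. apply Hx0. lra.
    - rewrite (RInt_const (V := R_CompleteNormedModule)). unfold scal; simpl; unfold mult; simpl.
      apply Rle_trans with (2 * al * (K + 1)); [nra|].
      apply (Rmult_le_compat_r (2 * (K + 1))) in Hal2; [|lra].
      replace (eps / (8 * (K + 1)) * (2 * (K + 1))) with (eps / 4) in Hal2 by (field; lra). lra. }
  rewrite R2.
  replace (RInt (fun w => h (- w)) al A + (RInt h (- al) al + RInt h al B) - (Lp + Lm)) with
   ((RInt (fun w => h (- w)) al A - Lm) + RInt h (- al) al + (RInt h al B - Lp)) by ring.
  eapply Rle_lt_trans; [apply Rabs_triang|].
  eapply Rle_lt_trans; [apply Rplus_le_compat_r, Rabs_triang|]. lra.
Qed.

(** Its integral over the whole line is 2 K_nu(z). The exponential in place of the hyperbolic cosine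
    of nu w becomes a plain power under t = q e^w. *)
Definition bessel_kernel (nu : C) (z w : R) : C :=
  Cmult (Cexp (Cmult nu (RtoC w))) (RtoC (exp (- (z * cosh w)))).

Lemma Ccontinuous_bessel_kernel (nu : C) (z w : R) : Ccontinuous (bessel_kernel nu z) w.
Proof.
  split; apply (ex_derive_continuous (V := R_NormedModule));
  unfold bessel_kernel, Cexp, cosh, Re, Im; simpl; unfold Re, Im; simpl; auto_derive; auto.
Qed.

Lemma exp_decay_majorant : integrable_majorant (fun w => exp (- w)) (2 * 1).
Proof.
  apply (majorant_of_primitive _ (fun w => - exp (- w)) (fun w => exp (- w))).
  - intros; split; [left; apply exp_pos|lra].
  - intros t _; apply (ex_derive_continuous (V := R_NormedModule)); auto_derive; auto.
  - intros t _; apply (ex_derive_continuous (V := R_NormedModule)); auto_derive; auto.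
  - intros t _. auto_derive; auto. ring.
  - intros t Ht. rewrite Rabs_Ropp, Rabs_pos_eq by (left; apply exp_pos).
    rewrite <- exp_0. left; apply exp_increasing; lra.
Qed.

Lemma integrable_majorant_scal (g : R -> R) (G c : R) : 0 <= c ->
  integrable_majorant g G -> integrable_majorant (fun t => c * g t) (c * G).
Proof.
  intros Hc Hg. pose proof (majorant_ex_RInt g G Hg) as Eg. destruct Hg as [H1 H2]. split.
  - intros t Ht. destruct (H1 t Ht) as [P Q]. split; [apply Rmult_le_pos; auto|].
    apply (continuous_scal_r (V := R_NormedModule) c g); auto.
  - intros a b Hab. rewrite (RInt_scal (V := R_CompleteNormedModule) g) by auto.
    unfold scal; simpl; unfold mult; simpl. apply Rmult_le_compat_l; auto.
Qed.

Lemma bessel_kernel_bound (nu : C) (z : R) : 0 < z ->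
  exists K, 0 <= K /\ forall w, 0 < w -> Cmod (bessel_kernel nu z w) <= K * exp (- w).
Proof.
  (* The factor e^(-(z/2) e^w) is at most a constant times e^(-pw); this p beats e^(w Re nu) and
     leaves e^(-w), for either sign of Re nu. *)
  intros Hz. set (p := Rabs (Re nu) + 1).
  assert (Hp : 0 < p) by (unfold p; pose proof (Rabs_pos (Re nu)); lra).
  set (M := exp (p * ln p - p)).
  exists (M * / Rpower (z / 2) p).
  assert (HR : 0 < Rpower (z / 2) p) by apply exp_pos.
  assert (HM : 0 < M) by apply exp_pos.
  split; [apply Rmult_le_pos; [lra|left; apply Rinv_0_lt_compat; auto]|].
  intros w Hw. unfold bessel_kernel.
  rewrite Cmod_mult, Cmod_Cexp, Cmod_R, Rabs_pos_eq by (left; apply exp_pos).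
  replace (Re (nu * RtoC w)%C) with (Re nu * w) by (unfold Re; simpl; ring).
  assert (Hy : 0 < z / 2 * exp w) by (apply Rmult_lt_0_compat; [lra|apply exp_pos]).
  assert (H := Rpower_exp_le p _ Hp Hy). fold M in H.
  assert (E : Rpower (z / 2 * exp w) p = Rpower (z / 2) p * exp (p * w)).
  { rewrite <- Rpower_mult_distr by (try lra; apply exp_pos). f_equal.
    unfold Rpower. rewrite ln_exp. auto. }
  rewrite E in H.
  assert (H1 : exp (- (z * cosh w)) <= exp (- (z / 2 * exp w))).
  { assert (A : - (z * cosh w) < - (z / 2 * exp w)).
    { unfold cosh. pose proof (exp_pos (- w)). nra. }
    left; apply exp_increasing; auto. }
  assert (H2 : exp (Re nu * w) <= exp (p * w) * exp (- w)).
  { rewrite <- exp_plus. assert (A : Re nu * w <= p * w + - w).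
    { unfold p. pose proof (Rle_abs (Re nu)). nra. }
    destruct A as [A|A]; [left; apply exp_increasing; auto|rewrite A; lra]. }
  pose proof (exp_pos (Re nu * w)). pose proof (exp_pos (- (z * cosh w))).
  pose proof (exp_pos (p * w)). pose proof (exp_pos (- w)). pose proof (exp_pos (- (z / 2 * exp w))).
  apply Rle_trans with (exp (p * w) * exp (- w) * exp (- (z / 2 * exp w))).
  - apply Rmult_le_compat; lra.
  - apply Rmult_le_reg_l with (Rpower (z / 2) p); auto.
    replace (Rpower (z / 2) p * (M * / Rpower (z / 2) p * exp (- w))) with (M * exp (- w)) by (field; lra).
    replace (Rpower (z / 2) p * (exp (p * w) * exp (- w) * exp (- (z / 2 * exp w)))) with
      (Rpower (z / 2) p * exp (p * w) * exp (- (z / 2 * exp w)) * exp (- w)) by ring.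
    apply Rmult_le_compat_r; lra.
Qed.

Lemma bessel_kernel_integrable (nu : C) (z : R) : 0 < z -> exists l, is_Cimp (bessel_kernel nu z) l.
Proof.
  intros Hz. destruct (bessel_kernel_bound nu z Hz) as [K [HK H]].
  apply (is_Cimp_dominated (bessel_kernel nu z) (fun w => K * exp (- w)) (K * (2 * 1))).
  - intros t _. apply Ccontinuous_bessel_kernel.
  - apply integrable_majorant_scal; auto. apply exp_decay_majorant.
  - exact H.
Qed.

Lemma BesselK_kernel (nu : C) (z : R) (lp lm : C) :
  is_Cimp (bessel_kernel nu z) lp -> is_Cimp (bessel_kernel (Copp nu) z) lm ->
  Cmult (RtoC 2) (BesselK nu z) = Cplus lp lm.
Proof.
  intros Hp Hm. pose proof (is_Cimp_scal (RtoC (/ 2)) _ _ (is_Cimp_plus _ _ _ _ Hp Hm)) as H.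
  assert (E : BesselK nu z = (RtoC (/ 2) * (lp + lm))%C).
  { apply is_Cimp_CInt. eapply is_Cimp_ext; [|exact H].
    intros t _. cbv beta. unfold bessel_kernel, Ccosh, Cexp.
    replace (Re (nu * RtoC t)%C) with (Re nu * t) by (unfold Re; simpl; ring).
    replace (Im (nu * RtoC t)%C) with (Im nu * t) by (unfold Re, Im; simpl; ring).
    replace (Re (- nu * RtoC t)%C) with (- (Re nu * t)) by (unfold Re; simpl; ring).
    replace (Im (- nu * RtoC t)%C) with (- (Im nu * t)) by (unfold Re, Im; simpl; ring).
    rewrite cos_neg, sin_neg, Ropp_mult_distr_l_reverse.
    generalize (exp (- (z * cosh t))). intros c. unfold cosh, sinh. Ceq; field. }
  rewrite E. rewrite Cmult_assoc, <- RtoC_mult. replace (2 * / 2) with 1 by field. ring.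
Qed.

(** Substitute t = q e^w with q = sqrt Y, so that t + Y / t = 2 q cosh w. The range w < 0 is the
    positive half-line for -nu. *)
Lemma is_Cimp_bessel (nu : C) (Y : R) : 0 < Y ->
  is_Cimp (fun t => Cmult (cpowR t (Cminus nu (RtoC 1))) (RtoC (exp (- t - Y / t))))
    (Cmult (RtoC 2) (Cmult (cpowR Y (Cdiv nu (RtoC 2))) (BesselK nu (2 * sqrt Y)))).
Proof.
  intros HY. set (q := sqrt Y). assert (Hq : 0 < q) by (apply sqrt_lt_R0; auto).
  assert (Hqq : q * q = Y) by (apply sqrt_sqrt; lra).
  destruct (bessel_kernel_integrable nu (2 * q)) as [lp Hp]; [lra|].
  destruct (bessel_kernel_integrable (Copp nu) (2 * q)) as [lm Hm]; [lra|].
  pose proof (BesselK_kernel nu (2 * q) lp lm Hp Hm) as EK.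
  assert (Hm' : is_Cimp (fun w => bessel_kernel nu (2 * q) (- w)) lm).
  { eapply is_Cimp_ext; [|exact Hm]. intros w _. unfold bessel_kernel. 
    replace (cosh (- w)) with (cosh w) by (unfold cosh; rewrite Ropp_involutive; f_equal; ring).
    rewrite RtoC_opp. f_equal. f_equal. ring. }
  assert (H : is_Cimp (fun t => Cmult (bessel_kernel nu (2 * q) (ln (t / q))) (RtoC (/ t))) (Cplus lp lm)).
  { split.
    - eapply improper_ext; [|exact (improper_exp_subst _ _ _ q Hq (fun w => proj1 (Ccontinuous_bessel_kernel nu (2 * q) w)) (proj1 Hp) (proj1 Hm'))].
      intros t _. cbv beta. unfold Rdiv, Re; simpl. ring.
    - eapply improper_ext; [|exact (improper_exp_subst _ _ _ q Hq (fun w => proj2 (Ccontinuous_bessel_kernel nu (2 * q) w)) (proj2 Hp) (proj2 Hm'))].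
      intros t _. cbv beta. unfold Rdiv, Im; simpl. ring. }
  apply (is_Cimp_scal (cpowR q nu)) in H.
  assert (Eq : cpowR Y (Cdiv nu (RtoC 2)) = cpowR q nu).
  { rewrite !cpowR_Cexp. f_equal. rewrite <- Hqq, ln_mult, RtoC_plus by auto. field. }
  rewrite Eq.
  replace (RtoC 2 * (cpowR q nu * BesselK nu (2 * q)))%C with (cpowR q nu * (lp + lm))%C by (rewrite <- EK; ring).
  eapply is_Cimp_ext; [|exact H].
  intros t Ht. cbv beta. unfold bessel_kernel.
  assert (Htq : 0 < t / q) by (apply Rdiv_lt_0_compat; auto).
  rewrite <- cpowR_Cexp.
  replace (- t - Y / t) with (- (2 * q * cosh (ln (t / q)))).
  2:{ unfold cosh. rewrite exp_Ropp, exp_ln by auto. rewrite <- Hqq. field. lra. }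
  replace (cpowR t (nu - RtoC 1)) with (cpowR q nu * cpowR (t / q) nu * RtoC (/ t))%C.
  - ring.
  - rewrite <- cpowR_mult by auto. replace (q * (t / q)) with t by (field; lra).
    replace (RtoC (/ t)) with (cpowR t (RtoC (- (1)))).
    + rewrite <- cpowR_plus. f_equal. rewrite RtoC_opp. ring.
    + rewrite cpowR_R, Rpower_Ropp, Rpower_1; auto.
Qed.

(* [k + 1 + d] powers of [u v] absorb [u^k] and leave the summable power [-(1 + d)] in each index. *)
Lemma lattice_power_bound (k : nat) (d rho u v y z A : R) :
  0 < d -> 0 < rho -> 1 <= y -> 1 <= z -> rho * y <= u -> rho * z <= v -> 0 < A ->
  u ^ k * Rpower (A * (u * v)) (- (INR k + 1 + d)) <=
  Rpower A (- (INR k + 1 + d)) * (Rpower rho (- (1 + d)) * Rpower rho (- (INR k + 1 + d)))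
    * (Rpower y (- (1 + d)) * Rpower z (- (1 + d))).
Proof.
  intros Hd Hr Hy Hz Hu Hv HA. set (p := INR k + 1 + d).
  assert (Hk := pos_INR k).
  assert (Hry : 0 < rho * y) by (apply Rmult_lt_0_compat; lra).
  assert (Hrz : 0 < rho * z) by (apply Rmult_lt_0_compat; lra).
  assert (mono : forall a b e, 0 < a -> a <= b -> 0 <= e -> Rpower b (- e) <= Rpower a (- e)).
  { intros a b e Ha Hab He. rewrite !Rpower_Ropp. apply Rinv_le_contravar; [apply exp_pos|].
    apply Rle_Rpower_l; auto. }
  rewrite <- !Rpower_mult_distr by (auto; try apply Rmult_lt_0_compat; lra).
  assert (E1 : u ^ k * Rpower u (- p) = Rpower u (- (1 + d))).
  { rewrite <- Rpower_pow, <- Rpower_plus by lra. f_equal. unfold p. ring. }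
  replace (u ^ k * (Rpower A (- p) * (Rpower u (- p) * Rpower v (- p)))) with
    (Rpower A (- p) * (u ^ k * Rpower u (- p) * Rpower v (- p))) by ring.
  rewrite E1.
  rewrite Rmult_assoc. apply Rmult_le_compat_l; [left; apply exp_pos|].
  replace (Rpower rho (- (1 + d)) * Rpower rho (- p) * (Rpower y (- (1 + d)) * Rpower z (- (1 + d)))) with
    ((Rpower rho (- (1 + d)) * Rpower y (- (1 + d))) * (Rpower rho (- p) * Rpower z (- (1 + d)))) by ring.
  apply Rmult_le_compat; try (left; apply exp_pos).
  - rewrite Rpower_mult_distr by lra. apply mono; auto; lra.
  - apply Rle_trans with (Rpower (rho * z) (- p)).
    + apply mono; auto; unfold p; lra.
    + rewrite <- Rpower_mult_distr by lra. apply Rmult_le_compat_l; [left; apply exp_pos|].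
      apply Rle_Rpower; auto. unfold p; lra.
Qed.

(** At most n + 1 divisors, each contributing at most (n + 1)^k. *)
Lemma divisor_coeff_bound (k n : nat) (theta psi : R) :
  Rabs (divisor_coeff k theta psi (S n)) <= (INR n + 1) ^ (k + 1).
Proof.
  unfold divisor_coeff, divsum. simpl pred.
  eapply Rle_trans; [apply Rsum_abs|].
  apply Rle_trans with (sum_f_R0 (fun _ => (INR n + 1) ^ k) n).
  - apply sum_Rle. intros i Hi.
    assert (Hn : 0 <= (INR n + 1) ^ k) by (apply pow_le; pose proof (pos_INR n); lra).
    destruct (Nat.eqb (S n mod S i) 0); [|rewrite Rabs_R0; auto].
    assert (sb : forall x, Rabs (sin x) <= 1) by (intros; apply Rabs_le, SIN_bound).
    rewrite !Rabs_mult, (Rabs_pos_eq (INR (S i) ^ k)) by (apply pow_le, pos_INR).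
    rewrite Rmult_assoc.
    apply Rle_trans with (INR (S i) ^ k * 1).
    + apply Rmult_le_compat_l; [apply pow_le, pos_INR|].
      rewrite <- (Rmult_1_r 1). apply Rmult_le_compat; auto using Rabs_pos.
    + rewrite Rmult_1_r. apply pow_incr. split; [apply pos_INR|]. rewrite S_INR. apply le_INR in Hi. lra.
  - rewrite sum_cte, S_INR, Nat.add_1_r. simpl. lra.
Qed.

(** * Integrating the identity *)

Lemma divisor_bessel_integral (k : nat) (nu : C) (X theta psi : R) : 0 < X -> 0 < Re nu ->
  let L := fun n => Cmult (RtoC (divisor_coeff k theta psi (S n)))
     (Cmult (RtoC 2) (Cmult (cpowR (INR (S n) * X) (Cdiv nu (RtoC 2))) (BesselK nu (2 * sqrt (INR (S n) * X))))) in
  is_Cseries L (CSeries L) /\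
  is_Cimp (fun t => Cmult (Cmult (cpowR t (Cminus nu (RtoC 1))) (RtoC (exp (- t))))
     (RtoC (Series (fun n => divisor_coeff k theta psi (S n) * exp (- (INR (S n) * (X / t))))))) (CSeries L).
Proof.
  intros HX Hnu L.
  (* From e^(-y) <= C0 y^(-N) at y = n X / t: the factor n^(-N) turns the coefficient bound n^(k+1)
     into n^(-2), and t^N only raises the exponent of the gamma majorant. *)
  set (N := (k + 3)%nat). set (p := INR N).
  assert (Hp : 0 < p) by (apply lt_0_INR; unfold N; lia).
  set (C0 := exp (p * ln p - p)). assert (HC0 : 0 < C0) by apply exp_pos.
  destruct (gamma_majorant (Re nu + p)) as [G HG]; [lra|].
  assert (HXN : 0 < X ^ N) by (apply pow_lt; auto).
  apply (is_Cimp_Series _ (fun n t => divisor_coeff k theta psi (S n) * exp (- (INR (S n) * (X / t)))) L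
    (fun n => C0 * / X ^ N * Rpower (INR n + 1) (- (1 + 1))) _ G) with (2 := HG).
  - intros n. assert (HS : 0 < INR (S n)) by (apply lt_0_INR; lia).
    assert (HY : 0 < INR (S n) * X) by (apply Rmult_lt_0_compat; auto).
    pose proof (is_Cimp_scal (RtoC (divisor_coeff k theta psi (S n))) _ _ (is_Cimp_bessel nu _ HY)) as H.
    eapply is_Cimp_ext; [|exact H]. intros t Ht. cbv beta.
    replace (- t - INR (S n) * X / t) with (- t + - (INR (S n) * (X / t))) by (unfold Rdiv; ring).
    rewrite exp_plus, !RtoC_mult. ring.
  - intros n t Ht. rewrite Cmod_mult, Cmod_cpowR, Cmod_R, (Rabs_pos_eq (exp (- t))) by (left; apply exp_pos).
    rewrite Rabs_mult, (Rabs_pos_eq (exp (- (INR (S n) * (X / t))))) by (left; apply exp_pos).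
    replace (Re (nu - RtoC 1)%C) with (Re nu - 1) by (unfold Re; simpl; ring).
    assert (HS : 0 < INR (S n)) by (apply lt_0_INR; lia).
    set (y := INR (S n) * (X / t)).
    assert (Hy : 0 < y) by (apply Rmult_lt_0_compat; auto; apply Rdiv_lt_0_compat; auto).
    assert (H := Rpower_exp_le p y Hp Hy). fold C0 in H. unfold p in H. rewrite Rpower_pow in H by auto.
    assert (Hc := divisor_coeff_bound k n theta psi). rewrite <- S_INR in *. set (s := INR (S n)) in *.
    set (dc := Rabs (divisor_coeff k theta psi (S n))) in *.
    assert (Hdc : 0 <= dc) by apply Rabs_pos.
    assert (E1 : Rpower t (Re nu + p - 1) = Rpower t (Re nu - 1) * t ^ N).
    { rewrite <- Rpower_pow, <- Rpower_plus by auto. f_equal. unfold p. ring. }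
    rewrite E1.
    assert (E2 : Rpower s (- (1 + 1)) = s ^ (k + 1) * / s ^ N).
    { rewrite Rpower_Ropp. replace (1 + 1) with (INR 2) by (simpl; ring). rewrite Rpower_pow by auto.
      unfold N. replace (k + 3)%nat with ((k + 1) + 2)%nat by lia. rewrite (pow_add s (k + 1) 2).
      assert (s ^ (k + 1) <> 0) by (apply pow_nonzero; lra). assert (s ^ 2 <> 0) by (apply pow_nonzero; lra).
      field. split; [lra | auto]. }
    rewrite E2.
    assert (HtN : 0 < t ^ N) by (apply pow_lt; auto). assert (HsN : 0 < s ^ N) by (apply pow_lt; auto).
    assert (E3 : y ^ N = s ^ N * X ^ N * / t ^ N).
    { unfold y, Rdiv. rewrite !Rpow_mult_distr, pow_inv. ring. }
    rewrite E3 in H.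
    assert (H2 : exp (- y) <= C0 * t ^ N * / X ^ N * / s ^ N).
    { apply Rmult_le_reg_l with (s ^ N * X ^ N * / t ^ N).
      - repeat apply Rmult_lt_0_compat; auto. apply Rinv_0_lt_compat; auto.
      - replace (s ^ N * X ^ N * / t ^ N * (C0 * t ^ N * / X ^ N * / s ^ N)) with C0 by (field; lra). auto. }
    set (r1 := Rpower t (Re nu - 1)). assert (Hr1 : 0 < r1) by apply exp_pos.
    pose proof (exp_pos (- t)). pose proof (exp_pos (- y)).
    apply Rle_trans with (r1 * exp (- t) * (s ^ (k + 1) * (C0 * t ^ N * / X ^ N * / s ^ N))).
    + apply Rmult_le_compat_l; [apply Rmult_le_pos; lra|]. apply Rmult_le_compat; lra.
    + right. ring.
  - intros n. apply Rmult_le_pos; [|left; apply exp_pos].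
    apply Rmult_le_pos; [lra|left; apply Rinv_0_lt_compat; auto].
  - apply ex_series_zeta2.
Qed.

Lemma lattice_integral (k : nat) (nu : C) (c theta psi : R) :
  0 < c -> 0 < Re nu -> 0 < theta < 1 -> 0 < psi < 1 ->
  let s := Cplus nu (RtoC (INR k + 1)) in
  let T := fun u v => Cdiv (RtoC (u ^ k)) (cpowR (c * (u * v) + 1) s) in
  is_Cimp (fun t => Cmult (Cmult (cpowR t (Cminus s (RtoC 1))) (RtoC (exp (- t))))
     (RtoC (Series (fun m => Series (fun n => quad_term k (c * t) theta psi m n)))))
    (Cmult (CGamma s) (CSeries (fun m => CSeries (fun n =>
         Cplus (Cminus (Cminus
           (T (INR n + psi) (INR m + theta))
           (T (INR n + 1 - psi) (INR m + theta)))
           (T (INR n + psi) (INR m + 1 - theta)))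
           (T (INR n + 1 - psi) (INR m + 1 - theta)))))).
Proof.
  intros Hc Hnu Hth Hps s T.
  pose proof (pos_INR k) as Hk0.
  (* Re s = k + 1 + 2d is divided as p + d: the power -p of the lattice point gives convergence in
     both indices, and the remaining d gives integrability at t = 0. *)
  set (d := Re nu / 2). assert (Hd : 0 < d) by (unfold d; lra).
  set (p := INR k + 1 + d). assert (Hp : 0 < p) by (unfold p; lra).
  assert (Hs : Re s = Re nu + INR k + 1) by (unfold s, Re; simpl; ring).
  set (rho := Rmin (Rmin theta (1 - theta)) (Rmin psi (1 - psi))).
  assert (Hrho : 0 < rho) by (repeat apply Rmin_pos; lra).
  assert (Hr1 : rho <= theta) by (eapply Rle_trans; [apply Rmin_l|apply Rmin_l]).
  assert (Hr2 : rho <= 1 - theta) by (eapply Rle_trans; [apply Rmin_l|apply Rmin_r]).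
  assert (Hr3 : rho <= psi) by (eapply Rle_trans; [apply Rmin_r|apply Rmin_l]).
  assert (Hr4 : rho <= 1 - psi) by (eapply Rle_trans; [apply Rmin_r|apply Rmin_r]).
  clearbody rho.
  set (B := fun n => Rpower (INR n + 1) (- (1 + d))).
  assert (HB0 : forall n, 0 <= B n) by (intros; left; apply exp_pos).
  assert (eB : ex_series B) by (apply ex_series_zeta; auto).
  set (Kr := Rpower rho (- (1 + d)) * Rpower rho (- p)).
  assert (HKr : 0 < Kr) by (apply Rmult_lt_0_compat; apply exp_pos).
  set (Kc := Rpower c (- p)). assert (HKc : 0 < Kc) by apply exp_pos.
  set (C0 := exp (p * ln p - p)). assert (HC0 : 0 < C0) by apply exp_pos.
  (* One lower bound common to the four shifts, so that every term meets the hypotheses of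
     [lattice_power_bound]. *)
  set (far := fun (n : nat) u => rho * (INR n + 1) <= u).
  assert (f1 : forall n, far n (INR n + theta)) by (intros n; unfold far; pose proof (pos_INR n); nra).
  assert (f2 : forall n, far n (INR n + 1 - theta)) by (intros n; unfold far; pose proof (pos_INR n); nra).
  assert (f3 : forall n, far n (INR n + psi)) by (intros n; unfold far; pose proof (pos_INR n); nra).
  assert (f4 : forall n, far n (INR n + 1 - psi)) by (intros n; unfold far; pose proof (pos_INR n); nra).
  assert (far0 : forall n u, far n u -> 0 < u).
  { intros n u Hu. apply Rlt_le_trans with (2 := Hu). pose proof (pos_INR n). apply Rmult_lt_0_compat; lra. }
  assert (HLB : forall A m n u v, 0 < A -> far n u -> far m v ->
     u ^ k * Rpower (A * (u * v)) (- p) <= Rpower A (- p) * Kr * (B n * B m)).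
  { intros A m n u v HA Hu Hv. pose proof (pos_INR n). pose proof (pos_INR m).
    apply (lattice_power_bound k d rho u v (INR n + 1) (INR m + 1) A); auto; lra. }
  (* The base is at least 1, so its exponent may be lowered from Re s to p. *)
  assert (HT : forall m n u v, far n u -> far m v -> Cmod (T u v) <= Kc * Kr * (B n * B m)).
  { intros m n u v Hu Hv. pose proof (far0 _ _ Hu). pose proof (far0 _ _ Hv).
    eapply Rle_trans; [|apply (HLB c m n u v Hc Hu Hv)]. unfold T.
    assert (Hcuv : 0 < c * (u * v)) by (repeat apply Rmult_lt_0_compat; auto).
    rewrite Cmod_div, Cmod_R, Cmod_cpowR by apply cpowR_neq_0.
    rewrite Rabs_pos_eq by (apply pow_le; lra).
    apply Rmult_le_compat_l; [apply pow_le; lra|].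
    rewrite Rpower_Ropp. apply Rinv_le_contravar; [apply exp_pos|].
    apply Rle_trans with (Rpower (c * (u * v) + 1) p).
    - apply Rle_Rpower_l; lra.
    - apply Rle_Rpower; [lra|]. rewrite Hs. unfold p, d. lra. }
  (* Trading the exponential for the power -p separates t from the two indices. *)
  assert (HE : forall t m n u v, 0 < t -> far n u -> far m v ->
     Rabs (u ^ k * exp (- (c * t * (u * v)))) <= C0 * Kc * Kr * (B n * B m) * Rpower t (- p)).
  { intros t m n u v Ht Hu Hv. pose proof (far0 _ _ Hu). pose proof (far0 _ _ Hv).
    assert (Hct : 0 < c * t) by (apply Rmult_lt_0_compat; auto).
    set (y := c * t * (u * v)).
    assert (Hy : 0 < y) by (repeat apply Rmult_lt_0_compat; auto).
    assert (H2 := Rpower_exp_le p y Hp Hy). fold C0 in H2.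
    assert (H3 : exp (- y) <= C0 * Rpower y (- p)).
    { apply Rmult_le_reg_l with (Rpower y p); [apply exp_pos|].
      rewrite Rpower_Ropp. assert (0 < Rpower y p) by apply exp_pos.
      replace (Rpower y p * (C0 * / Rpower y p)) with C0 by (field; lra). auto. }
    assert (H4 := HLB (c * t) m n u v Hct Hu Hv). fold y in H4.
    rewrite <- Rpower_mult_distr in H4 by auto. fold Kc in H4.
    assert (Huk : 0 <= u ^ k) by (apply pow_le; lra).
    rewrite Rabs_pos_eq by (apply Rmult_le_pos; auto; left; apply exp_pos).
    apply Rle_trans with (C0 * (u ^ k * Rpower y (- p))).
    - replace (C0 * (u ^ k * Rpower y (- p))) with (u ^ k * (C0 * Rpower y (- p))) by ring.
      apply Rmult_le_compat_l; auto.
    - replace (C0 * Kc * Kr * (B n * B m) * Rpower t (- p)) with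
        (C0 * (Kc * Rpower t (- p) * Kr * (B n * B m))) by ring.
      apply Rmult_le_compat_l; lra. }
  clearbody Kr Kc C0.
  set (D := fun m n => Cplus (Cminus (Cminus
           (T (INR n + psi) (INR m + theta))
           (T (INR n + 1 - psi) (INR m + theta)))
           (T (INR n + psi) (INR m + 1 - theta)))
           (T (INR n + 1 - psi) (INR m + 1 - theta))).
  assert (HD : forall m n, Cmod (D m n) <= 4 * Kc * Kr * B m * B n).
  { intros m n. unfold D, Cminus.
    eapply Rle_trans; [apply Cmod_triangle|].
    eapply Rle_trans; [apply Rplus_le_compat_r, Cmod_triangle|].
    eapply Rle_trans; [apply Rplus_le_compat_r, Rplus_le_compat_r, Cmod_triangle|].
    rewrite !Cmod_opp.
    pose proof (HT m n _ _ (f3 n) (f1 m)). pose proof (HT m n _ _ (f4 n) (f1 m)).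
    pose proof (HT m n _ _ (f3 n) (f2 m)). pose proof (HT m n _ _ (f4 n) (f2 m)). lra. }
  assert (HQ : forall t m n, 0 < t ->
    Rabs (quad_term k (c * t) theta psi m n) <= 4 * C0 * Kc * Kr * B m * B n * Rpower t (- p)).
  { intros t m n Ht. unfold quad_term, alt_pair.
    pose proof (HE t m n _ _ Ht (f3 n) (f1 m)) as A1. pose proof (HE t m n _ _ Ht (f4 n) (f1 m)) as A2.
    pose proof (HE t m n _ _ Ht (f3 n) (f2 m)) as A3. pose proof (HE t m n _ _ Ht (f4 n) (f2 m)) as A4.
    apply Rabs_le_between in A1. apply Rabs_le_between in A2.
    apply Rabs_le_between in A3. apply Rabs_le_between in A4.
    apply Rabs_le. lra. }
  set (Phi := fun t => Cmult (cpowR t (Cminus s (RtoC 1))) (RtoC (exp (- t)))).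
  (* What remains of the weight after the loss of t^(-p) is the gamma density of parameter d, the
     common majorant for both summations. *)
  assert (HPhi : forall t, 0 < t -> Cmod (Phi t) * Rpower t (- p) = Rpower t (d - 1) * exp (- t)).
  { intros t Ht. unfold Phi. rewrite Cmod_mult, Cmod_cpowR, Cmod_R, Rabs_pos_eq by (left; apply exp_pos).
    replace (d - 1) with (Re (s - RtoC 1)%C + - p).
    - rewrite Rpower_plus. ring.
    - replace (Re (s - RtoC 1)%C) with (Re s - 1) by (unfold Re; simpl; ring). rewrite Hs. unfold p, d. field. }
  assert (HI : forall u v, 0 < u -> 0 < v ->
    is_Cimp (fun t => Cmult (Phi t) (RtoC (u ^ k * exp (- (c * t * (u * v)))))) (Cmult (CGamma s) (T u v))).
  { intros u v Hu Hv.
    assert (Hb : 0 < c * (u * v) + 1) by (assert (0 < c * (u * v)) by (repeat apply Rmult_lt_0_compat; auto); lra).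
    assert (Hs0 : 0 < Re s) by (rewrite Hs; lra).
    pose proof (is_Cimp_scal (RtoC (u ^ k)) _ _ (is_Cimp_CGamma_scale s _ Hs0 Hb)) as H.
    unfold T. replace (CGamma s * (RtoC (u ^ k) / cpowR (c * (u * v) + 1) s))%C with
      (RtoC (u ^ k) * (CGamma s / cpowR (c * (u * v) + 1) s))%C by (unfold Cdiv; ring).
    eapply is_Cimp_ext; [|exact H]. intros t Ht. cbv beta. unfold Phi.
    replace (- ((c * (u * v) + 1) * t)) with (- t + - (c * t * (u * v))) by ring.
    rewrite exp_plus, !RtoC_mult. ring. }
  destruct (gamma_majorant d Hd) as [G HG].
  assert (H1 : forall m,
    is_Cimp (fun t => Cmult (Phi t) (RtoC (Series (fun n => quad_term k (c * t) theta psi m n))))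
      (CSeries (fun n => Cmult (CGamma s) (D m n)))).
  { intros m.
    apply (is_Cimp_Series Phi (fun n t => quad_term k (c * t) theta psi m n) _
      (fun n => 4 * C0 * Kc * Kr * B m * B n) _ G) with (2 := HG).
    - intros n.
      pose proof (HI _ _ (far0 _ _ (f3 n)) (far0 _ _ (f1 m))) as I1.
      pose proof (HI _ _ (far0 _ _ (f4 n)) (far0 _ _ (f1 m))) as I2.
      pose proof (HI _ _ (far0 _ _ (f3 n)) (far0 _ _ (f2 m))) as I3.
      pose proof (HI _ _ (far0 _ _ (f4 n)) (far0 _ _ (f2 m))) as I4.
      apply (is_Cimp_scal (RtoC (-1))) in I2. apply (is_Cimp_scal (RtoC (-1))) in I3.
      pose proof (is_Cimp_plus _ _ _ _ (is_Cimp_plus _ _ _ _ (is_Cimp_plus _ _ _ _ I1 I2) I3) I4) as I.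
      match type of I with is_Cimp _ ?l => replace (Cmult (CGamma s) (D m n)) with l by (unfold D; ring) end.
      eapply is_Cimp_ext; [|exact I]. intros t Ht. cbv beta. unfold quad_term, alt_pair.
      rewrite !RtoC_minus. ring.
    - intros n t Ht.
      apply Rle_trans with (Cmod (Phi t) * (4 * C0 * Kc * Kr * B m * B n * Rpower t (- p))).
      + apply Rmult_le_compat_l; [apply Cmod_ge_0 | auto].
      + rewrite <- HPhi by auto. right. ring.
    - intros n. pose proof (HB0 m). pose proof (HB0 n). repeat apply Rmult_le_pos; lra.
    - apply (ex_series_scal_l (V := R_NormedModule)); auto. }
  (* The sum over n was taken under the integral first; the resulting series now serve as terms for
     the sum over m. *)
  destruct (is_Cimp_Series Phi (fun m t => Series (fun n => quad_term k (c * t) theta psi m n)) _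
      (fun m => 4 * C0 * Kc * Kr * Series B * B m) _ G H1 HG) as [_ H2].
  - intros m t Ht.
    apply Rle_trans with (Cmod (Phi t) * (4 * C0 * Kc * Kr * Series B * B m * Rpower t (- p))).
    + apply Rmult_le_compat_l; [apply Cmod_ge_0|].
      replace (4 * C0 * Kc * Kr * Series B * B m * Rpower t (- p)) with
        (4 * C0 * Kc * Kr * B m * Rpower t (- p) * Series B) by ring.
      rewrite <- Series_scal_l. apply Series_abs_le.
      * intros n. eapply Rle_trans; [apply HQ; auto|]. right; ring.
      * apply (ex_series_scal_l (V := R_NormedModule)); auto.
    + rewrite <- HPhi by auto. right. ring.
  - intros m. pose proof (HB0 m). pose proof (Series_pos B HB0 eB). repeat apply Rmult_le_pos; lra.
  - apply (ex_series_scal_l (V := R_NormedModule)); auto.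
  - assert (eD : forall m, is_Cseries (D m) (CSeries (D m))).
    { intros m. apply CSeries_correct with (1 := HD m).
      apply (ex_series_scal_l (V := R_NormedModule)); auto. }
    assert (E1 : forall m, CSeries (fun n => Cmult (CGamma s) (D m n)) = Cmult (CGamma s) (CSeries (D m))).
    { intros m. apply is_Cseries_unique, is_Cseries_scal, eD. }
    assert (eD2 : is_Cseries (fun m => CSeries (D m)) (CSeries (fun m => CSeries (D m)))).
    { apply CSeries_correct with (b := fun m => 8 * Kc * Kr * Series B * B m).
      - intros m. eapply Rle_trans; [apply (CSeries_abs_le _ _ (HD m))|].
        + apply (ex_series_scal_l (V := R_NormedModule)); auto.
        + rewrite Series_scal_l. right; ring.
      - apply (ex_series_scal_l (V := R_NormedModule)); auto. }
    rewrite (CSeries_ext _ _ E1) in H2.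
    rewrite (is_Cseries_unique _ _ (is_Cseries_scal (CGamma s) _ _ eD2)) in H2.
    exact H2.
Qed.

Lemma quad_term_divisor_series (j : nat) (tau theta psi : R) :
  0 < tau -> 0 < theta < 1 -> 0 < psi < 1 ->
  let k := (2 * j + 1)%nat in
  Series (fun m => Series (fun n => quad_term k tau theta psi m n)) =
  -4 * ((-1) ^ (j + 1) * (2 * PI / tau) ^ (k + 1)) *
  Series (fun n => divisor_coeff k theta psi (S n) * exp (- (INR (S n) * (4 * PI ^ 2 / tau)))).
Proof.
  intros Ht Hth Hp k. unfold k. rewrite quad_term_series by auto.
  rewrite divisor_series; auto.
  pose proof PI_RGT_0. apply Rdiv_lt_0_compat; auto. nra.
Qed.

Theorem theorem2p12 (a x theta psi : R) (k : nat) (nu : C)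
  (ha : 0 < a) (hx : 0 < x) (ht0 : 0 < theta) (ht1 : theta < 1)
  (hp0 : 0 < psi) (hp1 : psi < 1) (hk : (1 <= k)%nat) (hkodd : Nat.Odd k)
  (hnu : 0 < Re nu) :
  let s : C := Cplus nu (RtoC (INR k + 1)) in
  let T (u v : R) : C :=
    Cdiv (RtoC (u ^ k)) (cpowR (16 * PI ^ 2 / a ^ 2 * (u * v) / x + 1) s) in
  Cmult (cpowR (a ^ 2 * x / 4) (Cplus (Cdiv nu (RtoC 2)) (RtoC (INR k + 1))))
    (CSeries (fun n0 =>
       let n := S n0 in
       Cmult (Cmult (cpowR (INR n) (Cdiv nu (RtoC 2))) (BesselK nu (a * sqrt (INR n * x))))
         (RtoC (divsum n (fun d =>
            INR d ^ k * sin (2 * PI * INR d * theta) * sin (2 * PI * INR n * psi / INR d))))))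
  =
  Cmult (RtoC (- (-1) ^ ((k + 1) / 2) * (2 * PI) ^ (k + 1) / 8))
    (Cmult (CGamma s)
      (CSeries (fun m => CSeries (fun n =>
         Cplus (Cminus (Cminus
           (T (INR n + psi) (INR m + theta))
           (T (INR n + 1 - psi) (INR m + theta)))
           (T (INR n + psi) (INR m + 1 - theta)))
           (T (INR n + 1 - psi) (INR m + 1 - theta)))))).
Proof.
  intros s T.
  pose proof PI_RGT_0 as Hpi.
  destruct hkodd as [j Hj].
  set (X := a ^ 2 * x / 4).
  assert (Ha2 : 0 < a ^ 2) by (apply pow_lt; auto).
  assert (HX : 0 < X) by (unfold X; apply Rdiv_lt_0_compat; [apply Rmult_lt_0_compat|]; lra).
  set (c := 4 * PI ^ 2 / X).
  assert (Hc : 0 < c) by (unfold c; apply Rdiv_lt_0_compat; auto; nra).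
  assert (HPI2 : 0 < PI ^ 2) by (apply pow_lt; auto).
  destruct (divisor_bessel_integral k nu X theta psi HX hnu) as [HL1 HL2].
  set (L := fun n => Cmult (RtoC (divisor_coeff k theta psi (S n)))
     (Cmult (RtoC 2) (Cmult (cpowR (INR (S n) * X) (Cdiv nu (RtoC 2))) (BesselK nu (2 * sqrt (INR (S n) * X)))))) in *.
  pose proof (lattice_integral k nu c theta psi Hc hnu (conj ht0 ht1) (conj hp0 hp1)) as HR.
  cbv zeta in HR. fold s in HR.
  set (q := -4 * ((-1) ^ (j + 1) * (2 * PI / c) ^ (k + 1))).
  assert (key := is_Cimp_scal (RtoC q) _ _ HL2).
  (* At tau = c t the identity carries a factor t^(-(k+1)), which lowers t^(s-1) to t^(nu-1); the
     constant left over is [q]. *)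
  assert (Epoint : forall t, 0 < t ->
    Cmult (RtoC q) (Cmult (Cmult (cpowR t (Cminus nu (RtoC 1))) (RtoC (exp (- t))))
     (RtoC (Series (fun n => divisor_coeff k theta psi (S n) * exp (- (INR (S n) * (X / t))))))) =
    Cmult (Cmult (cpowR t (Cminus s (RtoC 1))) (RtoC (exp (- t))))
     (RtoC (Series (fun m => Series (fun n => quad_term k (c * t) theta psi m n))))).
  { intros t Ht. assert (Hct : 0 < c * t) by (apply Rmult_lt_0_compat; auto).
    pose proof (quad_term_divisor_series j (c * t) theta psi Hct (conj ht0 ht1) (conj hp0 hp1)) as E.
    cbv zeta in E. rewrite <- Hj in E. rewrite E.
    replace (4 * PI ^ 2 / (c * t)) with (X / t) by (unfold c; field; lra).
    replace (cpowR t (s - RtoC 1)) with (cpowR t (nu - RtoC 1) * RtoC (t ^ (k + 1)))%C.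
    2:{ rewrite <- Rpower_pow, <- cpowR_R, <- cpowR_plus by auto. f_equal. unfold s.
        rewrite Nat.add_1_r, S_INR. ring. }
    replace q with (t ^ (k + 1) * (-4 * ((-1) ^ (j + 1) * (2 * PI / (c * t)) ^ (k + 1)))).
    - rewrite !RtoC_mult. ring.
    - unfold q, Rdiv. rewrite Rinv_mult, !Rpow_mult_distr, !pow_inv.
      assert (t ^ (k + 1) <> 0) by (apply pow_nonzero; lra).
      assert (c ^ (k + 1) <> 0) by (apply pow_nonzero; lra). field. auto. }
  apply (is_Cimp_ext _ _ _ Epoint) in key.
  assert (Efin := is_Cimp_unique _ _ _ key HR).
  assert (ET : T = fun u v => Cdiv (RtoC (u ^ k)) (cpowR (c * (u * v) + 1) s)).
  { apply functional_extensionality; intros u; apply functional_extensionality; intros v.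
    unfold T. f_equal. f_equal. unfold c, X. field. lra. }
  rewrite ET.
  rewrite <- Efin.
  pose proof (cpowR_neq_0 X (Cdiv nu (RtoC 2))) as NX.
  assert (N2 : RtoC 2 <> RtoC 0) by (intros E; apply RtoC_inj in E; lra).
  assert (Elhs : CSeries (fun n0 =>
       let n := S n0 in
       Cmult (Cmult (cpowR (INR n) (Cdiv nu (RtoC 2))) (BesselK nu (a * sqrt (INR n * x))))
         (RtoC (divsum n (fun d =>
            INR d ^ k * sin (2 * PI * INR d * theta) * sin (2 * PI * INR n * psi / INR d)))))
     = Cmult (Cinv (Cmult (RtoC 2) (cpowR X (Cdiv nu (RtoC 2))))) (CSeries L)).
  { apply is_Cseries_unique.
    eapply is_Cseries_ext; [|exact (is_Cseries_scal (Cinv (Cmult (RtoC 2) (cpowR X (Cdiv nu (RtoC 2))))) _ _ HL1)].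
    intros n. cbv zeta beta. unfold L. fold (divisor_coeff k theta psi (S n)).
    assert (HS : 0 < INR (S n)) by (apply lt_0_INR; lia).
    rewrite cpowR_mult by auto.
    replace (2 * sqrt (INR (S n) * X)) with (a * sqrt (INR (S n) * x)).
    - field. auto.
    - replace (INR (S n) * X) with ((a / 2) ^ 2 * (INR (S n) * x)) by (unfold X; field).
      rewrite (sqrt_mult ((a / 2) ^ 2)) by first [apply pow2_ge_0 | apply Rmult_le_pos; lra].
      rewrite sqrt_pow2 by lra. field. }
  rewrite Elhs, cpowR_plus, cpowR_R.
  replace (Rpower X (INR k + 1)) with (X ^ (k + 1))
    by (rewrite <- Rpower_pow, Nat.add_1_r, S_INR by auto; reflexivity).
  replace ((k + 1) / 2)%nat with (j + 1)%nat
    by (rewrite Hj; replace (2 * j + 1 + 1)%nat with ((j + 1) * 2)%nat by lia; rewrite Nat.div_mul; lia).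
  (* As 2 pi / c = X / (2 pi), q is -4 (-1)^(j+1) (X / (2 pi))^(k+1); the signs square to 1 and 4 /
     8 is the factor 1/2 of the Bessel integral. *)
  replace (RtoC (- (-1) ^ (j + 1) * (2 * PI) ^ (k + 1) / 8) * (RtoC q * CSeries L))%C with
    (RtoC (X ^ (k + 1) / 2) * CSeries L)%C.
  - replace (X ^ (k + 1) / 2) with (X ^ (k + 1) * / 2) by reflexivity.
    rewrite RtoC_mult, RtoC_inv by lra. field. auto.
  - rewrite Cmult_assoc, <- RtoC_mult. f_equal. f_equal. unfold q, c.
    replace (2 * PI / (4 * PI ^ 2 / X)) with (X * / (2 * PI)) by (field; lra).
    rewrite (Rpow_mult_distr X), pow_inv.
    assert (Hsq : (-1) ^ (j + 1) * (-1) ^ (j + 1) = 1).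
    { rewrite <- Rpow_mult_distr. replace (-1 * -1) with 1 by ring. apply pow1. }
    assert (NP : (2 * PI) ^ (k + 1) <> 0) by (apply pow_nonzero; lra).
    set (e := (-1) ^ (j + 1)) in *. set (P := (2 * PI) ^ (k + 1)) in *.
    transitivity ((e * e) * (X ^ (k + 1) / 2)); [rewrite Hsq; ring | field; auto].
Qed.
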